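(* Let $v_0$ be a bounded real-valued measurable function on $\mathbb T$, let $\{\mu_N\}_{N\in\mathbb N}$ be a sequence of probability measures on $\Omega_N$ associated to $v_0$, and assume that $\{\mu_N\}_{N\in\mathbb N}$ satisfies Assumption (IM) (stated in the context). Assume moreover that $\alpha_N=\alpha N^{-\kappa}$ with $\kappa=1$. Let $m>5/2$ be an integer. Then, for every $t\in[0,T]$, the sequence of empirical measures $\{\pi^{v,N}_t\}_{N\in\mathbb N}$ converges in probability to the absolutely continuous measure $v(t,u)du$; that is, for any $\delta>0$ and any $G\in C^2(\mathbb T)$, $$\lim_{N\to\infty}Q^{v,N}_m\Big(\Big|\langle\pi^{v,N}_t,G\rangle-\int_{\mathbb T}v(t,u)G(u)\,du\Big|>\delta\Big)=0,$$ where $v(t,u)$ is the unique weak solution of $\partial_tv=\Delta v+2\alpha\nabla v$ with $v(0,\cdot)=v_0$.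
   Context: Notation. $\mathbb T_N=\mathbb Z/N\mathbb Z$, $\mathbb T=\mathbb R/\mathbb Z$, $T>0$ is a fixed time horizon. For $g:\mathbb T_N\to\mathbb R$ set $\nabla^Ng(x)=N(g(x+1)-g(x))$ and $\Delta_N^{(1)}g(x)=N^2(g(x+1)+g(x-1)-2g(x))$. Model. $\Omega_N=\mathbb R^{\mathbb T_N}$, $\alpha_N=\alpha N^{-\kappa}$ with $\alpha>0$, $\kappa>0$ fixed. $\{\eta_t(x):x\in\mathbb T_N,t\ge0\}$ is the Markov process on $\Omega_N$ with generator $L_N=N^2S+\alpha_NN^2A$ and initial law $\mu_N$, where $Sf(\eta)=\sum_{x\in\mathbb T_N}(f(\eta^{x,x+1})-f(\eta))$, $Af(\eta)=\sum_{x\in\mathbb T_N}(\eta(x+1)-\eta(x-1))\,\partial f/\partial\eta(x)$, and $\eta^{x,y}$ is $\eta$ with the values at $x$ and $y$ exchanged. $\mathbb P_N,\mathbb E_N$ are the corresponding probability and expectation. Put $v^N_t(x)=\mathbb E_N[\eta_t(x)]$, $e^N_t(x)=\mathbb E_N[\eta_t(x)^2]$, and $\varphi^N_t(x,y)=\mathbb E_N[\eta_t(x)\eta_t(y)]-v^N_t(x)v^N_t(y)$ for $(x,y)\in V_N^{(2)}=\{(x,y)\in\mathbb T_N^2:x\ne y\}$. Discrete negative norm. $\|f\|_{-1,N}^2=\frac1N\sum_{x,y\in\mathbb T_N}f(x)K_N(x-y)\overline{f(y)}$ with $K_N(x)=\frac1N\sum_{z\in\mathbb T_N}\frac{e^{2\pi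 i zx/N}}{1+2N^2(1-\cos(2\pi z/N))}$; $\|\eta^2\|_{-1,N}$ is the norm of $x\mapsto\eta(x)^2$. Assumption (IM). There is a constant $C>0$ such that: $\limsup_N\mathbb E_N[\|\eta_0^2\|_{-1,N}^2]\le C$; $\limsup_N\max_{x}\{|v_0^N(x)|\vee|\nabla^Nv_0^N(x)|\vee|\Delta_N^{(1)}v^N_0(x)|\}\le C$; $\limsup_N\max_x\{|e^N_0(x)|\vee|\nabla^Ne^N_0(x)|\}\le C$; $\limsup_N N\max_{(x,y)\in V^{(2)}_N}|\varphi^N_0(x,y)|\le C$. Association. $\{\mu_N\}$ is associated to $v_0$ if for every continuous $G:\mathbb T\to\mathbb R$ and $\delta>0$, $\mu_N(|\frac1N\sum_x\eta(x)G(x/N)-\int_{\mathbb T}Gv_0\,du|>\delta)\to0$ as $N\to\infty$. Empirical measure. $\pi^{v,N}_t=\frac1N\sum_x\eta_t(x)\delta_{x/N}$ and $\langle\pi,G\rangle=\int G\,d\pi$. For an integer $m\ge0$, $H^m(\mathbb T)$ is the Hilbert space induced by $C^\infty(\mathbb T)$ and the scalar product $\langle f,(1-\Delta)^mg\rangle_{L^2(\mathbb T)}$, and $H^{-m}(\mathbb T)$ is its dual. $Q^{v,N}_m=\mathbb P_N\circ(\pi^{v,N})^{-1}$ is the law of $\pi^{v,N}$ on the Skorohod space $D([0,T],H^{-m}(\mathbb T))$. Weak solution. $v\in L^2([0,T]\times\mathbb T)$ is a weak solution of $\partial_tv=\Delta v+2\alpha\nabla v$, $v(0,\cdot)=v_0$,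 if for every $t\in[0,T]$ and $G\in C^2(\mathbb T)$: $\int_{\mathbb T}v(t,u)G(u)du-\int_{\mathbb T}v_0(u)G(u)du-\int_0^t\int_{\mathbb T}v(s,u)(\Delta G(u)-2\alpha\nabla G(u))\,du\,ds=0$. Here $\nabla=\partial_u$. *)

(* Defs.v *)
From HB Require Import structures.
From mathcomp Require Import all_boot all_order all_algebra perm complex.
From mathcomp Require Import all_classical all_reals all_analysis.
From mathcomp Require Import ring lra.
Set Implicit Arguments.
Unset Strict Implicit.
Unset Printing Implicit Defensive.
Import Order.TTheory GRing.Theory Num.Theory.
Import numFieldNormedType.Exports.
Local Open Scope classical_set_scope.
Local Open Scope ring_scope.

(* Functions on the circle R/Z are 1-periodic functions on R, and integrals   *)
(* over the circle are Lebesgue integrals over [0, 1]. Z/NZ is 'I_N, with the *)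
(* cyclic successor ordS and predecessor ord_pred.                            *)

Section circle.
Context {R : realType}.

Definition periodic1 (f : R -> R) := forall u, f (u + 1) = f u.

Definition circle_integral (f : R -> R) : R :=
  \int[lebesgue_measure]_(u in `[0, 1]) f u.

Definition C2_circle (G : R -> R) :=
  [/\ periodic1 G, forall u, derivable G u 1,
      forall u, derivable (derive1 G) u 1 & continuous (derive1n 2 G)].

Definition smooth (f : R -> R) :=
  periodic1 f /\ forall n u, derivable (derive1n n f) u 1.

Definition one_minus_laplacian (f : R -> R) : R -> R :=
  fun u => f u - derive1n 2 f u.

Definition sobolev_dot m (f g : R -> R) : R :=
  circle_integral (fun u => f u * iter m one_minus_laplacian g u).

Definition sobolev_norm m (f : R -> R) : R := Num.sqrt (sobolev_dot m f f).

Lemma smooth_derive1 f : smooth f -> smooth (derive1 f).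
Proof.
move=> [pf df]; split=> [u|n u].
  rewrite /derive1 (_ : (fun h => h^-1 *: (f (h + (u + 1)) - f (u + 1))) =
    fun h => h^-1 *: (f (h + u) - f u))//.
  by apply/funext => h; rewrite addrA !pf.
by have := df n.+1 u; rewrite /derive1n iterSr.
Qed.

Lemma smooth_derive1n n f : smooth f -> smooth (derive1n n f).
Proof.
by move=> sf; elim: n => [|n IH]; [exact: sf|exact: (smooth_derive1 IH)].
Qed.

Lemma derive1nB f g n : smooth f -> smooth g ->
  derive1n n (fun u => f u - g u) = fun u => derive1n n f u - derive1n n g u.
Proof.
move=> [_ df] [_ dg]; elim: n => [//|n IH]; rewrite derive1nS IH.
apply/funext => u; rewrite [LHS]derive1E.
rewrite (_ : (fun u0 => _) = (derive1n n f : R -> R^o) - derive1n n g)//.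
by rewrite (deriveB (df n u) (dg n u)) !derive1nS -!derive1E.
Qed.

Lemma smoothB f g : smooth f -> smooth g -> smooth (fun u => f u - g u).
Proof.
move=> sf sg; split=> [u|n u]; first by rewrite sf.1 sg.1.
rewrite derive1nB//; apply: (@derivableB _ _ _ (derive1n n f) (derive1n n g)).
  exact: sf.2.
exact: sg.2.
Qed.

Lemma smooth_oml f : smooth f -> smooth (one_minus_laplacian f).
Proof. by move=> sf; exact: (smoothB sf (smooth_derive1n 2 sf)). Qed.

Lemma smooth_iter_oml m f : smooth f -> smooth (iter m one_minus_laplacian f).
Proof. by move=> sf; elim: m => [|m IH]; [exact: sf|exact: (smooth_oml IH)]. Qed.

Lemma derive1_iter_oml m f : smooth f ->
  derive1 (iter m one_minus_laplacian f) =
  iter m one_minus_laplacian (derive1 f).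
Proof.
move=> sf; elim: m => //= m IH; rewrite -IH.
set g := iter m _ f; have sg : smooth g by exact: smooth_iter_oml.
exact: (@derive1nB g (derive1n 2 g) 1 sg (smooth_derive1n 2 sg)).
Qed.

Lemma smooth_cont f : smooth f -> continuous f.
Proof.
move=> [_ df] u; apply/differentiable_continuous/derivable1_diffP.
exact: (df 0%N).
Qed.

Local Notation mu := (@lebesgue_measure R).

Lemma cont_integrable a b (f : R -> R) : continuous f ->
  mu.-integrable `[a, b] (EFin \o f).
Proof.
move=> cf; apply: continuous_compact_integrable; first exact: segment_compact.
exact: continuous_subspaceT.
Qed.

Lemma smooth_LR f a b : smooth f -> derivable_oo_LRcontinuous f a b.
Proof.
move=> sf; split=> [u _||].
- exact: (sf.2 0%N).
- exact/cvg_at_right_filter/smooth_cont.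
- exact/cvg_at_left_filter/smooth_cont.
Qed.

Lemma smooth_byparts f g : smooth f -> smooth g ->
  circle_integral (fun u => f u * derive1n 2 g u) =
  - circle_integral (fun u => derive1 f u * derive1 g u).
Proof.
move=> sf sg; have sf' := smooth_derive1 sf; have sg' := smooth_derive1 sg.
have sg2 := smooth_derive1n 2 sg.
rewrite /circle_integral.
rewrite (@Rintegration_by_parts _ f (derive1 g) (derive1 f) (derive1n 2 g))//.
- have := sf.1 0; have := sg'.1 0; rewrite !add0r => -> ->.
  by rewrite subrr sub0r.
- exact/continuous_subspaceT/smooth_cont.
- exact: smooth_LR.
- exact/continuous_subspaceT/smooth_cont.
- exact: smooth_LR.
Qed.

Lemma sobolev_dotS m f g : smooth f -> smooth g ->
  sobolev_dot m.+1 f g =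
  sobolev_dot m f g + sobolev_dot m (derive1 f) (derive1 g).
Proof.
move=> sf sg; rewrite /sobolev_dot/= -derive1_iter_oml//.
set h := iter m _ g; have sh : smooth h by exact: smooth_iter_oml.
rewrite /one_minus_laplacian.
have cf := smooth_cont sf; have ch := smooth_cont sh.
have ch2 := smooth_cont (smooth_derive1n 2 sh).
under [X in circle_integral X]eq_fun do rewrite mulrBr.
rewrite {1}/circle_integral RintegralB//.
- by rewrite -2!/(circle_integral _) smooth_byparts// opprK.
- by apply: cont_integrable => u; apply: cvgM; [exact: cf|exact: ch].
- apply: cont_integrable; move: ch2; set h2 := derive1n 2 h => ch2.
  by move=> u; apply: cvgM; [exact: cf|exact: ch2].
Qed.

Lemma sobolev_dot_ge0 m f : smooth f -> 0 <= sobolev_dot m f f.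
Proof.
elim: m f => [|m IH] f sf.
  by apply: Rintegral_ge0 => u _; rewrite /= -expr2 sqr_ge0.
rewrite (sobolev_dotS _ sf sf) addr_ge0 ?(IH _ sf)//.
exact: IH (smooth_derive1 sf).
Qed.

Lemma sobolev_dot_mono m f : smooth f ->
  sobolev_dot 1 f f <= sobolev_dot m.+1 f f.
Proof.
move=> sf; elim: m => [|m IH]; first exact: lexx.
apply: (le_trans IH).
rewrite (sobolev_dotS m.+1 sf sf) lerDl.
exact: sobolev_dot_ge0 (smooth_derive1 sf).
Qed.

Lemma smooth_osc f a b : smooth f -> 0 <= a -> a < b -> b <= 1 ->
  `|f b ^+ 2 - f a ^+ 2| <= sobolev_dot 1 f f.
Proof.
move=> sf a0 ab b1; have sf' := smooth_derive1 sf.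
pose q u := f u * f u + derive1 f u * derive1 f u.
have cf := smooth_cont sf; have cf' := smooth_cont sf'.
have cff : continuous (fun u => f u * f u) by move=> u; apply: cvgM; exact: cf.
have cff' : continuous (fun u => derive1 f u * derive1 f u).
  by move=> u; apply: cvgM; exact: cf'.
have cq : continuous q by move=> u; apply: cvgD; [exact: cff|exact: cff'].
have -> : sobolev_dot 1 f f = circle_integral q.
  rewrite (sobolev_dotS _ sf sf) /circle_integral RintegralD//; exact: cont_integrable.
pose g' u := f u * derive1 f u + f u * derive1 f u.
have cg' : continuous g'.
  by move=> u; apply: cvgD; apply: cvgM; (exact: cf || exact: cf').
have dg (u : R) : is_derive u 1 (fun v => f v ^+ 2 : R) (g' u).
  have df : is_derive u 1 (f : R -> R) (derive1 f u).
    by rewrite derive1E; apply: DeriveDef => //; exact: (sf.2 0%N).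
  have <- : f * f = (fun v => f v ^+ 2 : R) by apply/funext => v; rewrite expr2.
  exact: (@is_deriveM _ _ f f u 1 _ _ df df).
have E : \int[mu]_(u in `[a, b]) g' u = f b ^+ 2 - f a ^+ 2.
  rewrite /Rintegral (@continuous_FTC2 _ g' (fun v => f v ^+ 2))//.
  - exact: continuous_subspaceT.
  - have cg : continuous (fun v => f v ^+ 2 : R).
      move=> u; apply/differentiable_continuous/derivable1_diffP.
      by have [] := dg u.
    split=> [u _||]; first by have [] := dg u.
    - exact/cvg_at_right_filter/cg.
    - exact/cvg_at_left_filter/cg.
  - by move=> u _; rewrite derive1E; have [_ ->] := dg u.
rewrite -E; apply: le_trans (le_normr_Rintegral _ _) _ => //.
  exact: cont_integrable.
apply: (@le_trans _ _ (\int[mu]_(u in `[a, b]) q u)).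
  apply: le_Rintegral => //.
  - by apply: cont_integrable => u; apply: cvg_norm; exact: cg'.
  - exact: cont_integrable.
  move=> u _; rewrite /g' /q ler_norml; apply/andP; split.
  - by have := sqr_ge0 (f u + derive1 f u); lra.
  - by have := sqr_ge0 (f u - derive1 f u); lra.
have iq c d : mu.-integrable `[c, d] (EFin \o q) by exact: cont_integrable.
rewrite /circle_integral /Rintegral fine_le//; try exact: integrable_fin_num.
apply: ge0_subset_integral => //.
- by have /integrableP[] := iq 0 1.
- by move=> u _; rewrite lee_fin /q addr_ge0// -expr2 sqr_ge0.
- by apply: subset_itvScc; rewrite bnd_simp.
Qed.

Lemma smooth_sup f x : smooth f -> 0 <= x <= 1 ->
  f x ^+ 2 <= 2 * sobolev_dot 1 f f.
Proof.
move=> sf /andP[x0 x1]; have sf' := smooth_derive1 sf.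
have cff : continuous (fun u => f u ^+ 2 : R).
  by move=> u; apply: cvgM; exact: smooth_cont.
have [c] := @EVT_min _ (fun u => f u ^+ 2 : R) 0 1 ler01 (continuous_subspaceT cff).
rewrite in_itv/= => /andP[c0 c1] cmin.
have c_le : f c ^+ 2 <= sobolev_dot 1 f f.
  rewrite (sobolev_dotS _ sf sf).
  apply: (@le_trans _ _ (sobolev_dot 0 f f)); last first.
    by rewrite lerDl; exact: sobolev_dot_ge0 sf'.
  rewrite /sobolev_dot/= /circle_integral.
  have <- : \int[mu]_(u in `[0, 1]) (f c ^+ 2) = f c ^+ 2.
    rewrite Rintegral_cst//=.
    have -> := @lebesgue_measure_itv R `[0, 1].
    by rewrite /= lte_fin ltr01 oppr0 adde0 /= mulr1.
  apply: le_Rintegral.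
  - exact: measurable_itv.
  - by apply: cont_integrable => u; exact: cvg_cst.
  - by apply: cont_integrable => u; exact: cff.
  - by move=> u u01; rewrite -expr2; exact: cmin.
have [xc|cx|->] := ltgtP x c.
- have := smooth_osc sf x0 xc c1; rewrite distrC.
  by move=> /(le_trans (ler_norm _)); lra.
- have := smooth_osc sf c0 cx x1.
  by move=> /(le_trans (ler_norm _)); lra.
- by have := sobolev_dot_ge0 1 sf; lra.
Qed.

Lemma sobolev_embedding m f x : (0 < m)%N -> smooth f -> 0 <= x <= 1 ->
  `|f x| <= 2 * sobolev_norm m f.
Proof.
case: m => // m _ sf x01; rewrite /sobolev_norm.
have := sobolev_dot_ge0 m.+1 sf; have := sobolev_dot_mono m sf.
have := smooth_sup sf x01.
move: (sobolev_dot 1 f f) (sobolev_dot m.+1 f f) => d1 d h1 d1d d0.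
rewrite -ler_sqr ?nnegrE ?mulr_ge0 ?sqrtr_ge0//.
rewrite real_normK ?num_real// exprMn sqr_sqrtr//; lra.
Qed.
End circle.

(* H^m is the completion of the smooth functions for sobolev_norm m, so its   *)
(* dual is the space of the linear forms on smooth functions that are bounded *)
(* for that norm.                                                             *)
Section sobolev_dual.
Context {R : realType}.

Record smooth_circle := SmoothCircle {
  smooth_val :> R -> R;
  smooth_valP : smooth smooth_val }.

Record sobolev_dual (m : nat) := SobolevDual {
  dual_val :> smooth_circle -> R;
  dual_linear : forall a (f g h : smooth_circle),
    (forall u, h u = a * f u + g u) ->
    dual_val h = a * dual_val f + dual_val g;
  dual_bounded : exists C, forall f : smooth_circle,
    `|dual_val f| <= C * sobolev_norm m f }.

Definition dual_dist m (l l' : sobolev_dual m) : R :=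
  sup [set `|l f - l' f| | f in [set f : smooth_circle | sobolev_norm m f <= 1]].

Definition zero_dual m : sobolev_dual m.
Proof.
apply: (@SobolevDual m (fun=> 0)) => [a f g h _|]; first by rewrite mulr0 addr0.
by exists 0 => f; rewrite normr0 mul0r.
Defined.

Lemma dual_dist_le m (l l' : sobolev_dual m) (M : R) : 0 <= M ->
  (forall f : smooth_circle, sobolev_norm m f <= 1 -> `|l f - l' f| <= M) ->
  0 <= dual_dist l l' <= M.
Proof.
move=> M0 H; rewrite /dual_dist; set A := image _ _.
have ubA : ubound A M by move=> _ [f fm <-]; exact: H.
have [->|/set0P A0] := eqVneq A set0; first by rewrite sup0 lexx M0.
apply/andP; split; last exact: ge_sup.
case: (A0) => _ [f fm _]; apply: (@le_trans _ _ `|l f - l' f|) => //.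
by apply: ub_le_sup; [exists M|exists f].
Qed.

End sobolev_dual.
Arguments smooth_circle : clear implicits.
Arguments sobolev_dual : clear implicits.

(* The Skorohod space D([0, T], H^-m). A path is represented by a function on *)
(* R of which only the values on [0, T] matter.                               *)
Section skorohod.
Context {R : realType}.

Record skorohod (T : R) (m : nat) := Skorohod {
  skorohod_path :> R -> sobolev_dual R m;
  skorohod_right : forall t, 0 <= t < T ->
    dual_dist (skorohod_path s) (skorohod_path t) @[s --> t^'+] --> (0 : R);
  skorohod_left : forall t, 0 < t <= T -> exists l : sobolev_dual R m,
    dual_dist (skorohod_path s) l @[s --> t^'-] --> (0 : R) }.

Definition time_change (T : R) (lam : R -> R) :=
  [/\ lam 0 = 0, lam T = T, {within `[0, T], continuous lam} &
      {in `[0, T] &, {homo lam : s t / s < t}}].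

Definition skorohod_ball T m (g : skorohod T m) (eps : R) : set (skorohod T m) :=
  [set g' | exists2 lam, time_change T lam & forall t, 0 <= t <= T ->
     `|lam t - t| < eps /\ dual_dist (g t) (g' (lam t)) < eps].

Definition skorohod_open T m : set (set (skorohod T m)) :=
  [set U | forall g, U g -> exists2 eps, 0 < eps & skorohod_ball g eps `<=` U].

Lemma dual_dist0 m (l : sobolev_dual R m) : dual_dist l l = 0.
Proof.
by apply/eqP; rewrite eq_le andbC dual_dist_le// => f _; rewrite subrr normr0.
Qed.

Definition zero_skorohod T m : skorohod T m.
Proof.
apply: (@Skorohod T m (fun=> zero_dual m)) => [t _|t _].
  by rewrite dual_dist0; exact: cvg_cst.
by exists (zero_dual m); rewrite dual_dist0; exact: cvg_cst.
Defined.

HB.instance Definition _ T m := gen_eqMixin (skorohod T m).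
HB.instance Definition _ T m := gen_choiceMixin (skorohod T m).
HB.instance Definition _ T m := isPointed.Build (skorohod T m) (zero_skorohod T m).

Definition skorohod_borel T m := g_sigma_algebraType (@skorohod_open T m).

End skorohod.

(* For a finite signed measure nu1 - nu2 on the circle [0, 1[ inducing the    *)
(* element l of H^-m, dual_pairing l G is the integral of G. This makes sense *)
(* for G only continuous, and does not depend on the choice of nu1 and nu2.   *)
(* If l is not induced by a finite signed measure, the value is 0.            *)
Section pairing.
Context {R : realType}.
Local Notation finite_meas :=
  {finite_measure set (measurableTypeR R) -> \bar R}.

Definition signed_integral (nu1 nu2 : finite_meas) (f : R -> R) : R :=
  (\int[nu1]_(u in `[0, 1[) f u) - (\int[nu2]_(u in `[0, 1[) f u).

Definition dual_pairing m (l : sobolev_dual R m) (G : R -> R) : R :=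
  xget 0 [set r | exists nu1 nu2 : finite_meas,
    (forall f : smooth_circle R, l f = signed_integral nu1 nu2 f) /\
    r = signed_integral nu1 nu2 G].

End pairing.

Section configurations.
Context (R : realType) (N : nat).

Definition config := 'rV[R]_N.
HB.instance Definition _ := NormedModule.copy config 'rV[R]_N.

Let coord (x : 'I_N) (eta : config) : R := eta ord0 x.

Let config0 : g_sigma_preimage coord set0.
Proof. exact: sigma_algebra0. Qed.

Let configC A : g_sigma_preimage coord A -> g_sigma_preimage coord (~` A).
Proof. exact: sigma_algebraC. Qed.

Let config_bigcup (F : _^nat) : (forall i, g_sigma_preimage coord (F i)) ->
  g_sigma_preimage coord (\bigcup_i (F i)).
Proof. exact: sigma_algebra_bigcup. Qed.

HB.instance Definition _ := @isMeasurable.Build default_measure_display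
  config (g_sigma_preimage coord) config0 configC config_bigcup.

End configurations.

Section cadlag.
Context {R : realType}.

Record cadlag (V : normedModType R) := Cadlag {
  cadlag_path :> R -> V;
  cadlag_right : forall t, 0 <= t ->
    cadlag_path s @[s --> t^'+] --> cadlag_path t;
  cadlag_left : forall t, 0 < t -> cvg (cadlag_path s @[s --> t^'-]) }.

End cadlag.

Section empirical.
Context {R : realType}.

Definition empirical_form N (eta : config R N) (f : R -> R) : R :=
  N%:R^-1 * \sum_(x < N) eta ord0 x * f (x%:R / N%:R).

Lemma empirical_form_le m N (eta : config R N) (f : smooth_circle R) :
  (0 < m)%N -> `|empirical_form eta f| <= 2 * `|eta| * sobolev_norm m f.
Proof.
move=> m0; have n0 : 0 <= sobolev_norm m f by exact: sqrtr_ge0.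
move: eta; case: N => [|N] eta.
  by rewrite /empirical_form big_ord0 mulr0 normr0 !mulr_ge0.
rewrite /empirical_form normrM ger0_norm ?invr_ge0// ler_pdivrMl//.
apply: le_trans (ler_norm_sum _ _ _) _.
apply: (@le_trans _ _ (\sum_(x < N.+1) (2 * `|eta| * sobolev_norm m f))).
  apply: ler_sum => x _; rewrite normrM.
  have -> : 2 * `|eta| * sobolev_norm m f = `|eta| * (2 * sobolev_norm m f).
    by ring.
  apply: ler_pM => //.
    by rewrite [leRHS]/Num.norm/= mx_normrE; apply/bigmax_geP; right;
       exists (ord0, x).
  apply: (sobolev_embedding m0 (smooth_valP f)).
  by rewrite divr_ge0//= ler_pdivrMr// mul1r ler_nat ltnW.
by rewrite sumr_const card_ord [leRHS]mulr_natl.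
Qed.

Lemma empirical_linear N (eta : config R N) a (f g h : smooth_circle R) :
  (forall u, h u = a * f u + g u) ->
  empirical_form eta h = a * empirical_form eta f + empirical_form eta g.
Proof.
move=> E; rewrite /empirical_form [a * _]mulrCA -[RHS]mulrDr.
congr (_ * _); rewrite mulr_sumr -big_split/=.
by apply: eq_bigr => x _; rewrite E; ring.
Qed.

Lemma empirical_formB N (eta zeta : config R N) f :
  empirical_form eta f - empirical_form zeta f = empirical_form (eta - zeta) f.
Proof.
rewrite /empirical_form -mulrBr -sumrB; congr (_ * _).
by apply: eq_bigr => x _; rewrite !mxE; ring.
Qed.

Lemma empirical_bounded m (m0 : (0 < m)%N) N (eta : config R N) :
  exists C, forall f : smooth_circle R,
    `|empirical_form eta f| <= C * sobolev_norm m f.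
Proof. by exists (2 * `|eta|) => f; exact: empirical_form_le. Qed.

Definition empirical_dual m (m0 : (0 < m)%N) N (eta : config R N) :
    sobolev_dual R m :=
  @SobolevDual R m (fun f => empirical_form eta f) (@empirical_linear N eta)
    (empirical_bounded m0 eta).

Lemma empirical_dual_cvg m (m0 : (0 < m)%N) N (F : set_system R)
    (FF : Filter F) (g : R -> config R N) (l : config R N) :
  g s @[s --> F] --> l ->
  dual_dist (empirical_dual m0 (g s)) (empirical_dual m0 l) @[s --> F] --> (0 : R).
Proof.
move=> gl; apply: (@squeeze_cvgr _ _ _ _ (fun=> 0) (fun s => 2 * `|g s - l|)).
- near=> s; apply: dual_dist_le => [|f fm]; first by rewrite mulr_ge0.
  rewrite /= empirical_formB; apply: le_trans (empirical_form_le _ _ m0) _.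
  by rewrite ler_piMr// mulr_ge0.
- exact: cvg_cst.
- rewrite -[X in _ --> X](mulr0 2); apply: cvgMr.
  rewrite -[X in _ --> X](normr0 (config R N)) -(subrr l).
  by apply: cvg_norm; apply: cvgB => //; exact: cvg_cst.
Unshelve. all: by end_near.
Qed.

Lemma half5_gt0 m : 5 / 2 < m%:R :> R -> (0 < m)%N.
Proof. by case: m => // /lt_trans-/(_ 1); lra. Qed.

Definition empirical_path (T : R) m (hm : 5 / 2 < m%:R :> R) N
  (eta : cadlag (config R N)) : skorohod T m.
Proof.
apply: (@Skorohod R T m (fun t => empirical_dual (half5_gt0 hm) (eta t))).
- move=> t /andP[t0 _]; apply: empirical_dual_cvg; exact: cadlag_right.
- move=> t /andP[t0 _].
  exists (empirical_dual (half5_gt0 hm) (lim (eta s @[s --> t^'-]))).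
  apply: empirical_dual_cvg; exact: cadlag_left.
Defined.

End empirical.

Section markov_process.
Context {R : realType}.

Definition swap N (x y : 'I_N) (eta : config R N) : config R N :=
  col_perm (tperm x y) eta.

Definition partial N (x : 'I_N) (f : config R N -> R) : config R N -> R :=
  'D_(delta_mx ord0 x) f.

Definition exchange_generator N (f : config R N -> R) (eta : config R N) : R :=
  \sum_(x < N) (f (swap x (ordS x) eta) - f eta).

Definition drift_generator N (f : config R N -> R) (eta : config R N) : R :=
  \sum_(x < N) (eta ord0 (ordS x) - eta ord0 (ord_pred x)) * partial x f eta.

Definition alpha_seq (alpha kappa : R) (N : nat) : R :=
  alpha * N%:R `^ (- kappa).

Definition generator (alpha kappa : R) N (f : config R N -> R) (eta : config R N) :
    R :=
  N%:R ^+ 2 * exchange_generator f eta +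
  alpha_seq alpha kappa N * N%:R ^+ 2 * drift_generator f eta.

Definition C1_compact_support N (f : config R N -> R) :=
  [/\ forall eta, differentiable f eta,
      forall x, continuous (partial x f) &
      compact (closure [set eta | f eta != 0])].

Definition transition_semigroup N (p : R -> R.-pker (config R N) ~> (config R N)) :=
  (forall eta A, measurable A -> p 0 eta A = \d_eta A) /\
  (forall (s t : R) eta A, 0 <= s -> 0 <= t -> measurable A ->
     p (s + t) eta A = (\int[p s eta]_zeta p t zeta A)%E).

Definition has_generator N (p : R -> R.-pker (config R N) ~> (config R N))
    (L : (config R N -> R) -> config R N -> R) :=
  forall f, C1_compact_support f -> forall eps : R, 0 < eps ->
    \forall h \near 0^'+, forall eta,
      `|h^-1 * ((\int[p h eta]_zeta f zeta) - f eta) - L f eta| < eps.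

Section process.
Context {d : measure_display} {W : measurableType d} (N : nat).
Variables (P : probability W R) (eta : W -> cadlag (config R N)).

Definition natural_filtration (t : R) : set (set W) :=
  <<s [set A | exists (s : R) (B : set (config R N)),
         [/\ 0 <= s <= t, measurable B & A = [set w | B (eta w s)]]] >>.

Definition markov_property (p : R -> R.-pker (config R N) ~> (config R N)) :=
  forall (s t : R) A (B : set (config R N)), 0 <= s <= t ->
    natural_filtration s A -> measurable B ->
    P (A `&` [set w | B (eta w t)]) = (\int[P]_(w in A) p (t - s)%R (eta w s) B)%E.

(* The generator is tested on C^1 functions with compact support. They are a  *)
(* core of it: the drift has a linear flow, which preserves the Euclidean     *)
(* norm of configurations, and so do the exchanges.                           *)
Definition is_markov_process (mu : probability (config R N) R)
    (L : (config R N -> R) -> config R N -> R) :=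
  [/\ forall t, 0 <= t -> measurable_fun setT (fun w => eta w t),
      forall B, measurable B -> P [set w | B (eta w 0)] = mu B &
      exists p, [/\ transition_semigroup p, has_generator p L &
                    markov_property p]].

Definition empirical_law (T : R) m (hm : 5 / 2 < m%:R :> R) :
    set (skorohod T m) -> \bar R :=
  pushforward P (fun w => empirical_path T hm (eta w) : skorohod_borel T m).

End process.
End markov_process.

Section initial_law.
Context {R : realType}.

Definition cexp (theta : R) : R[i] := (cos theta +i* sin theta)%C.

Definition neg_kernel (N : nat) (k : int) : R[i] :=
  N%:R^-1 * \sum_(z < N) cexp (2 * pi * z%:R * k%:~R / N%:R) /
    (1 + 2 * N%:R ^+ 2 * (1 - cos (2 * pi * z%:R / N%:R)))%:C%C.

Definition neg_norm_sq N (f : 'I_N -> R[i]) : R[i] :=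
  N%:R^-1 * \sum_(x < N) \sum_(y < N)
    f x * neg_kernel N (x%:Z - y%:Z) * conjc (f y).

Section moments.
Local Open Scope ereal_scope.
Context N (mu : probability (config R N) R).

Definition mean (x : 'I_N) : \bar R := \int[mu]_eta (eta ord0 x)%:E.

Definition second_moment (x : 'I_N) : \bar R := \int[mu]_eta (eta ord0 x ^+ 2)%:E.

Definition correlation (x y : 'I_N) : \bar R :=
  \int[mu]_eta (eta ord0 x * eta ord0 y)%:E - mean x * mean y.

Definition discrete_grad (g : 'I_N -> \bar R) (x : 'I_N) : \bar R :=
  N%:R%:E * (g (ordS x) - g x).

Definition discrete_laplacian (g : 'I_N -> \bar R) (x : 'I_N) : \bar R :=
  (N%:R ^+ 2)%:E * (g (ordS x) + g (ord_pred x) - 2%:E * g x).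

End moments.

(* Moments are extended reals, so that the bounds below include finiteness.   *)
Definition assumption_IM (mu : forall N, probability (config R N) R) :=
  exists2 C : R, 0 < C &
  [/\ (limn_esup (fun N => \int[mu N]_eta
        (complex.Re (neg_norm_sq (fun x => (eta ord0 x ^+ 2)%:C%C)))%:E) <= C%:E)%E,
      (limn_esup (fun N => \big[maxe/0]_(x < N)
        maxe (maxe `|mean (mu N) x| `|discrete_grad (mean (mu N)) x|)
             `|discrete_laplacian (mean (mu N)) x|) <= C%:E)%E,
      (limn_esup (fun N => \big[maxe/0]_(x < N)
        maxe `|second_moment (mu N) x|
             `|discrete_grad (second_moment (mu N)) x|) <= C%:E)%E &
      (limn_esup (fun N => N%:R%:E *
        \big[maxe/0]_(z : 'I_N * 'I_N | z.1 != z.2)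
          `|correlation (mu N) z.1 z.2|) <= C%:E)%E].

Definition associated (mu : forall N, probability (config R N) R) (v0 : R -> R) :=
  forall (G : R -> R) (delta : R), periodic1 G -> continuous G -> 0 < delta ->
    mu N [set eta | delta < `|empirical_form eta G -
                             circle_integral (fun u => G u * v0 u)|]
      @[N --> \oo] --> 0%E.

End initial_law.

Section weak_solution.
Context {R : realType}.
Local Notation leb := (@lebesgue_measure R).

Definition space_time (T : R) : set (R * R) :=
  [set z | 0 <= z.1 <= T /\ 0 <= z.2 <= 1].

(* The equation is required at every time t of [0, T], hence the              *)
(* integrability of every v t, which v in L^2 only gives for almost every t.  *)
Definition weak_solution (T alpha : R) (v0 : R -> R) (v : R -> R -> R) :=
  [/\ forall t, periodic1 (v t),
      measurable_fun (space_time T) (fun z : R * R => v z.1 z.2),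
      (\int[leb \x leb]_(z in space_time T) ((v z.1 z.2) ^+ 2)%:E
        < +oo)%E,
      forall t, 0 <= t <= T -> leb.-integrable `[0, 1] (EFin \o v t) &
      forall t (G : R -> R), 0 <= t <= T -> C2_circle G ->
        circle_integral (fun u => v t u * G u)
        - circle_integral (fun u => v0 u * G u)
        - \int[leb]_(s in `[0, t]) circle_integral (fun u =>
            v s u * (derive1n 2 G u - 2 * alpha * derive1 G u)) = 0].

End weak_solution.

(* Main.v *)
Require Import Defs.
From HB Require Import structures.
From mathcomp Require Import all_boot all_order all_algebra.
From mathcomp Require Import all_classical all_reals all_analysis.
From mathcomp Require Import perm measurable_realfun zify ring lra.
Set Implicit Arguments.
Unset Strict Implicit.
Unset Printing Implicit Defensive.
Import Order.TTheory GRing.Theory Num.Theory.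
Import numFieldNormedType.Exports.
Local Open Scope classical_set_scope.
Local Open Scope ring_scope.

(* The k-th cosine and sine modes of the empirical measure form a closed pair
   under the generator, damped at rate disc_rate k and rotated at speed
   disc_drift k, which converge to (2 pi k)^2 and 4 pi alpha k when kappa = 1.
   Exchanges and drift both preserve the energy sum_x eta(x)^2, so the generator
   commutes with multiplication by a function of the energy; cutting off in the
   energy turns the modes and the sum of their squares into admissible test
   functions, and the semigroup acts on the modes by an explicit linear flow. The
   sum of squares is an eigenfunction up to a term of order energy / N^2, and the
   energy is O(N) by the second-moment bound, so Chebyshev's inequality shows
   that the modes follow the flow of their initial values. Trigonometric
   polynomials and then, by Fejer's theorem and the energy bound, all continuous
   test functions follow. The limit is the Fourier series whose coefficients
   solve the limiting linear systems; it is the unique weak solution because the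
   Fourier coefficients of any weak solution solve these systems, and they
   determine the function almost everywhere. *)

(** * Integration over the circle *)

Section circle_integral_theory.
Context {R : realType}.
Implicit Types (f g : R -> R) (a b : R).
Local Notation mu := (@lebesgue_measure R).

(** The dynamics enter only through difference quotients of the semigroup at time 0, on C^1
    functions with compact support, uniformly in the starting configuration. Integrated against the
    kernel at time s, this uniformity becomes a bound [h * e] on increments from s to s + h, with a
    threshold on h that does not depend on s. Hence all differential equations are solved on a time
    grid from one-sided increments, and the same lemma later serves the weak solutions, whose
    coefficients are at first only integrable in time. The cutoff is a bump centred at the energy of
    the starting configuration itself: there it equals 1, and since the semigroup preserves it
    exactly it brings no error term. The plane spanned by the k-th cosine and sine is exactly
    invariant, so no discretization error accumulates in time, and N enters the flow only through
    [disc_rate] and [disc_drift]. Started at energy of order K N, a fixed mode has variance of order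
    t K / N. The conclusion concerns one time at a time, so conditioning on the configuration at
    time 0 is enough and no tightness of paths is involved. *)

Definition circle_integrable f := mu.-integrable `[0, 1] (EFin \o f).

Lemma circle_integrable_cont f : continuous f -> circle_integrable f.
Proof. exact: cont_integrable. Qed.

Lemma is_derive_continuous f g : (forall u : R, is_derive u 1 f (g u)) -> continuous f.
Proof.
move=> d u; apply/differentiable_continuous/derivable1_diffP.
by have [] := d u.
Qed.

Lemma circle_integrable_bounded f B : measurable_fun setT f ->
  (forall u, `|f u| <= B) -> circle_integrable f.
Proof.
move=> mf fB; apply: measurable_bounded_integrable => //.
- by rewrite /= lebesgue_measure_itv/= lte_fin ltr01 -EFinB ltry.
- exact: measurable_funTS.
- by exists B; split; [exact: num_real|move=> x /ltW Bx y _; exact: le_trans (fB y) Bx].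
Qed.

Lemma circle_integrable_cst a : circle_integrable (fun=> a).
Proof. by apply: circle_integrable_cont => u; exact: cvg_cst. Qed.

Lemma circle_integrableD f g : circle_integrable f -> circle_integrable g ->
  circle_integrable (fun u => f u + g u).
Proof. by move=> fi gi; exact: (integrableD _ fi gi). Qed.

Lemma circle_integrableZ a f : circle_integrable f ->
  circle_integrable (fun u => a * f u).
Proof. by move=> fi; exact: (integrableZl _ a fi). Qed.

Lemma circle_integrableB f g : circle_integrable f -> circle_integrable g ->
  circle_integrable (fun u => f u - g u).
Proof. by move=> fi gi; exact: (integrableB _ fi gi). Qed.

Lemma circle_integrable_norm f : circle_integrable f ->
  circle_integrable (fun u => `|f u|).
Proof. exact: integrable_norm. Qed.

Lemma circle_integrableMl f g : circle_integrable f -> continuous g ->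
  circle_integrable (fun u => f u * g u).
Proof.
move=> fi cg; apply: (integrableMl _ fi) => //.
- by apply: measurable_funTS; exact: continuous_measurable_fun.
- have := @continuous_compact _ _ g `[0, 1] (continuous_subspaceT cg) (@segment_compact R 0 1).
  by move=> /compact_bounded; rewrite /bounded_set/bounded_near/=; apply: filterS => M h x hx; apply: h; exists x.
Qed.

Lemma circle_integralD f g : circle_integrable f -> circle_integrable g ->
  circle_integral (fun u => f u + g u) = circle_integral f + circle_integral g.
Proof. by move=> fi gi; rewrite /circle_integral RintegralD. Qed.

Lemma circle_integralB f g : circle_integrable f -> circle_integrable g ->
  circle_integral (fun u => f u - g u) = circle_integral f - circle_integral g.
Proof. by move=> fi gi; rewrite /circle_integral RintegralB. Qed.

Lemma circle_integralZ a f : circle_integrable f ->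
  circle_integral (fun u => a * f u) = a * circle_integral f.
Proof. by move=> fi; rewrite /circle_integral RintegralZl. Qed.

Lemma circle_integral_cst a : circle_integral (fun=> a) = a.
Proof.
rewrite /circle_integral Rintegral_cst//=.
have -> := @lebesgue_measure_itv R `[0, 1].
by rewrite /= lte_fin ltr01 oppr0 adde0 /= mulr1.
Qed.

Lemma circle_integral_sum n (F : 'I_n -> R -> R) :
  (forall i, circle_integrable (F i)) ->
  circle_integrable (fun u => \sum_(i < n) F i u) /\
  circle_integral (fun u => \sum_(i < n) F i u) =
  \sum_(i < n) circle_integral (F i).
Proof.
elim: n F => [|n IH] F Fi.
  have -> : (fun u => \sum_(i < 0) F i u) = (fun=> 0).
    by apply/funext => u; rewrite big_ord0.
  rewrite big_ord0 circle_integral_cst; split=> //; first exact: circle_integrable_cst.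
have [i1 e1] := IH (fun i => F (lift ord0 i)) (fun i => Fi _).
have -> : (fun u => \sum_(i < n.+1) F i u) =
   (fun u => F ord0 u + \sum_(i < n) F (lift ord0 i) u).
  by apply/funext => u; rewrite big_ord_recl.
split; first exact: circle_integrableD.
by rewrite circle_integralD// e1 big_ord_recl.
Qed.

Lemma circle_integral_le f g : circle_integrable f -> circle_integrable g ->
  (forall u, 0 <= u <= 1 -> f u <= g u) ->
  circle_integral f <= circle_integral g.
Proof.
move=> fi gi fg; apply: le_Rintegral => // u /=; rewrite in_itv/=; exact: fg.
Qed.

Lemma circle_integral_norm f : circle_integrable f ->
  `|circle_integral f| <= circle_integral (fun u => `|f u|).
Proof. by move=> fi; exact: le_normr_Rintegral. Qed.

Lemma itv_FTC a b f (F : R -> R) : a <= b -> continuous f ->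
  (forall u : R, is_derive u 1 F (f u)) ->
  \int[mu]_(u in `[a, b]) f u = F b - F a.
Proof.
rewrite le_eqVlt => /predU1P[<-|ab] cf dF.
  by rewrite set_itv1 Rintegral_set1 subrr.
have cF := is_derive_continuous dF.
rewrite /Rintegral (@continuous_FTC2 _ f F)//.
- exact: continuous_subspaceT.
- split=> [u _||]; first by have [] := dF u.
  + exact/cvg_at_right_filter/cF.
  + exact/cvg_at_left_filter/cF.
- by move=> u _; rewrite derive1E; have [_ ->] := dF u.
Qed.

Lemma circle_integral_FTC f (F : R -> R) : continuous f ->
  (forall u : R, is_derive u 1 F (f u)) ->
  circle_integral f = F 1 - F 0.
Proof. exact: itv_FTC. Qed.

End circle_integral_theory.

(** * The real trigonometric basis and its integrals *)

Section fourier_modes.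
Context {R : realType}.
Implicit Types (k l : int) (u s : R).

(** Indices are integers rather than naturals, so that product formulas and the double sums of the
    Fejer kernel can use [k - l] without case analysis. *)
Definition freq k : R := 2 * pi * k%:~R.
Definition ecos k u : R := cos (freq k * u).
Definition esin k u : R := sin (freq k * u).

Lemma is_derive_ecos k u :
  is_derive u 1 (ecos k : R -> R) (- freq k * esin k u).
Proof.
rewrite /ecos /esin; apply: is_derive_eq; rewrite /GRing.scale/=; ring.
Qed.

Lemma is_derive_esin k u :
  is_derive u 1 (esin k : R -> R) (freq k * ecos k u).
Proof.
rewrite /ecos /esin; apply: is_derive_eq; rewrite /GRing.scale/=; ring.
Qed.

Lemma continuous_ecos k : continuous (ecos k).
Proof. exact: is_derive_continuous (is_derive_ecos k). Qed.

Lemma continuous_esin k : continuous (esin k).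
Proof. exact: is_derive_continuous (is_derive_esin k). Qed.

Lemma sincos_freq k : cos (freq k) = 1 /\ sin (freq k) = 0.
Proof.
have H n : cos (freq n%:Z) = 1 /\ sin (freq n%:Z) = 0.
  have -> : freq n%:Z = 0 + pi *+ 2 *+ n.
    by rewrite add0r /freq mulr_natl -[RHS]mulr_natr.
  rewrite (periodicn (@cosD2pi R)) (periodicn (@sinD2pi R)).
  by rewrite cos0 sin0.
case: k => n; first exact: H.
have [h1 h2] := H n.+1.
rewrite NegzE /freq mulrNz mulrN cosN sinN.
by rewrite -/(freq n.+1) h1 h2 oppr0.
Qed.

Lemma periodic_ecos k : periodic1 (ecos k).
Proof.
move=> u; rewrite /ecos mulrDr mulr1 cosD.
by have [-> ->] := sincos_freq k; rewrite mulr1 mulr0 subr0.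
Qed.

Lemma periodic_esin k : periodic1 (esin k).
Proof.
move=> u; rewrite /esin mulrDr mulr1 sinD.
by have [-> ->] := sincos_freq k; rewrite mulr1 mulr0 addr0.
Qed.

Lemma ecosB k u s : ecos k (u - s) = ecos k u * ecos k s + esin k u * esin k s.
Proof. by rewrite /ecos mulrBr cosB. Qed.

Lemma freq_eq0 k : (freq k == 0) = (k == 0).
Proof.
by rewrite /freq mulf_eq0 mulf_eq0 pnatr_eq0 /= gt_eqF ?pi_gt0//= intr_eq0.
Qed.

Lemma ecos0 u : ecos 0 u = 1.
Proof. by rewrite /ecos /freq mulr0 mul0r cos0. Qed.

Lemma esin0 u : esin 0 u = 0.
Proof. by rewrite /esin /freq mulr0 mul0r sin0. Qed.

Lemma circle_integral_ecos k : circle_integral (ecos k) = (k == 0)%:R.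
Proof.
have [->|k0] := eqVneq k 0.
  rewrite -[RHS](circle_integral_cst 1); congr circle_integral.
  by apply/funext => u; rewrite ecos0.
have fk : freq k != 0 by rewrite freq_eq0.
have d u : is_derive u 1 (fun v => (freq k)^-1 * esin k v) (ecos k u).
  have h := is_derive_esin k u.
  by apply: is_derive_eq; rewrite /GRing.scale/= mulrA mulVf// mul1r.
rewrite (circle_integral_FTC (@continuous_ecos k) d).
rewrite /esin mulr0 sin0 mulr1; have [_ ->] := sincos_freq k.
by rewrite !mulr0 subr0.
Qed.

Lemma circle_integral_esin k : circle_integral (esin k) = 0.
Proof.
have [->|k0] := eqVneq k 0.
  rewrite -[RHS](circle_integral_cst 0); congr circle_integral.
  by apply/funext => u; rewrite esin0.
have fk : freq k != 0 by rewrite freq_eq0.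
have d u : is_derive u 1 (fun v => - (freq k)^-1 * ecos k v) (esin k u).
  have h := is_derive_ecos k u.
  by apply: is_derive_eq; rewrite /GRing.scale/= mulrA mulrNN mulVf// mul1r.
rewrite (circle_integral_FTC (@continuous_esin k) d).
rewrite /ecos mulr0 cos0 mulr1; have [-> _] := sincos_freq k.
by rewrite mulr1 subrr.
Qed.

Lemma freqD k l : freq (k + l) = freq k + freq l.
Proof. by rewrite /freq intrD mulrDr. Qed.

Lemma freqB k l : freq (k - l) = freq k - freq l.
Proof. by rewrite /freq intrB mulrBr. Qed.

Lemma ecosM k l u : ecos k u * ecos l u = 2^-1 * (ecos (k - l) u + ecos (k + l) u).
Proof. by rewrite /ecos freqB freqD mulrBl mulrDl cosB cosD; field. Qed.

Lemma esinM k l u : esin k u * esin l u = 2^-1 * (ecos (k - l) u - ecos (k + l) u).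
Proof. by rewrite /ecos /esin freqB freqD mulrBl mulrDl cosB cosD; field. Qed.

Lemma ecos_esinM k l u :
  ecos k u * esin l u = 2^-1 * (esin (k + l) u - esin (k - l) u).
Proof. by rewrite /ecos /esin freqB freqD mulrBl mulrDl sinB sinD; field. Qed.

Lemma circle_integral_ecosB k u :
  circle_integrable (fun s => ecos k (u - s)) /\
  circle_integral (fun s => ecos k (u - s)) = (k == 0)%:R.
Proof.
have -> : (fun s => ecos k (u - s)) =
   (fun s => ecos k u * ecos k s + esin k u * esin k s).
  by apply/funext => s; rewrite ecosB.
have ic := circle_integrable_cont (@continuous_ecos k).
have iss := circle_integrable_cont (@continuous_esin k).
have ic' := circle_integrableZ (ecos k u) ic.
have is' := circle_integrableZ (esin k u) iss.
split; first exact: circle_integrableD.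
rewrite circle_integralD// !circle_integralZ// circle_integral_ecos.
rewrite circle_integral_esin mulr0 addr0.
by case: eqVneq => [->|]; rewrite ?ecos0 ?mulr1 ?mulr0.
Qed.

End fourier_modes.

(** * Fejer means and the Fejer kernel *)

Section fejer.
Context {R : realType}.
Implicit Types (k l : int) (u s : R) (f : R -> R).

Definition fourier_cos f k := circle_integral (fun u => f u * ecos k u).
Definition fourier_sin f k := circle_integral (fun u => f u * esin k u).

(** The Cesaro mean of the Fourier partial sums: for [i] and [j] below [n], the difference [i - j]
    takes the value k exactly n - |k| times, which is the weight 1 - |k| / n. The double sum makes
    positivity visible and reduces integrals to counting pairs. *)
Definition fejer n f u : R := n%:R^-1 * \sum_(i < n) \sum_(j < n)
  (fourier_cos f (i%:Z - j%:Z) * ecos (i%:Z - j%:Z) u +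
   fourier_sin f (i%:Z - j%:Z) * esin (i%:Z - j%:Z) u).

Definition fejer_kernel n u : R :=
  n%:R^-1 * \sum_(i < n) \sum_(j < n) ecos (i%:Z - j%:Z) u.

(** The double sum is the squared modulus of the sum of exp(2 pi i j u) over j < n. *)
Lemma fejer_kernel_ge0 n u : 0 <= fejer_kernel n u.
Proof.
rewrite /fejer_kernel mulr_ge0 ?invr_ge0//.
have -> : \sum_(i < n) \sum_(j < n) ecos (i%:Z - j%:Z) u =
  (\sum_(i < n) ecos i%:Z u) ^+ 2 + (\sum_(i < n) esin i%:Z u) ^+ 2.
  rewrite !expr2 !big_distrlr/= -big_split/=; apply: eq_bigr => i _.
  rewrite -big_split/=; apply: eq_bigr => j _.
  by rewrite /ecos /esin freqB mulrBl cosB.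
by rewrite addr_ge0 ?sqr_ge0.
Qed.

(** The weight [w] is left free because it is used with the constant 1 (mass), with [ecos 1 (u - s)]
    (first moment) and with the function to be approximated. *)
Lemma fejer_kernel_integral (w : R -> R) n u :
  (forall k, circle_integrable (fun s => w s * ecos k (u - s))) ->
  circle_integrable (fun s => w s * fejer_kernel n (u - s)) /\
  circle_integral (fun s => w s * fejer_kernel n (u - s)) =
  n%:R^-1 * \sum_(i < n) \sum_(j < n)
     circle_integral (fun s => w s * ecos (i%:Z - j%:Z) (u - s)).
Proof.
move=> wi.
have -> : (fun s => w s * fejer_kernel n (u - s)) =
  (fun s => n%:R^-1 * \sum_(i < n) \sum_(j < n) w s * ecos (i%:Z - j%:Z) (u - s)).
  apply/funext => s; rewrite /fejer_kernel mulrCA mulr_sumr; congr (_ * _).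
  by apply: eq_bigr => i _; rewrite mulr_sumr.
have H (i : 'I_n) := @circle_integral_sum _ n
  (fun j s => w s * ecos (i%:Z - j%:Z) (u - s)) (fun j => wi _).
have [H1 H2] := circle_integral_sum (fun i => (H i).1).
split; first exact: circle_integrableZ.
rewrite circle_integralZ// H2; congr (_ * _).
by apply: eq_bigr => i _; rewrite (H i).2.
Qed.

Lemma circle_integrableM_ecosB f k u : circle_integrable f ->
  circle_integrable (fun s => f s * ecos k (u - s)).
Proof.
move=> fi; apply: circle_integrableMl => // s.
apply: (@continuous_comp _ _ _ (fun s => u - s) (ecos k)); last exact: continuous_ecos.
by apply: cvgB; [exact: cvg_cst|exact: cvg_id].
Qed.

Lemma fejerE n f u : circle_integrable f ->
  fejer n f u = circle_integral (fun s => f s * fejer_kernel n (u - s)).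
Proof.
move=> fi.
rewrite (fejer_kernel_integral n (fun k => circle_integrableM_ecosB k u fi)).2.
rewrite /fejer; congr (_ * _); apply: eq_bigr => i _; apply: eq_bigr => j _.
move: (_ - _) => k.
have -> : (fun s => f s * ecos k (u - s)) =
   (fun s => ecos k u * (f s * ecos k s) + esin k u * (f s * esin k s)).
  by apply/funext => s; rewrite ecosB; ring.
have i1 := circle_integrableMl fi (@continuous_ecos _ k).
have i2 := circle_integrableMl fi (@continuous_esin _ k).
rewrite circle_integralD ?circle_integralZ//; try exact: circle_integrableZ.
by rewrite mulrC [_ * esin _ _]mulrC.
Qed.

(** Only the [n] diagonal pairs have frequency zero and survive integration; the factor [n%:R^-1]
    cancels their number. *)
Lemma fejer_kernel_mass n u : (0 < n)%N ->
  circle_integrable (fun s => fejer_kernel n (u - s)) /\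
  circle_integral (fun s => fejer_kernel n (u - s)) = 1.
Proof.
move=> n0.
have i1 k : circle_integrable (fun s => 1 * ecos k (u - s)).
  apply: (@circle_integrableM_ecosB (fun=> 1)); exact: circle_integrable_cst.
have [] := fejer_kernel_integral n i1.
have -> : (fun s => 1 * fejer_kernel n (u - s)) = (fun s => fejer_kernel n (u - s)).
  by apply/funext => s; rewrite mul1r.
move=> ? ->; split=> //.
have E (i j : 'I_n) :
    circle_integral (fun s => 1 * ecos (i%:Z - j%:Z) (u - s)) = (j == i)%:R.
  have -> : (fun s => 1 * ecos (i%:Z - j%:Z) (u - s)) =
      (fun s => ecos (i%:Z - j%:Z) (u - s)).
    by apply/funext => s; rewrite mul1r.
  by rewrite (circle_integral_ecosB _ u).2 subr_eq0 eqz_nat eq_sym val_eqE.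
rewrite (eq_bigr (fun=> 1)) => [|i _]; last first.
  rewrite (eq_bigr _ (fun j _ => E i j)) (bigD1 i)//= eqxx big1 ?addr0//.
  by move=> j /negbTE ->.
by rewrite sumr_const card_ord mulVf// pnatr_eq0 -lt0n.
Qed.

(** The pairs counted satisfy i = j + 1: the row i = 0 has none, and each of the other n rows has
    exactly one. *)
Lemma sum_consecutive n :
  \sum_(i < n.+1) \sum_(j < n.+1) (i%:Z - j%:Z == 1)%:R = n%:R :> R.
Proof.
rewrite big_ord_recl big1 => [|j _]; last first.
  by rewrite sub0r; case: (j : nat) => [|m]; rewrite ?oppr0.
rewrite add0r (eq_bigr (fun=> 1)) ?sumr_const ?card_ord// => i _.
rewrite (bigD1 (widen_ord (leqnSn n) i))//= big1 => [|j ji].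
  by rewrite /bump add1n -addn1 PoszD addrAC subrr add0r eqxx addr0.
rewrite /bump add1n -addn1 PoszD addrAC -subr_eq0 addrK subr_eq0 eqz_nat.
by move: ji; rewrite -val_eqE/= eq_sym => /negbTE ->.
Qed.

(* With periodic_modulus, this gives the uniform convergence of Fejer sums by
   Korovkin's argument, with the test function 1 - cos (2 pi (u - s)). *)
Lemma fejer_kernel_first_moment n u : (0 < n)%N ->
  circle_integrable (fun s => (1 - ecos 1 (u - s)) * fejer_kernel n (u - s)) /\
  circle_integral (fun s => (1 - ecos 1 (u - s)) * fejer_kernel n (u - s)) =
  n%:R^-1.
Proof.
case: n => // n _.
have i1 k : circle_integrable (fun s => ecos 1 (u - s) * ecos k (u - s)).
  apply: circle_integrableM_ecosB; exact: (circle_integral_ecosB 1 u).1.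
have [h1 h2] := fejer_kernel_integral n.+1 i1.
have [m1 m2] := fejer_kernel_mass u (ltn0Sn n).
have -> : (fun s => (1 - ecos 1 (u - s)) * fejer_kernel n.+1 (u - s)) =
  (fun s => fejer_kernel n.+1 (u - s) - ecos 1 (u - s) * fejer_kernel n.+1 (u - s)).
  by apply/funext => s; ring.
split; first exact: circle_integrableB.
rewrite circle_integralB// m2 h2.
(* By orthogonality only the pairs with i - j equal to 1 or -1 contribute, each with weight 1/2.
   There are n of each kind, so the integral is 1 - n / (n + 1) = 1 / (n + 1). *)
have E (i j : 'I_n.+1) :
    circle_integral (fun s => ecos 1 (u - s) * ecos (i%:Z - j%:Z) (u - s)) =
    2^-1 * (i%:Z - j%:Z == 1)%:R + 2^-1 * (j%:Z - i%:Z == 1)%:R.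
  move E : (i%:Z - j%:Z) => k.
  have -> : j%:Z - i%:Z = - k by rewrite -E opprB.
  have -> : (fun s => ecos 1 (u - s) * ecos k (u - s)) =
     (fun s => 2^-1 * ecos (1 - k) (u - s) + 2^-1 * ecos (1 + k) (u - s)).
    by apply/funext => s; rewrite ecosM mulrDr.
  have [a1 a2] := circle_integral_ecosB (1 - k) u.
  have [b1 b2] := circle_integral_ecosB (1 + k) u.
  rewrite circle_integralD ?circle_integralZ//; try exact: circle_integrableZ.
  by rewrite a2 b2 subr_eq0 eq_sym [1 + k]addrC addr_eq0 eqr_oppLR.
under eq_bigr => i _ do under eq_bigr => j _ do rewrite E.
under eq_bigr => i _ do rewrite big_split/=.
rewrite big_split/=.
rewrite [X in _ - _ * (_ + X)]exchange_big/=.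
rewrite -(eq_bigr _ (fun i _ => mulr_sumr _ _ _ _)) -mulr_sumr sum_consecutive.
have n0 : n.+1%:R != 0 :> R by rewrite pnatr_eq0.
by move: n0; rewrite -natr1 => n0; field.
Qed.

End fejer.

(** * Uniform convergence of Fejer means *)

Section fejer_cvg.
Context {R : realType}.
Implicit Types (k l : int) (u s : R) (f G : R -> R).

Lemma periodic1_int f k u : periodic1 f -> f (u + k%:~R) = f u.
Proof.
move=> pf; have H n v : f (v + n%:R) = f v.
  by elim: n => [|n IH]; rewrite ?addr0// -natr1 addrA pf.
case: k => n; first exact: H.
by rewrite NegzE mulrNz -[in RHS](subrK n.+1%:R u) H.
Qed.

Lemma periodic1_rep u : exists k, 0 <= u - k%:~R <= 1.
Proof.
exists (Num.floor u); rewrite subr_ge0 floor_le_tmp/= lerBlDl.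
by have := floorD1_gt u; rewrite intrD => /ltW.
Qed.

Lemma ecos1_lt1 u : 0 < `|u| < 1 -> ecos 1 u < 1.
Proof.
move=> /andP[u0 u1].
have -> : ecos 1 u = 1 - 2 * sin (pi * `|u|) ^+ 2.
  have -> : ecos 1 u = cos ((pi * `|u|) *+ 2).
    rewrite /ecos /freq mulr1 -cos_norm !normrM (ger0_norm (pi_ge0 R)).
    by rewrite ger0_norm// -mulrA mulr_natl.
  rewrite cos_mulr2n cos2sin2; ring.
have : 0 < sin (pi * `|u|).
  by apply: sin_gt0_pi; rewrite mulr_gt0 ?pi_gt0//= gtr_pMr ?pi_gt0.
by move=> h; have := exprn_gt0 2 h; lra.
Qed.

Lemma ecos_le1 k u : ecos k u <= 1. Proof. exact: cos_le1. Qed.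

(** Compactness: on the closed set [K] of pairs where G varies by at least [eps], the continuous
    function 1 - cos(2 pi (u - s)) is positive, hence has a minimum m > 0, and M = 2 B / m works
    with B a bound of |G|. Off [K] the term [eps] is enough. *)
Lemma periodic_modulus G (eps : R) : periodic1 G -> continuous G -> 0 < eps ->
  exists2 M, 0 <= M & forall u s, 0 <= u <= 1 -> 0 <= s <= 1 ->
    `|G s - G u| <= eps + M * (1 - ecos 1 (u - s)).
Proof.
move=> pG cG e0.
pose K : set (R * R) := (`[0, 1] `*` `[0, 1]) `&`
  [set z : R * R | eps <= `|G z.2 - G z.1|].
have cd : continuous (fun z : R * R => `|G z.2 - G z.1|).
  move=> z; apply: cvg_norm; apply: cvgB.
    by apply: (@continuous_comp _ _ _ snd G); [exact: cvg_snd|exact: cG].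
  by apply: (@continuous_comp _ _ _ fst G); [exact: cvg_fst|exact: cG].
have cK : compact K.
  apply: compact_closedI; first by apply: compact_setX; exact: segment_compact.
  exact: (@closed_comp _ _ _ [set x | eps <= x] (fun z _ => cd z) (@closed_ge _ eps)).
have ce : continuous (fun z : R * R => 1 - ecos 1 (z.1 - z.2)).
  move=> z; apply: cvgB; first exact: cvg_cst.
  apply: (@continuous_comp _ _ _ (fun z : R * R => z.1 - z.2) (ecos 1)); last exact: continuous_ecos.
  by apply: cvgB; [exact: cvg_fst|exact: cvg_snd].
have [K0|K0] := eqVneq K set0.
  exists 0 => // u s u01 s01; rewrite mul0r addr0.
  have [//|/ltW h] := leP (`|G s - G u|) eps.
  have : K (u, s) by split => //; split; rewrite /= in_itv.
  by rewrite K0.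
have [c /set_mem[[c1 c2] c3] cm] := compact_EVT_min (iffLR (@set0P _ K) K0) cK (continuous_subspaceT ce).
have m0 : 0 < 1 - ecos 1 (c.1 - c.2).
  rewrite subr_gt0; apply: ecos1_lt1.
  move: c1 c2 c3; rewrite /= !in_itv/= => /andP[a1 a2] /andP[b1 b2] c3.
  (* Besides the diagonal, 1 - cos(2 pi (u - s)) vanishes in the unit square at the corners (0, 1)
     and (1, 0); periodicity of G keeps these out of [K]. *)
  have G01 : G 1 = G 0 by rewrite -[RHS]pG add0r.
  rewrite normr_gt0 subr_eq0; apply/andP; split.
    apply/eqP => E; move: c3; rewrite E subrr normr0; lra.
  rewrite lt_neqAle ler_norml; apply/andP; split; last by apply/andP; split; lra.
  apply/eqP => /eqP; rewrite eqr_norml => /andP[/orP[]/eqP h _]; move: c3.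
    have -> : c.1 = 1 by lra. have -> : c.2 = 0 by lra.
    by rewrite G01 subrr normr0; lra.
  have -> : c.1 = 0 by lra. have -> : c.2 = 1 by lra.
  by rewrite G01 subrr normr0; lra.
have [B HB] : exists B, forall u, 0 <= u <= 1 -> `|G u| <= B.
  have := continuous_compact (continuous_subspaceT cG) (@segment_compact R 0 1).
  move=> /compact_bounded[B [_ HB]]; exists (B + 1) => u u01.
  by apply: (HB (B + 1)); [rewrite ltrDl|exists u => //=; rewrite in_itv].
have B0 : 0 <= B by apply: le_trans (HB 0 _); rewrite // lexx ler01.
set m := 1 - _ in m0 cm.
exists (2 * B / m); first by rewrite divr_ge0 ?mulr_ge0// ltW.
move=> u s u01 s01.
have e1 : 0 <= 1 - ecos 1 (u - s) by rewrite subr_ge0 ecos_le1.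
have [h|/ltW h] := leP (`|G s - G u|) eps.
  apply: (le_trans h); rewrite lerDl; apply: mulr_ge0 => //.
  by rewrite divr_ge0 ?mulr_ge0// ltW.
have Kus : K (u, s) by split => //; split; rewrite /= in_itv.
have := cm (u, s) (mem_set Kus); rewrite /= => mle.
apply: (@le_trans _ _ (2 * B)).
  apply: (le_trans (ler_normB _ _)); have := HB _ u01; have := HB _ s01; lra.
apply: (@le_trans _ _ (2 * B / m * (1 - ecos 1 (u - s)))); last by rewrite lerDr ltW.
by rewrite -mulrA ler_peMr ?mulr_ge0// mulrC ler_pdivlMr// mul1r.
Qed.

Lemma periodic_fejer n f : periodic1 (fejer n f).
Proof.
move=> u; rewrite /fejer; congr (_ * _); apply: eq_bigr => i _.
by apply: eq_bigr => j _; rewrite periodic_ecos periodic_esin.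
Qed.

Lemma fejer_cvg G (eps : R) : periodic1 G -> continuous G -> 0 < eps ->
  exists n0, forall n u, (n0 < n)%N -> `|fejer n G u - G u| <= eps.
Proof.
move=> pG cG e0; have e20 : 0 < eps / 2 by rewrite divr_gt0.
have [M M0 HM] := periodic_modulus pG cG e20.
(* The first moment of the kernel is 1 / n, so beyond this rank the second term of the modulus
   contributes at most [eps / 2]. *)
pose n0 := Num.truncn (2 * M / eps); exists n0 => n u nn.
have n_gt0 : (0 < n)%N by exact: leq_ltn_trans nn.
wlog u01 : u / 0 <= u <= 1.
  move=> W; have [k hk] := periodic1_rep u.
  have := W _ hk.
  by rewrite -intrN (periodic1_int _ _ (@periodic_fejer n G)) (periodic1_int _ _ pG).
have iG := circle_integrable_cont cG.
rewrite fejerE//.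
have [k1 k2] := fejer_kernel_mass u n_gt0.
have [f1 f2] := fejer_kernel_first_moment u n_gt0.
have [g1 _] := fejer_kernel_integral n (fun k => circle_integrableM_ecosB k u iG).
have -> : G u = circle_integral (fun s => G u * fejer_kernel n (u - s)).
  by rewrite circle_integralZ// k2 mulr1.
rewrite -circle_integralB//; last exact: circle_integrableZ.
have id : circle_integrable (fun s => G s * fejer_kernel n (u - s) - G u * fejer_kernel n (u - s)).
  by apply: circle_integrableB => //; exact: circle_integrableZ.
apply: (le_trans (circle_integral_norm id)).
pose h s := eps / 2 * fejer_kernel n (u - s) +
  M * ((1 - ecos 1 (u - s)) * fejer_kernel n (u - s)).
have ih : circle_integrable h by apply: circle_integrableD; exact: circle_integrableZ.
apply: (@le_trans _ _ (circle_integral h)).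
  apply: circle_integral_le => //; first exact: circle_integrable_norm.
  move=> s s01; rewrite -mulrBl normrM (ger0_norm (fejer_kernel_ge0 _ _)).
  rewrite /h/= [M * (_ * _)]mulrA -mulrDl ler_wpM2r ?fejer_kernel_ge0//; exact: HM.
rewrite /h circle_integralD; [|exact: circle_integrableZ|exact: circle_integrableZ].
rewrite (circle_integralZ _ k1) (circle_integralZ _ f1) k2 f2 mulr1.
have : M * n%:R^-1 <= eps / 2.
  rewrite ler_pdivrMr ?ltr0n// mulrAC ler_pdivlMr//.
  have : 2 * M / eps < n%:R.
    apply: lt_le_trans (truncnS_gt _) _; by rewrite ler_nat.
  by rewrite ltr_pdivrMr// => /ltW; rewrite mulrC [_ * eps]mulrC.
lra.
Qed.

End fejer_cvg.

(** * Trigonometric polynomials *)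

Section trigonometric_polynomials.
Context {R : realType}.
Implicit Types (k l : int) (u s a b : R) (f G p q : R -> R).

(** Frequencies may repeat and come in any order, so sums need no normal form, and a linear
    statement is proved by adding one mode at a time. *)
Inductive trigpoly : (R -> R) -> Prop :=
| trigpoly0 : trigpoly (fun=> 0)
| trigpolyS k a b p : trigpoly p ->
    trigpoly (fun u => (a * ecos k u + b * esin k u) + p u).

Lemma trigpolyD p q : trigpoly p -> trigpoly q -> trigpoly (fun u => p u + q u).
Proof.
move=> tp tq; elim: tp => [|k a b {}p _ IH].
  by have -> : (fun u => 0 + q u) = q by apply/funext => u; rewrite add0r.
rewrite (_ : (fun u => _) = (fun u => (a * ecos k u + b * esin k u) + (p u + q u))).
  exact: trigpolyS.
by apply/funext => u; rewrite addrA.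
Qed.

Lemma trigpolyZ c p : trigpoly p -> trigpoly (fun u => c * p u).
Proof.
elim=> [|k a b {}p _ IH].
  by rewrite (_ : (fun u => _) = (fun=> 0)); [exact: trigpoly0|apply/funext => u; rewrite mulr0].
rewrite (_ : (fun u => _) = (fun u => ((c * a) * ecos k u + (c * b) * esin k u) + c * p u)).
  exact: trigpolyS.
by apply/funext => u; ring.
Qed.

Lemma trigpoly_sum n (F : 'I_n -> R -> R) : (forall i, trigpoly (F i)) ->
  trigpoly (fun u => \sum_(i < n) F i u).
Proof.
elim: n F => [|n IH] F tF.
  by rewrite (_ : (fun u => _) = (fun=> 0)); [exact: trigpoly0|apply/funext => u; rewrite big_ord0].
rewrite (_ : (fun u => _) = (fun u => F ord0 u + \sum_(i < n) F (lift ord0 i) u)).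
  by apply: trigpolyD => //; exact: IH.
by apply/funext => u; rewrite big_ord_recl.
Qed.

Lemma trigpoly_mode k a b : trigpoly (fun u => a * ecos k u + b * esin k u).
Proof.
rewrite (_ : (fun u => _) = (fun u => (a * ecos k u + b * esin k u) + 0)).
  exact/trigpolyS/trigpoly0.
by apply/funext => u; rewrite addr0.
Qed.

Lemma trigpoly_fejer n f : trigpoly (fejer n f).
Proof.
apply: trigpolyZ; apply: trigpoly_sum => i; apply: trigpoly_sum => j.
exact: trigpoly_mode.
Qed.

Lemma is_derive_mode k a b u : is_derive u 1
  (fun v => a * ecos k v + b * esin k v)
  ((freq k * b) * ecos k u + (- freq k * a) * esin k u).
Proof.
have h1 := is_derive_ecos k u; have h2 := is_derive_esin k u.
by apply: is_derive_eq; rewrite /GRing.scale/=; ring.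
Qed.

Lemma trigpoly_derive p : trigpoly p ->
  exists2 q, trigpoly q & forall u, is_derive u 1 p (q u).
Proof.
elim=> [|k a b {}p _ [q tq dq]].
  by exists (fun=> 0) => [|u]; [exact: trigpoly0|exact: is_derive_cst].
exists (fun u => ((freq k * b) * ecos k u + (- freq k * a) * esin k u) + q u).
  exact: trigpolyS.
move=> u; have h1 := is_derive_mode k a b u; have h2 := dq u.
exact: (is_deriveD h1 h2).
Qed.

Lemma derive1_eq f g : (forall u : R, is_derive u 1 f (g u)) -> derive1 f = g.
Proof. by move=> d; apply/funext => u; rewrite derive1E; have [_ ->] := d u. Qed.

Lemma trigpoly_smooth p : trigpoly p -> smooth p.
Proof.
move=> tp; split.
  elim: tp => [//|k a b {}p _ IH] u.
  by rewrite periodic_ecos periodic_esin IH.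
move=> n; elim: n p tp => [|n IH] p tp u; have [q tq dq] := trigpoly_derive tp.
  by have [] := dq u.
by rewrite derive1Sn (derive1_eq dq); exact: IH.
Qed.

Lemma is_derive_sum_fun n (h : 'I_n -> R -> R) (dh : 'I_n -> R) u :
  (forall i, is_derive u 1 (h i) (dh i)) ->
  is_derive u 1 (fun v => \sum_(i < n) h i v) (\sum_(i < n) dh i).
Proof.
move=> d; rewrite (_ : (fun v => _) = \sum_(i < n) h i); first exact: is_derive_sum.
by apply/funext => v; rewrite fct_sumE.
Qed.

(** Integration by parts: the derivative of G times a mode integrates to a boundary term, which
    periodicity cancels. *)
Lemma fourier_derive G G' k : periodic1 G ->
  (forall u, is_derive u 1 G (G' u)) -> continuous G' ->
  fourier_cos G' k = freq k * fourier_sin G k /\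
  fourier_sin G' k = - freq k * fourier_cos G k.
Proof.
move=> pG dG cG'; have cG := is_derive_continuous dG.
have iG := circle_integrable_cont cG; have iG' := circle_integrable_cont cG'.
have Gc := circle_integrableMl iG (@continuous_ecos _ k).
have Gs := circle_integrableMl iG (@continuous_esin _ k).
have G'c := circle_integrableMl iG' (@continuous_ecos _ k).
have G's := circle_integrableMl iG' (@continuous_esin _ k).
have G01 : G 1 = G 0 by rewrite -[RHS]pG add0r.
have e01 : ecos k 1 = ecos k 0 :> R by rewrite -[RHS]periodic_ecos add0r.
have s01 : esin k 1 = esin k 0 :> R by rewrite -[RHS]periodic_esin add0r.
split; apply/eqP; rewrite -subr_eq0.
- rewrite -circle_integralZ// -circle_integralB//; last exact: circle_integrableZ.
  have d u : is_derive u 1 (fun v => G v * ecos k v)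
      (G' u * ecos k u - freq k * (G u * esin k u)).
    have h1 := is_derive_ecos k u; have h2 := dG u.
    by apply: (is_derive_eq (is_deriveM h2 h1)); rewrite /GRing.scale/=; ring.
  rewrite (circle_integral_FTC _ d) ?G01 ?e01 ?subrr//.
  move=> u; apply: cvgB; first by apply: cvgM; [exact: cG'|exact: continuous_ecos].
  apply: cvgM; first exact: cvg_cst.
  by apply: cvgM; [exact: cG|exact: continuous_esin].
- rewrite -circle_integralZ// -circle_integralB//; last exact: circle_integrableZ.
  have d u : is_derive u 1 (fun v => G v * esin k v)
      (G' u * esin k u - - freq k * (G u * ecos k u)).
    have h1 := is_derive_esin k u; have h2 := dG u.
    by apply: (is_derive_eq (is_deriveM h2 h1)); rewrite /GRing.scale/=; ring.
  rewrite (circle_integral_FTC _ d) ?G01 ?s01 ?subrr//.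
  move=> u; apply: cvgB; first by apply: cvgM; [exact: cG'|exact: continuous_esin].
  apply: cvgM; first exact: cvg_cst.
  by apply: cvgM; [exact: cG|exact: continuous_ecos].
Qed.

(** Differentiation acts on the coefficients mode by mode, so it commutes with Fejer means. The
    derivatives of the Fejer means of a C^2 function therefore converge as well, which carries the
    weak equation from trigonometric polynomials to C^2 test functions. *)
Lemma is_derive_fejer n G G' u : periodic1 G ->
  (forall u, is_derive u 1 G (G' u)) -> continuous G' ->
  is_derive u 1 (fejer n G) (fejer n G' u).
Proof.
move=> pG dG cG'; rewrite /fejer.
apply: is_deriveZ; apply: is_derive_sum_fun => i; apply: is_derive_sum_fun => j.
by have [-> ->] := fourier_derive (i%:Z - j%:Z) pG dG cG'; exact: is_derive_mode.
Qed.

Lemma periodic_derive1 f : periodic1 f -> periodic1 (derive1 f).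
Proof.
move=> pf u; rewrite /derive1 (_ : (fun h => h^-1 *: (f (h + (u + 1)) - f (u + 1))) =
  fun h => h^-1 *: (f (h + u) - f u))//.
by apply/funext => h; rewrite addrA !pf.
Qed.

End trigonometric_polynomials.

(** * Fourier coefficients determine an integrable function almost everywhere *)

Section fourier_uniqueness.
Context {R : realType}.
Implicit Types (k l : int) (u s a b : R) (f G p q : R -> R).
Local Notation mu := (@lebesgue_measure R).

Lemma itv_dominated a b (F : nat -> R -> R) f g :
  (forall n, mu.-integrable `[a, b] (EFin \o F n)) ->
  mu.-integrable `[a, b] (EFin \o g) ->
  (forall u, a <= u <= b -> F n u @[n --> \oo] --> f u) ->
  (forall n u, a <= u <= b -> `|F n u| <= g u) ->
  mu.-integrable `[a, b] (EFin \o f) /\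
  \int[mu]_(u in `[a, b]) F n u @[n --> \oo] --> \int[mu]_(u in `[a, b]) f u.
Proof.
move=> Fi gi Ff Fg.
have mF n : measurable_fun (`[a, b]%classic : set R) (EFin \o F n).
  exact: measurable_int (Fi n).
have cF u : (`[a, b]%classic : set R) u ->
    (fun n => (EFin \o F n) u) @ \oo --> (EFin \o f) u.
  by rewrite /= in_itv/= => uab; apply: cvg_EFin; [exact: nearW|exact: Ff].
have mf : measurable_fun (`[a, b]%classic : set R) (EFin \o f).
  by apply: (emeasurable_fun_cvg (fun n => EFin \o F n)) => // u; exact: cF.
have [] := @dominated_convergence _ _ _ mu _ (measurable_itv `[a, b])
  (fun n => EFin \o F n) (EFin \o f) (EFin \o g) mF mf.
- by apply: aeW => u; exact: cF.
- exact: gi.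
- by apply: aeW => u n; rewrite /= in_itv/= => uab; rewrite lee_fin Fg.
move=> fi _ cv; split=> //; rewrite /Rintegral.
by apply: fine_cvg; rewrite fineK; [exact: cv|exact: integrable_fin_num].
Qed.

Lemma circle_dominated (F : nat -> R -> R) f g :
  (forall n, circle_integrable (F n)) -> circle_integrable g ->
  (forall u, 0 <= u <= 1 -> F n u @[n --> \oo] --> f u) ->
  (forall n u, 0 <= u <= 1 -> `|F n u| <= g u) ->
  circle_integrable f /\ circle_integral (F n) @[n --> \oo] --> circle_integral f.
Proof. exact: itv_dominated. Qed.

Lemma circle_integral_trigpoly0 f p : circle_integrable f ->
  (forall k, fourier_cos f k = 0 /\ fourier_sin f k = 0) -> trigpoly p ->
  circle_integral (fun u => f u * p u) = 0.
Proof.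
move=> fi f0; elim=> [|k a b {}p tp IH].
  rewrite -[RHS](circle_integral_cst 0); congr circle_integral.
  by apply/funext => u; rewrite mulr0.
have cp := smooth_cont (trigpoly_smooth tp).
have i1 := circle_integrableMl fi (@continuous_ecos _ k).
have i2 := circle_integrableMl fi (@continuous_esin _ k).
have i3 := circle_integrableMl fi cp.
rewrite (_ : (fun u => _) = (fun u => (a * (f u * ecos k u) + b * (f u * esin k u))
   + f u * p u)); last by apply/funext => u; ring.
have j1 := circle_integrableZ a i1; have j2 := circle_integrableZ b i2.
rewrite circle_integralD//; last exact: circle_integrableD.
rewrite circle_integralD// !circle_integralZ// IH.
by have [] := f0 k; rewrite /fourier_cos /fourier_sin => -> ->; ring.
Qed.

(** The function f is merely integrable, so the approximation is put on G: Fejer means converge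
    uniformly and the error is at most the uniform distance times the L^1 norm of f. *)
Lemma circle_integral_cont0 f G : circle_integrable f ->
  (forall k, fourier_cos f k = 0 /\ fourier_sin f k = 0) ->
  periodic1 G -> continuous G -> circle_integral (fun u => f u * G u) = 0.
Proof.
move=> fi f0 pG cG; apply/eqP; rewrite -normr_eq0 eq_le normr_ge0 andbT.
apply/ler_addgt0Pl => e e0; rewrite addr0.
have fn := circle_integrable_norm fi.
pose A := circle_integral (fun u => `|f u|).
have A0 : 0 <= A by apply: Rintegral_ge0.
have d0 : 0 < e / (A + 1) by rewrite divr_gt0// ltr_wpDl.
have [n /(_ n.+1)H] := fejer_cvg pG cG d0.
have tp := trigpoly_fejer n.+1 G.
have cp := smooth_cont (trigpoly_smooth tp).
rewrite -[circle_integral _]subr0 -(circle_integral_trigpoly0 fi f0 tp).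
have i1 := circle_integrableMl fi cG; have i2 := circle_integrableMl fi cp.
rewrite -circle_integralB//.
apply: le_trans (circle_integral_norm (circle_integrableB i1 i2)) _.
apply: (@le_trans _ _ (circle_integral (fun u => e / (A + 1) * `|f u|))).
  apply: circle_integral_le.
  - exact/circle_integrable_norm/circle_integrableB.
  - exact: circle_integrableZ.
  - by move=> u _; rewrite -mulrBr normrM mulrC ler_wpM2r// distrC H.
rewrite circle_integralZ// -/A mulrAC ler_pdivrMr ?ltr_wpDl//.
by rewrite ler_wpM2l ?lerDl// ltW.
Qed.

Lemma sin_pi_gt0 u : 0 < u < 1 -> 0 < sin (pi * u).
Proof.
by move=> /andP[u0 u1]; apply: sin_gt0_pi; rewrite mulr_gt0 ?pi_gt0//= gtr_pMr ?pi_gt0.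
Qed.

Lemma sin_pi_ge0 u : 0 <= u <= 1 -> 0 <= sin (pi * u).
Proof.
move=> /andP[u0 u1]; apply: sin_ge0_pi.
by rewrite mulr_ge0 ?pi_ge0//= ler_piMr ?pi_ge0.
Qed.

(* The indicator of ]0, x[ is the pointwise limit of the continuous 1-periodic
   functions min (1, n max (0, sin (pi u) sin (pi (x - u)))). *)
Lemma circle_integral_itv0 f x : circle_integrable f ->
  (forall k, fourier_cos f k = 0 /\ fourier_sin f k = 0) ->
  0 <= x <= 1 -> \int[mu]_(u in `[0, x]) f u = 0.
Proof.
move=> fi f0 /andP[x0 x1].
(* Both factors change sign under u -> u + 1, so the product is 1-periodic; on [0, 1] it is positive
   exactly on ]0, x[. *)
pose h u := sin (pi * u) * sin (pi * (x - u)).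
have ch : continuous h.
  have cpi : continuous (fun u : R => pi * u).
    by move=> u; apply: cvgM; [exact: cvg_cst|exact: cvg_id].
  move=> u; apply: cvgM.
    by apply: (@continuous_comp _ _ _ (fun u => pi * u) sin); [exact: cpi|exact: continuous_sin].
  apply: (@continuous_comp _ _ _ (fun u => pi * (x - u)) sin); last exact: continuous_sin.
  by apply: cvgM; [exact: cvg_cst|apply: cvgB; [exact: cvg_cst|exact: cvg_id]].
have ph : periodic1 h.
  move=> u; rewrite /h mulrDr mulr1 sinDpi opprD addrA mulrBr mulr1 sinB.
  by rewrite cospi sinpi; ring.
pose G n u := Num.min 1 (n%:R * Num.max 0 (h u)).
have pG n : periodic1 (G n) by move=> u; rewrite /G ph.
have cG n : continuous (G n).
  move=> u; apply: (@continuous_min _ _ (fun=> 1) (fun u => n%:R * Num.max 0 (h u))).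
    exact: cvg_cst.
  apply: cvgM; first exact: cvg_cst.
  by apply: (@continuous_max _ _ (fun=> 0) h); [exact: cvg_cst|exact: ch].
have G01 n u : 0 <= G n u <= 1.
  by rewrite /G ge_min lexx/= le_min ler01/= mulr_ge0// le_max lexx.
have Gf n : circle_integrable (fun u => f u * G n u) by exact: circle_integrableMl.
have fn := circle_integrable_norm fi.
have lim u : 0 <= u <= 1 ->
    f u * G n u @[n --> \oo] --> f u * \1_(`]0, x[%classic) u.
  move=> /andP[u0 u1]; apply: cvgM; first exact: cvg_cst.
  have [hu|hu] := leP (h u) 0.
    rewrite indicE memNset; last first.
      rewrite /= in_itv/= => /andP[au ux]; move: hu; rewrite leNgt => /negP; apply.
      by rewrite mulr_gt0//; apply: sin_pi_gt0; lra.
    apply: cvg_near_cst; apply: nearW => n.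
    by rewrite /G max_l// mulr0 min_r.
  rewrite indicE mem_set; last first.
    rewrite /= in_itv/=; apply/andP; split; rewrite ltNge; apply/negP => H;
      move: hu; rewrite ltNge => /negP; apply; rewrite /h.
      have -> : u = 0 by lra.
      by rewrite mulr0 sin0 mul0r.
    apply: mulr_ge0_le0; first by apply: sin_pi_ge0; lra.
    rewrite -[x - u]opprB mulrN sinN oppr_le0; apply: sin_pi_ge0; lra.
  have [m hm] : exists m, (h u)^-1 < m%:R by exists (Num.truncn (h u)^-1).+1; exact: truncnS_gt.
  apply: cvg_near_cst; exists m => // n /= mn.
  rewrite /G min_l// max_r ?(ltW hu)// -ler_pdivrMr// div1r (le_trans (ltW hm))//.
  by rewrite ler_nat.
have bd n u : 0 <= u <= 1 -> `|f u * G n u| <= `|f u|.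
  move=> _; rewrite normrM ler_piMr//; have /andP[g0 g1] := G01 n u.
  by rewrite ger0_norm.
have [i1 c1] := circle_dominated Gf fn lim bd.
have c2 : circle_integral (fun u => f u * G n u) @[n --> \oo] --> (0 : R).
  apply: cvg_near_cst; apply: nearW => n; exact: circle_integral_cont0.
have L0 := cvg_unique _ c1 c2.
have ix : mu.-integrable `]0, x[ (EFin \o f).
  apply: integrableS fi => //; apply: subset_itvScc; rewrite bnd_simp//.
have ix' : mu.-integrable `]0, x] (EFin \o f).
  apply: integrableS fi => //; apply: subset_itvScc; rewrite bnd_simp//.
rewrite -Rintegral_itv_obnd_cbnd// -Rintegral_itv_bndo_bndc// -[RHS]L0//.
have -> : (fun u => f u * \1_(`]0, x[%classic) u) = f \_ (`]0, x[%classic).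
  by rewrite patch_indic.
rewrite /circle_integral -Rintegral_mkcondr setIidr//.
by apply: subset_itvScc; rewrite bnd_simp.
Qed.

(** All integrals of f over [0, x] vanish, and Lebesgue differentiation recovers f almost everywhere
    as the derivative of this zero primitive. Extending f by zero outside [0, 1] makes it integrable
    on the line. *)
Lemma fourier_unique f : circle_integrable f ->
  (forall k, fourier_cos f k = 0 /\ fourier_sin f k = 0) ->
  {ae mu, forall u, u \in `[0, 1] -> f u = 0}.
Proof.
move=> fi f0; pose f' : R -> R := f \_ (`[0, 1]%classic).
have lf : locally_integrable [set: R] f' by exact: integrable_locally.
have fi' : mu.-integrable setT (EFin \o f').
  by move: fi; rewrite /circle_integrable integrable_mkcond// restrict_EFin.
have fiy (y : R) : mu.-integrable [set` Interval (BLeft (0 : R)) (BRight y)] (EFin \o f').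
  exact: integrableS fi'.
have H := FTC1 fiy lf.
(* The primitive is known to vanish only for upper limits in [0, 1], so its derivative is computed
   at interior points; the two endpoints form a null set. *)
have N : {ae mu, forall u : R, u != 0 /\ u != 1}.
  exists [set 0; 1]; split.
  - exact: measurableU.
  - rewrite measureU0//; exact: lebesgue_measure_set1.
  - move=> u /= h; have [->|n0] := eqVneq u 0; first by left.
    by have [->|n1] := eqVneq u 1; [right|case: h].
move: H N; apply: filterS2; first exact: (ae_filter_ringOfSetsType mu).
move=> u H [n0 n1] u01.
have {}u01 : 0 < u < 1.
  by move: u01; rewrite in_itv/= !lt_neqAle eq_sym n0 n1 => /andP[-> ->].
have /andP[u0 u1] := u01.
case: H => [|_]; first by rewrite /= lte_fin.
rewrite /f' patchT; last by rewrite inE/= in_itv/= !ltW.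
move=> <-; rewrite derive1E.
rewrite (near_eq_derive (g := cst 0)); first exact: derive_cst.
near=> y.
have y01 : 0 <= y <= 1.
  by apply/andP; split; apply: ltW; near: y; [exact: lt_nbhsr|exact: lt_nbhsl].
rewrite -[RHS](circle_integral_itv0 fi f0 y01); apply: eq_Rintegral => z.
rewrite inE/= in_itv/= => /andP[z0 zy]; rewrite patchT// inE/= in_itv/= z0/=.
by apply: le_trans zy _; have /andP[] := y01.
Unshelve. all: by end_near. Qed.

End fourier_uniqueness.

(** * Linear differential equations from one-sided increments *)

Section ode.
Context {R : realType}.
Implicit Types (f g u F : R -> R) (a b x y t s h e d B K T rho : R).

Lemma is_derive_expansion f (x df e : R) : is_derive x 1 f df -> 0 < e ->
  exists2 d, 0 < d & forall h, 0 < h < d -> `|f (x + h) - f x - h * df| <= h * e.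
Proof.
move=> [df1 <-] e0; have := df1; rewrite /derivable => /cvg_ex[l cl].
have <- : l = 'D_1 f x by rewrite /derive; apply/esym; apply: cvg_lim.
move/cvgrPdist_le: cl => /(_ e e0); rewrite near_withinE => /nbhs_ballP[d d0 H].
exists d => // h /andP[h0 hd].
have := H h; rewrite /ball/= sub0r normrN gtr0_norm// => /(_ hd).
rewrite gt_eqF// => /(_ isT); rewrite /GRing.scale/= mulr1 [h + x]addrC => E.
have -> : f (x + h) - f x - h * l = - (h * (l - h^-1 * (f (x + h) - f x))).
  rewrite mulrBr mulrA divff ?gt_eqF//; ring.
by rewrite normrN normrM (gtr0_norm h0) ler_wpM2l ?(ltW h0).
Qed.

Lemma uniform_step t d : 0 < d -> 0 < t ->
  exists n : nat, [/\ (0 < n)%N & t / n%:R < d].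
Proof.
move=> d0 t0; exists (Num.truncn (t / d)).+1; split=> //.
by rewrite ltr_pdivrMr ?ltr0n// mulrC -ltr_pdivrMr// truncnS_gt.
Qed.

Lemma zero_derivative_constant F T :
  (forall e, 0 < e -> exists2 d, 0 < d & forall s h, 0 <= s -> 0 < h < d ->
     s + h <= T -> `|F (s + h) - F s| <= h * e) ->
  forall t, 0 <= t <= T -> F t = F 0.
Proof.
move=> HF t /andP[]; rewrite le_eqVlt => /predU1P[<-//|t0] tT.
apply/eqP; rewrite -subr_eq0 -normr_eq0 eq_le normr_ge0 andbT.
apply/ler_addgt0Pl => e e0; rewrite addr0.
have et0 : 0 < e / t by rewrite divr_gt0.
have [d d0 Hd] := HF _ et0.
have [n [n0 nd]] := uniform_step d0 t0.
set h := t / n%:R in nd.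
have nn : n%:R != 0 :> R by rewrite pnatr_eq0 -lt0n.
have h0 : 0 < h by rewrite divr_gt0// ltr0n.
have H j : (j <= n)%N -> `|F (j%:R * h) - F 0| <= j%:R * h * (e / t).
  elim: j => [|j IH] jn; first by rewrite !mul0r subrr normr0.
  have -> : j.+1%:R * h = j%:R * h + h by rewrite -natr1; ring.
  rewrite -(subrKA (F (j%:R * h))); apply: (le_trans (ler_normD _ _)).
  rewrite [leRHS]mulrDl addrC; apply: lerD; first exact: IH (ltnW jn).
  have jh0 : 0 <= j%:R * h by rewrite mulr_ge0// ltW.
  have hd : 0 < h < d by rewrite h0.
  apply: (Hd _ _ jh0 hd).
  have -> : j%:R * h + h = j.+1%:R * h by rewrite -natr1; ring.
  apply: le_trans tT; rewrite /h mulrCA ger_pMr// ler_pdivrMr ?ltr0n// mul1r.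
  by rewrite ler_nat.
have := H n (leqnn n).
by rewrite /h mulrCA divff// mulr1 mulrCA divff ?gt_eqF// mulr1.
Qed.

(** Gronwall's inequality on a grid: each step multiplies by 1 - a h, which is at most exp(- a h),
    and the forcing is damped afterwards, so it accumulates to at most t K. Only upper bounds on
    increments are needed, as the generator gives them for a nonnegative observable. *)
Lemma gronwall_step u a K : 0 <= a -> 0 <= K -> (forall s, 0 <= s -> 0 <= u s) ->
  (forall e, 0 < e -> exists2 d, 0 < d & forall s h, 0 <= s -> 0 < h < d ->
     u (s + h) <= u s + h * (- a * u s + K + e)) ->
  forall t, 0 <= t -> u t <= expR (- a * t) * u 0 + t * K.
Proof.
move=> a0 K0 u0 Hu t; rewrite le_eqVlt => /predU1P[<-|t0].
  by rewrite mulr0 expR0 mul1r mul0r addr0.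
apply/ler_addgt0Pl => e e0.
have et0 : 0 < e / t by rewrite divr_gt0.
have [d d0 Hd] := Hu _ et0.
have [n [n0 nd]] := uniform_step d0 t0.
set h := t / n%:R in nd.
have nn : n%:R != 0 :> R by rewrite pnatr_eq0 -lt0n.
have h0 : 0 < h by rewrite divr_gt0// ltr0n.
have H j : u (j%:R * h) <= expR (- a * (j%:R * h)) * u 0 + j%:R * h * (K + e / t).
  elim: j => [|j IH]; first by rewrite !mul0r mulr0 expR0 mul1r addr0.
  have -> : j.+1%:R * h = j%:R * h + h by rewrite -natr1; ring.
  have jh0 : 0 <= j%:R * h by rewrite mulr_ge0// ltW.
  have hd : 0 < h < d by rewrite h0.
  apply: (le_trans (Hd _ _ jh0 hd)).
  have e1 : 1 - a * h <= expR (- a * h) by rewrite -mulNr expR_ge1Dx.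
  have e2 : expR (- a * h) <= 1 by rewrite -[leRHS]expR0 ler_expR mulNr oppr_le0 mulr_ge0// ltW.
  have uj := u0 _ jh0.
  apply: (@le_trans _ _ (expR (- a * h) * u (j%:R * h) + h * (K + e / t))).
    have := ler_wpM2r uj e1; lra.
  have -> : expR (- a * (j%:R * h + h)) = expR (- a * h) * expR (- a * (j%:R * h)).
    by rewrite -expRD; congr expR; ring.
  have := ler_wpM2l (expR_ge0 (- a * h)) IH.
  have : expR (- a * h) * (j%:R * h * (K + e / t)) <= j%:R * h * (K + e / t).
    by rewrite ler_piMl// mulr_ge0// addr_ge0// ltW.
  lra.
have := H n; have -> : n%:R * h = t by rewrite /h mulrCA divff// mulr1.
have -> : t * (K + e / t) = e + t * K by field; rewrite gt_eqF.
by rewrite addrCA.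
Qed.

(* The flow of x' = - a x + b y, y' = - a y - b x. *)
Definition decay_cos a b x y t : R := expR (- a * t) * (cos (b * t) * x + sin (b * t) * y).
Definition decay_sin a b x y t : R := expR (- a * t) * (cos (b * t) * y - sin (b * t) * x).

Lemma decay_sqr a b x y t :
  decay_cos a b x y t ^+ 2 + decay_sin a b x y t ^+ 2 =
  expR (- a * t) ^+ 2 * (x ^+ 2 + y ^+ 2).
Proof.
rewrite -[x ^+ 2 + _]mul1r -(cos2Dsin2 (b * t)) /decay_cos /decay_sin; ring.
Qed.

Lemma decay_norm a b x y t (M : R) : `|x| <= M -> `|y| <= M ->
  `|decay_cos a b x y t| <= 2 * M * expR (- a * t) /\
  `|decay_sin a b x y t| <= 2 * M * expR (- a * t).
Proof.
move=> xM yM; rewrite !normrM (ger0_norm (expR_ge0 _)) ![expR _ * _]mulrC.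
have c1 := cos_max (b * t); have s1 := sin_max (b * t).
split; rewrite ler_wpM2r ?expR_ge0// mulr_natl mulr2n.
  apply: (le_trans (ler_normD _ _)); rewrite !normrM.
  by apply: lerD; rewrite -[leRHS]mul1r ler_pM.
apply: (le_trans (ler_normB _ _)); rewrite !normrM.
by apply: lerD; rewrite -[leRHS]mul1r ler_pM.
Qed.

(** The flow is linear, so the difference of two orbits is the orbit of the difference. The factor 2
    bounds |cos| + |sin|. *)
Lemma decay_lipschitz a b x y x' y' rho t : 0 <= a -> 0 <= t ->
  `|x - x'| <= rho -> `|y - y'| <= rho ->
  `|decay_cos a b x y t - decay_cos a b x' y' t| <= 2 * rho /\
  `|decay_sin a b x y t - decay_sin a b x' y' t| <= 2 * rho.
Proof.
move=> a0 t0 hx hy; have [h1 h2] := decay_norm a b t hx hy.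
have le1 : 2 * rho * expR (- a * t) <= 2 * rho.
  rewrite ler_piMr ?mulr_ge0 ?(le_trans _ hx)//.
  by rewrite -[leRHS]expR0 ler_expR mulNr oppr_le0 mulr_ge0.
split; apply: le_trans le1.
  rewrite (_ : _ - _ = decay_cos a b (x - x') (y - y') t)//; rewrite /decay_cos; ring.
rewrite (_ : _ - _ = decay_sin a b (x - x') (y - y') t)//; rewrite /decay_sin; ring.
Qed.

Lemma decayD a b x y s t :
  decay_cos a b x y (s + t) = decay_cos a b (decay_cos a b x y t) (decay_sin a b x y t) s /\
  decay_sin a b x y (s + t) = decay_sin a b (decay_cos a b x y t) (decay_sin a b x y t) s.
Proof.
by rewrite /decay_cos /decay_sin !(mulrDr _ s t) cosD sinD expRD; split; ring.
Qed.

Lemma decay0 a b x y : decay_cos a b x y 0 = x /\ decay_sin a b x y 0 = y.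
Proof.
by rewrite /decay_cos /decay_sin !mulr0 expR0 cos0 sin0 !mul0r !mul1r addr0 subr0.
Qed.

(** Linearity makes the expansion uniform over bounded starting points: only the two scalar
    functions exp(- a h) cos(b h) and exp(- a h) sin(b h) have to be expanded at 0. *)
Lemma decay_expansion a b B e : 0 <= B -> 0 < e ->
  exists2 d, 0 < d & forall h x y, 0 < h < d -> `|x| <= B -> `|y| <= B ->
  `|decay_cos a b x y h - x - h * (- a * x + b * y)| <= h * e /\
  `|decay_sin a b x y h - y - h * (- a * y - b * x)| <= h * e.
Proof.
move=> B0 e0; have e'0 : 0 < e / (2 * B + 1) by rewrite divr_gt0// ltr_wpDl// mulr_ge0.
have d1 : is_derive (0 : R) 1 (fun h => expR (- a * h) * cos (b * h)) (- a).
  by apply: is_derive_eq; rewrite /GRing.scale/= !mulr0 expR0 cos0 sin0; ring.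
have d2 : is_derive (0 : R) 1 (fun h => expR (- a * h) * sin (b * h)) b.
  by apply: is_derive_eq; rewrite /GRing.scale/= !mulr0 expR0 cos0 sin0; ring.
have [x1 x10 H1] := is_derive_expansion d1 e'0.
have [x2 x20 H2] := is_derive_expansion d2 e'0.
exists (Num.min x1 x2) => [|h x y /andP[h0]]; first by rewrite lt_min x10.
rewrite lt_min => /andP[h1 h2] xB yB.
have := H1 h; rewrite h0 h1 !add0r !mulr0 expR0 cos0 mul1r => /(_ isT).
have := H2 h; rewrite h0 h2 !add0r !mulr0 sin0 mulr0 subr0 => /(_ isT).
set r2 := (X in `|X|); set r1 := (X in _ -> `|X| <= _ -> _) => A2 A1.
have K (z w : R) : `|z| <= B -> `|w| <= B -> `|r1 * z + r2 * w| <= h * e.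
  move=> zB wB; apply: (@le_trans _ _ (h * (e / (2 * B + 1)) * B + h * (e / (2 * B + 1)) * B)).
    by apply: (le_trans (ler_normD _ _)); rewrite !normrM; apply: lerD; exact: ler_pM.
  rewrite -mulrDr -mulrA ler_wpM2l ?(ltW h0)// mulrAC ler_pdivrMr ?ltr_wpDl ?mulr_ge0//.
  by rewrite ler_wpM2l ?(ltW e0)//; lra.
split.
  by rewrite (_ : _ - _ = r1 * x + r2 * y); [exact: K|rewrite /r1 /r2 /decay_cos; ring].
rewrite (_ : _ - _ = r1 * y + r2 * - x); first by apply: K; rewrite ?normrN.
by rewrite /r1 /r2 /decay_sin; ring.
Qed.

(* Transporting the value at time s by the explicit flow up to time t gives a
   function of s with vanishing derivative. *)
Lemma rotation_ode f g a b B T : 0 <= a ->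
  (forall s, 0 <= s <= T -> `|f s| <= B /\ `|g s| <= B) ->
  (forall e, 0 < e -> exists2 d, 0 < d & forall s h, 0 <= s -> 0 < h < d ->
     s + h <= T ->
     `|f (s + h) - f s - h * (- a * f s + b * g s)| <= h * e /\
     `|g (s + h) - g s - h * (- a * g s - b * f s)| <= h * e) ->
  forall t, 0 <= t <= T ->
   f t = decay_cos a b (f 0) (g 0) t /\ g t = decay_sin a b (f 0) (g 0) t.
Proof.
move=> a0 fgB Hfg t tT; have /andP[t0 tT'] := tT.
have B0 : 0 <= B by have [] := fgB t tT => /(le_trans (normr_ge0 _)).
pose F s := decay_cos a b (f s) (g s) (t - s).
pose G s := decay_sin a b (f s) (g s) (t - s).
have step e : 0 < e -> exists2 d, 0 < d & forall s h, 0 <= s -> 0 < h < d ->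
     s + h <= t -> `|F (s + h) - F s| <= h * e /\ `|G (s + h) - G s| <= h * e.
  (* The true increment and the flow each differ from the first-order term by at most h e / 4, hence
     from each other by h e / 2; [decay_lipschitz] then doubles this to h e. *)
  move=> e0; have e40 : 0 < e / 4 by rewrite divr_gt0.
  have [d1 d10 H1] := Hfg _ e40; have [d2 d20 H2] := decay_expansion a b B0 e40.
  exists (Num.min d1 d2) => [|s h s0 /andP[h0]]; first by rewrite lt_min d10.
  rewrite lt_min => /andP[h1 h2] sht; have shT := le_trans sht tT'.
  have sT : 0 <= s <= T by rewrite s0 (le_trans _ shT)// lerDl ltW.
  have h01 : 0 < h < d1 by rewrite h0.
  have h02 : 0 < h < d2 by rewrite h0.
  have [fB gB] := fgB s sT; have [X1 X2] := H1 s h s0 h01 shT.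
  have [Y1 Y2] := H2 h _ _ h02 fB gB.
  have close (x y z w : R) : `|x - z - w| <= h * (e / 4) -> `|y - z - w| <= h * (e / 4) ->
      `|x - y| <= h * (e / 2).
    move=> xz yz; rewrite (_ : x - y = (x - z - w) - (y - z - w)); last by ring.
    by apply: (le_trans (ler_normB _ _)); lra.
  have r0 : 0 <= t - (s + h) by rewrite subr_ge0.
  have [Z1 Z2] := decay_lipschitz b a0 r0 (close _ _ _ _ X1 Y1) (close _ _ _ _ X2 Y2).
  have [E1 E2] := decayD a b (f s) (g s) (t - (s + h)) h.
  move: Z1 Z2; rewrite -E1 -E2 (_ : t - (s + h) + h = t - s); last by ring.
  by rewrite (_ : 2 * (h * (e / 2)) = h * e); [split|field].
have tt : 0 <= t <= t by rewrite t0 lexx.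
have F0 : F t = F 0.
  apply: (@zero_derivative_constant F t) tt => e e0; have [d d0 H] := step e e0.
  by exists d => // s h s0 hd sT; have [] := H s h s0 hd sT.
have G0 : G t = G 0.
  apply: (@zero_derivative_constant G t) tt => e e0; have [d d0 H] := step e e0.
  by exists d => // s h s0 hd sT; have [] := H s h s0 hd sT.
by move: F0 G0; rewrite /F /G subrr subr0 (decay0 _ _ _ _).1 (decay0 _ _ _ _).2.
Qed.

End ode.

(** * Finite Fourier series and Bessel's inequality *)

Section trigonometric_sums.
Context {R : realType}.
Implicit Types (k l : int) (u : R) (f : R -> R) (c s : nat -> R).

Lemma fourier_cosN f k : fourier_cos f (- k) = fourier_cos f k.
Proof.
rewrite /fourier_cos; congr circle_integral; apply/funext => u.
by rewrite /ecos /freq mulrNz mulrN mulNr cosN.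
Qed.

Lemma fourier_sinN f k : circle_integrable f ->
  fourier_sin f (- k) = - fourier_sin f k.
Proof.
move=> fi; rewrite /fourier_sin -[RHS]mulN1r -circle_integralZ; last first.
  exact: (circle_integrableMl fi (@continuous_esin _ k)).
congr circle_integral; apply/funext => u.
by rewrite /esin /freq mulrNz mulrN mulNr sinN; ring.
Qed.

(** The Fourier partial sum with the frequencies k and -k merged: hence the factor 2 on positive
    frequencies and none on the mean. The value [s 0] does not occur. *)
Definition trig_sum n c s u : R := c 0%N +
  \sum_(k < n) 2 * (c k.+1 * ecos k.+1 u + s k.+1 * esin k.+1 u).

Lemma trigpoly_trig_sum n c s : trigpoly (trig_sum n c s).
Proof.
rewrite /trig_sum (_ : (fun u => _) = (fun u => (c 0%N * ecos 0 u + 0 * esin 0 u) +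
  \sum_(k < n) 2 * (c k.+1 * ecos k.+1 u + s k.+1 * esin k.+1 u))).
  apply: trigpolyS; apply: trigpoly_sum => i; apply: trigpolyZ; exact: trigpoly_mode.
by apply/funext => u; rewrite ecos0 mul0r addr0 mulr1.
Qed.

Lemma continuous_trig_sum n c s : continuous (trig_sum n c s).
Proof. exact/smooth_cont/trigpoly_smooth/trigpoly_trig_sum. Qed.

Lemma circle_integral_trig_sum f n c s : circle_integrable f ->
  circle_integral (fun u => f u * trig_sum n c s u) =
  c 0%N * fourier_cos f 0 +
  \sum_(k < n) 2 * (c k.+1 * fourier_cos f k.+1 + s k.+1 * fourier_sin f k.+1).
Proof.
move=> fi.
have i1 k := circle_integrableMl fi (@continuous_ecos _ k).
have i2 k := circle_integrableMl fi (@continuous_esin _ k).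
have ij (k : 'I_n) : circle_integrable (fun u => 2 * (c k.+1 * (f u * ecos k.+1 u) + s k.+1 * (f u * esin k.+1 u))).
  by apply/circle_integrableZ/circle_integrableD; exact: circle_integrableZ.
have [j1 j2] := circle_integral_sum ij.
have -> : (fun u => f u * trig_sum n c s u) = (fun u => c 0%N * (f u * ecos 0 u) +
   \sum_(k < n) 2 * (c k.+1 * (f u * ecos k.+1 u) + s k.+1 * (f u * esin k.+1 u))).
  apply/funext => u; rewrite /trig_sum mulrDr ecos0 mulr1 [f u * c _]mulrC mulr_sumr.
  by congr (_ + _); apply: eq_bigr => k _; ring.
rewrite circle_integralD//; last exact: circle_integrableZ.
rewrite (circle_integralZ _ (i1 0)) j2; congr (_ + _).
apply: eq_bigr => k _; rewrite circle_integralZ; last by apply: circle_integrableD; exact: circle_integrableZ.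
rewrite circle_integralD; [|exact: circle_integrableZ|exact: circle_integrableZ].
by rewrite !circle_integralZ.
Qed.

Lemma fourier_ecos l k : fourier_cos (@ecos R l) k = 2^-1 * ((l == k)%:R + (l == - k)%:R) /\
  fourier_sin (@ecos R l) k = 0.
Proof.
have ic j := circle_integrable_cont (@continuous_ecos R j).
have is_ j := circle_integrable_cont (@continuous_esin R j).
split.
  rewrite /fourier_cos (_ : (fun u => _) = (fun u => 2^-1 * (ecos (l - k) u + ecos (l + k) u))).
    rewrite circle_integralZ; last exact: circle_integrableD.
    by rewrite circle_integralD// !circle_integral_ecos subr_eq0 addr_eq0.
  by apply/funext => u; rewrite ecosM.
rewrite /fourier_sin (_ : (fun u => _) = (fun u => 2^-1 * (esin (l + k) u - esin (l - k) u))).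
  rewrite circle_integralZ; last exact: circle_integrableB.
  by rewrite circle_integralB// !circle_integral_esin subrr mulr0.
by apply/funext => u; rewrite ecos_esinM.
Qed.

Lemma fourier_esin l k : fourier_cos (@esin R l) k = 0 /\
  fourier_sin (@esin R l) k = 2^-1 * ((l == k)%:R - (l == - k)%:R).
Proof.
have ic j := circle_integrable_cont (@continuous_ecos R j).
have is_ j := circle_integrable_cont (@continuous_esin R j).
split.
  have [_ <-] := fourier_ecos k l; rewrite /fourier_cos /fourier_sin; congr circle_integral.
  by apply/funext => u; rewrite mulrC.
rewrite /fourier_sin (_ : (fun u => _) = (fun u => 2^-1 * (ecos (l - k) u - ecos (l + k) u))).
  rewrite circle_integralZ; last exact: circle_integrableB.
  by rewrite circle_integralB// !circle_integral_ecos subr_eq0 addr_eq0.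
by apply/funext => u; rewrite esinM.
Qed.

Lemma fourier_trig_sum n c s (k : nat) : (k <= n)%N ->
  fourier_cos (trig_sum n c s) k = c k /\
  ((0 < k)%N -> fourier_sin (trig_sum n c s) k = s k).
Proof.
move=> kn.
have E (f : R -> R) : continuous f -> circle_integral (fun u => trig_sum n c s u * f u) =
   c 0%N * fourier_cos f 0 + \sum_(k < n) 2 * (c k.+1 * fourier_cos f k.+1 + s k.+1 * fourier_sin f k.+1).
  move=> cf; rewrite -(circle_integral_trig_sum n c s (circle_integrable_cont cf)).
  by congr circle_integral; apply/funext => u; rewrite mulrC.
have neg (i j : nat) : (i%:Z == - j.+1%:Z) = false by apply/negP => /eqP; lia.
split.
  rewrite /fourier_cos E; last exact: continuous_ecos.
  rewrite (fourier_ecos _ _).1 oppr0.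
  case: k kn => [|k] kn.
    rewrite eqxx big1 ?addr0 => [|i _]; first by rewrite (_ : 2^-1 * _ = 1) ?mulr1//=; field.
    by rewrite (fourier_ecos _ _).1 (fourier_ecos _ _).2 neg /= !(mulr0, addr0).
  rewrite /= addr0 mulr0 mulr0 add0r.
  have Z (i : 'I_n) : i != Ordinal kn ->
      2 * (c i.+1 * fourier_cos (ecos k.+1) i.+1 + s i.+1 * fourier_sin (ecos k.+1) i.+1) = 0.
    rewrite -val_eqE/= => ik; rewrite (fourier_ecos _ _).1 (fourier_ecos _ _).2.
    by rewrite neg eqz_nat eqSS eq_sym (negbTE ik) !(mulr0, addr0).
  rewrite (bigD1 (Ordinal kn) isT) (big1 _ _ _ Z) /=.
  by rewrite (fourier_ecos _ _).1 (fourier_ecos _ _).2 eqxx neg /=; field.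
case: k kn => // k kn _.
rewrite /fourier_sin E; last exact: continuous_esin.
rewrite (fourier_esin _ _).1 mulr0 add0r.
have Z (i : 'I_n) : i != Ordinal kn ->
    2 * (c i.+1 * fourier_cos (esin k.+1) i.+1 + s i.+1 * fourier_sin (esin k.+1) i.+1) = 0.
  rewrite -val_eqE/= => ik; rewrite (fourier_esin _ _).1 (fourier_esin _ _).2.
  by rewrite neg eqz_nat eqSS eq_sym (negbTE ik) subrr !(mulr0, addr0).
rewrite (bigD1 (Ordinal kn) isT) (big1 _ _ _ Z) /=.
by rewrite (fourier_esin _ _).1 (fourier_esin _ _).2 eqxx neg /=; field.
Qed.

Definition energy n c s : R := c 0%N ^+ 2 + \sum_(k < n) 2 * (c k.+1 ^+ 2 + s k.+1 ^+ 2).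

Lemma circle_integral_trig_sum_sqr n c s :
  circle_integral (fun u => trig_sum n c s u ^+ 2) = energy n c s.
Proof.
rewrite (_ : (fun u => _) = (fun u => trig_sum n c s u * trig_sum n c s u))//.
rewrite circle_integral_trig_sum; last exact/circle_integrable_cont/continuous_trig_sum.
rewrite (fourier_trig_sum c s (leq0n n)).1 -expr2; congr (_ + _); apply: eq_bigr => k _.
have [-> ->//] := fourier_trig_sum c s (ltn_ord k).
Qed.

(** For P the partial sum of f, both the integral of f P and that of P^2 equal the energy; the
    integral of (f - P)^2 being nonnegative, the energy is at most the integral of f^2. *)
Lemma bessel f n (M : R) : measurable_fun setT f -> (forall u, `|f u| <= M) ->
  energy n (fun k : nat => fourier_cos f k) (fun k : nat => fourier_sin f k) <= M ^+ 2.
Proof.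
move=> mf fM.
have M0 : 0 <= M by apply: le_trans (fM 0).
have fi := circle_integrable_bounded mf fM.
have fi2 : circle_integrable (fun u => f u * f u).
  apply: (@circle_integrable_bounded _ _ (M ^+ 2)) => [|u]; first exact: measurable_funM.
  by rewrite normrM expr2; apply: ler_pM.
set c := fun k : nat => fourier_cos f k; set s := fun k : nat => fourier_sin f k.
pose P := trig_sum n c s.
have cP : continuous P by exact: continuous_trig_sum.
have fP := circle_integrableMl fi cP.
have PP : circle_integrable (fun u => P u ^+ 2).
  by apply: circle_integrable_cont => u; apply: cvgM; exact: cP.
have E1 : circle_integral (fun u => f u * P u) = energy n c s.
  rewrite circle_integral_trig_sum// /energy /c /s; congr (_ + _).
have E2 : circle_integral (fun u => P u ^+ 2) = energy n c s.
  exact: circle_integral_trig_sum_sqr.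
have : 0 <= circle_integral (fun u => f u * f u - (2 * (f u * P u) - P u ^+ 2)).
  apply: Rintegral_ge0 => u _.
  rewrite (_ : _ - _ = (f u - P u) ^+ 2) ?sqr_ge0//; ring.
have i3 := circle_integrableZ 2 fP.
rewrite circle_integralB//; last exact: circle_integrableB.
rewrite circle_integralB// circle_integralZ// E1 E2.
have : circle_integral (fun u => f u * f u) <= M ^+ 2.
  rewrite -[leRHS]circle_integral_cst; apply: circle_integral_le => //.
    exact: circle_integrable_cst.
  move=> u _; rewrite -expr2 -real_normK ?num_real// ler_sqr ?nnegrE//.
lra.
Qed.

End trigonometric_sums.

(** * The Fourier series of the limit *)

Section heat_flow.
Context {R : realType}.
Implicit Types (k : int) (t u a b x y : R).

Lemma is_derive_decay a b x y t :
  is_derive t 1 (decay_cos a b x y)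
    (- a * decay_cos a b x y t + b * decay_sin a b x y t) /\
  is_derive t 1 (decay_sin a b x y)
    (- a * decay_sin a b x y t - b * decay_cos a b x y t).
Proof.
rewrite /decay_cos /decay_sin; split.
  apply: is_derive_eq; rewrite /GRing.scale/=; ring.
apply: is_derive_eq; rewrite /GRing.scale/=; ring.
Qed.

Variables (alpha M : R) (v0 : R -> R).
Hypotheses (mv0 : measurable_fun setT v0) (v0M : forall u, `|v0 u| <= M).

Definition heat_cos k t := decay_cos (freq k ^+ 2) (2 * alpha * freq k)
  (fourier_cos v0 k) (fourier_sin v0 k) t.
Definition heat_sin k t := decay_sin (freq k ^+ 2) (2 * alpha * freq k)
  (fourier_cos v0 k) (fourier_sin v0 k) t.

Definition heat_sum n t u :=
  trig_sum n (fun k : nat => heat_cos k t) (fun k : nat => heat_sin k t) u.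

(* The series need not converge at t = 0. *)
Definition heat_sol t u : R := if t == 0 then v0 u else limn (fun n => heat_sum n t u).

Let iv0 : circle_integrable v0. Proof. exact: circle_integrable_bounded v0M. Qed.

Let M0 : 0 <= M. Proof. exact: le_trans (v0M 0). Qed.

Lemma fourier_bound k : `|fourier_cos v0 k| <= M /\ `|fourier_sin v0 k| <= M.
Proof.
have H (g : R -> R) : continuous g -> (forall u, `|g u| <= 1) ->
    `|circle_integral (fun u => v0 u * g u)| <= M.
  move=> cg g1; have i := circle_integrableMl iv0 cg.
  apply: (le_trans (circle_integral_norm i)).
  rewrite -[leRHS]circle_integral_cst; apply: circle_integral_le.
  - exact: circle_integrable_norm.
  - exact: circle_integrable_cst.
  - by move=> u _; rewrite normrM -[leRHS]mulr1 ler_pM.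
split.
  by apply: (H (ecos k)) => [|u]; [exact: continuous_ecos|exact: cos_max].
by apply: (H (esin k)) => [|u]; [exact: continuous_esin|exact: sin_max].
Qed.

(** A crude linear bound, enough to compare the damping of the k-th mode with a geometric
    sequence. *)
Lemma freq_sqr_ge (n : nat) : n%:R <= freq n ^+ 2 :> R.
Proof.
have p2 := @pi_ge2 R.
have n2 : n%:R <= n%:R ^+ 2 :> R by rewrite -natrX ler_nat; case: n => // n; rewrite expnS expn1 leq_pmulr.
apply: (le_trans n2); rewrite /freq exprMn ler_peMl ?sqr_ge0//.
have : 1 <= 2 * pi :> R by lra.
by move=> h; rewrite expr2; apply: le_trans h _; rewrite ler_peMl//; lra.
Qed.

(** Each flow component is at most 2 M times its damping factor; two components and the factor 2 of
    the series give 8 M. *)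
Lemma heat_term_bound (n : nat) t u : 0 < t ->
  `|2 * (heat_cos n.+1 t * ecos n.+1 u + heat_sin n.+1 t * esin n.+1 u)| <=
  geometric (8 * M) (expR (- t)) n.
Proof.
move=> t0; have [cM sM] := fourier_bound n.+1.
have [h1 h2] := decay_norm (freq n.+1 ^+ 2) (2 * alpha * freq n.+1) t cM sM.
have E : expR (- freq n.+1 ^+ 2 * t) <= expR (- t) ^+ n.
  rewrite -expRM_natl ler_expR mulNr mulrN lerN2 ler_wpM2r ?(ltW t0)//.
  by apply: le_trans (freq_sqr_ge n.+1); rewrite ler_nat.
rewrite normrM ger0_norm// /=.
apply: (@le_trans _ _ (2 * (2 * M * expR (- freq n.+1 ^+ 2 * t) + 2 * M * expR (- freq n.+1 ^+ 2 * t)))).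
  rewrite ler_wpM2l//; apply: (le_trans (ler_normD _ _)); rewrite (normrM (heat_cos _ _)) (normrM (heat_sin _ _)).
  apply: lerD.
    by rewrite -[leRHS]mulr1; apply: (ler_pM (normr_ge0 _) (normr_ge0 _) h1 (cos_max _)).
  by rewrite -[leRHS]mulr1; apply: (ler_pM (normr_ge0 _) (normr_ge0 _) h2 (sin_max _)).
have := ler_wpM2l M0 E; lra.
Qed.

(** Comparison with a geometric series that does not depend on u. The bound uniform in n and u is
    the dominating constant of the later limits. *)
Lemma heat_sum_cvg t : 0 < t ->
  (forall u, heat_sum n t u @[n --> \oo] --> heat_sol t u) /\
  exists K, forall n u, `|heat_sum n t u| <= K.
Proof.
move=> t0.
pose g := geometric (8 * M) (expR (- t)).
pose F u n := 2 * (heat_cos n.+1 t * ecos n.+1 u + heat_sin n.+1 t * esin n.+1 u).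
have sumE n u : heat_sum n t u = heat_cos 0 t + series (F u) n.
  by rewrite /heat_sum /trig_sum /series/= big_mkord.
have Fg u n : `|F u n| <= g n by exact: heat_term_bound.
have g0 n : 0 <= g n by apply: le_trans (Fg 0 n).
have cg : cvgn (series g).
  apply: is_cvg_geometric_series.
  by rewrite ger0_norm ?expR_ge0// -[ltRHS]expR0 ltr_expR oppr_lt0.
split=> [u|].
  rewrite /heat_sol gt_eqF//.
  suff : cvgn (series (F u)).
    move=> cF; apply: (@cvgP _ _ (heat_cos 0 t + limn (series (F u)))).
    rewrite (_ : (fun n => _) = (fun n => heat_cos 0 t + series (F u) n)).
      by apply: cvgD => //; exact: cvg_cst.
    by apply/funext => n; rewrite sumE.
  by apply: normed_cvg; apply: (series_le_cvg _ g0 (Fg u) cg) => n.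
exists (`|heat_cos 0 t| + limn (series g)) => n u.
rewrite sumE; apply: (le_trans (ler_normD _ _)); apply: lerD => //.
apply: (@le_trans _ _ (series g n)).
  rewrite /series/=; apply: (le_trans (ler_norm_sum _ _ _)).
  by apply: ler_sum => i _; exact: Fg.
apply: nondecreasing_cvgn_le => //; apply/nondecreasing_seqP => m.
by rewrite /series/= big_nat_recr//= lerDl.
Qed.

(** At t = 0 the function is [v0] itself. For t > 0 dominated convergence applies to the partial
    sums, whose k-th coefficients are constant from rank k on. The L^2 bound does not depend on t:
    the flow contracts every pair of coefficients, and Bessel's inequality bounds the sum for
    [v0]. *)
Lemma heat_sol_moments t : 0 <= t ->
  [/\ circle_integrable (heat_sol t),
    forall k : nat, fourier_cos (heat_sol t) k = heat_cos k t /\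
      fourier_sin (heat_sol t) k = heat_sin k t,
    circle_integrable (fun u => heat_sol t u ^+ 2) &
    circle_integral (fun u => heat_sol t u ^+ 2) <= M ^+ 2].
Proof.
rewrite le_eqVlt => /predU1P[<-|t0].
  have -> : heat_sol 0 = v0 by apply/funext => u; rewrite /heat_sol eqxx.
  have i2 : circle_integrable (fun u => v0 u ^+ 2).
    apply: (@circle_integrable_bounded _ _ (M ^+ 2)); first exact: measurable_funX.
    by move=> u; rewrite normrX ler_sqr ?nnegrE.
  split=> //.
    by move=> k; rewrite /heat_cos /heat_sin (decay0 _ _ _ _).1 (decay0 _ _ _ _).2.
  rewrite -[leRHS]circle_integral_cst; apply: circle_integral_le => //.
    exact: circle_integrable_cst.
  by move=> u _; rewrite -real_normK ?num_real// ler_sqr ?nnegrE.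
have [cv [K HK]] := heat_sum_cvg t0.
have cs n : continuous (heat_sum n t) by exact: continuous_trig_sum.
have K0 : 0 <= K by apply: le_trans (HK 0%N 0).
have iK := @circle_integrable_cst R.
have [i1 _] := circle_dominated (fun n => circle_integrable_cont (cs n)) (iK K)
  (fun u _ => cv u) (fun n u _ => HK n u).
have iM (g : R -> R) : continuous g -> (forall u, `|g u| <= 1) ->
   circle_integral (fun u => heat_sum n t u * g u) @[n --> \oo] -->
   circle_integral (fun u => heat_sol t u * g u).
  move=> cg g1.
  have h1 n : circle_integrable (fun u => heat_sum n t u * g u).
    by apply: circle_integrable_cont => u; apply: cvgM; [exact: cs|exact: cg].
  have h2 u : 0 <= u <= 1 -> heat_sum n t u * g u @[n --> \oo] --> heat_sol t u * g u.
    by move=> _; apply: cvgM; [exact: cv|exact: cvg_cst].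
  have h3 n u : 0 <= u <= 1 -> `|heat_sum n t u * g u| <= K.
    by move=> _; rewrite normrM -[leRHS]mulr1 ler_pM.
  exact: (circle_dominated h1 (iK K) h2 h3).2.
have c2 n : circle_integrable (fun u => heat_sum n t u ^+ 2).
  by apply: circle_integrable_cont => u; apply: cvgM; exact: cs.
have l2 u : 0 <= u <= 1 -> heat_sum n t u ^+ 2 @[n --> \oo] --> heat_sol t u ^+ 2.
  by move=> _; apply: cvgM; exact: cv.
have b2 n u : 0 <= u <= 1 -> `|heat_sum n t u ^+ 2| <= K ^+ 2.
  by move=> _; rewrite normrX ler_sqr ?nnegrE.
have [i2 e2] := circle_dominated c2 (iK (K ^+ 2)) l2 b2.
split=> //.
  move=> k; split.
    have c1 := iM _ (@continuous_ecos R k) (fun u => cos_max _).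
    have c3 : circle_integral (fun u => heat_sum n t u * ecos k u) @[n --> \oo] --> heat_cos k t.
      apply: cvg_near_cst; exists k => // n /= kn.
      by have [] := fourier_trig_sum (fun k : nat => heat_cos k t) (fun k : nat => heat_sin k t) kn.
    exact: cvg_unique _ c1 c3.
  (* [fourier_trig_sum] gives no sine coefficient at frequency 0; there both sides vanish. *)
  case: k => [|k].
    have z (f : R -> R) : fourier_sin f 0 = 0.
      rewrite -[RHS](circle_integral_cst 0); congr circle_integral.
      by apply/funext => u; rewrite esin0 mulr0.
    rewrite /heat_sin /decay_sin !z /freq !mulr0 mul0r sin0; ring.
  have c1 := iM _ (@continuous_esin R k.+1) (fun u => sin_max _).
  have c3 : circle_integral (fun u => heat_sum n t u * esin k.+1 u) @[n --> \oo] --> heat_sin k.+1 t.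
    apply: cvg_near_cst; exists k.+1 => // n /= kn.
    by have [_ ] := fourier_trig_sum (fun k : nat => heat_cos k t) (fun k : nat => heat_sin k t) kn; exact.
  exact: cvg_unique _ c1 c3.
rewrite -(cvg_lim (@Rhausdorff _) e2); apply: limr_le; first exact: (cvgP _ e2).
apply: nearW => n; rewrite circle_integral_trig_sum_sqr.
    apply: le_trans (bessel n mv0 v0M).
    have E (k : nat) : heat_cos k t ^+ 2 + heat_sin k t ^+ 2 <= fourier_cos v0 k ^+ 2 + fourier_sin v0 k ^+ 2.
      rewrite decay_sqr ler_piMl ?addr_ge0 ?sqr_ge0// expr_le1 ?expR_ge0//.
      by rewrite -[leRHS]expR0 ler_expR mulNr oppr_le0 mulr_ge0 ?sqr_ge0 ?ltW.
    rewrite /energy; apply: lerD; last by apply: ler_sum => k _; rewrite ler_wpM2l.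
    have -> : heat_cos 0 t = fourier_cos v0 0; last by [].
    rewrite /heat_cos /decay_cos /freq !mulr0 expr0n/= oppr0 !mul0r sin0 expR0 cos0; ring.
Qed.

End heat_flow.

(** * Measurability and square integrability of the limit *)

Section weak_solution_existence.
Context {R : realType}.
Implicit Types (k : int) (t s u : R) (f G p q : R -> R).
Local Notation mu := (@lebesgue_measure R).

Lemma periodic_bounded G : periodic1 G -> continuous G ->
  exists B, forall u, `|G u| <= B.
Proof.
move=> pG cG; have [M M0 HM] := periodic_modulus pG cG ltr01.
exists (`|G 0| + (1 + M * 2)) => u.
have [k hk] := periodic1_rep u.
rewrite -(periodic1_int (- k) u pG) intrN.
rewrite -[X in `|X|](subrK (G 0)) addrC; apply: (le_trans (ler_normD _ _)).
rewrite lerD2l; apply: (le_trans (HM 0 _ _ hk)); first by rewrite lexx ler01.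
rewrite lerD2l ler_wpM2l//; have := @cos_geN1 R (freq 1 * (0 - (u - k%:~R))).
rewrite /ecos; lra.
Qed.

(** Averaging against a nonnegative kernel of mass one cannot exceed the bound of f; this provides
    the domination, uniform in n, wherever Fejer means pass to the limit under an integral. *)
Lemma fejer_bound n f (B : R) : continuous f -> (forall u, `|f u| <= B) ->
  forall u, `|fejer n f u| <= B.
Proof.
move=> cf fB u; have B0 : 0 <= B by apply: le_trans (fB 0).
case: n => [|n]; first by rewrite /fejer big_ord0 mulr0 normr0.
have i := circle_integrable_cont cf.
rewrite fejerE//; have [k1 k2] := fejer_kernel_mass u (ltn0Sn n).
have [g1 _] := fejer_kernel_integral n.+1 (fun k => circle_integrableM_ecosB k u i).
apply: (le_trans (circle_integral_norm g1)).
rewrite -[leRHS]mulr1 -k2 -circle_integralZ//.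
apply: circle_integral_le; first exact: circle_integrable_norm.
  exact: circle_integrableZ.
by move=> s _; rewrite normrM (ger0_norm (fejer_kernel_ge0 _ _)) ler_wpM2r ?fejer_kernel_ge0.
Qed.

Lemma fejer_pointwise_cvg G u : periodic1 G -> continuous G ->
  fejer n G u @[n --> \oo] --> G u.
Proof.
move=> pG cG; apply/cvgrPdist_le => e e0; have [n0 H] := fejer_cvg pG cG e0.
by exists n0.+1 => // n /= nn; rewrite distrC; exact: H.
Qed.

Lemma fejer_integral_cvg f G : circle_integrable f -> periodic1 G -> continuous G ->
  circle_integral (fun u => f u * fejer n G u) @[n --> \oo] -->
  circle_integral (fun u => f u * G u).
Proof.
move=> fi pG cG; have [B GB] := periodic_bounded pG cG.
have h1 n : circle_integrable (fun u => f u * fejer n G u).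
  by apply: circle_integrableMl => //; exact/smooth_cont/trigpoly_smooth/trigpoly_fejer.
have h2 u : 0 <= u <= 1 -> f u * fejer n G u @[n --> \oo] --> f u * G u.
  by move=> _; apply: cvgM; [exact: cvg_cst|exact: fejer_pointwise_cvg].
have h3 n u : 0 <= u <= 1 -> `|f u * fejer n G u| <= B * `|f u|.
  by move=> _; rewrite normrM mulrC ler_wpM2r//; exact: fejer_bound.
exact: (circle_dominated h1 (circle_integrableZ B (circle_integrable_norm fi)) h2 h3).2.
Qed.

Variables (T alpha M : R) (v0 : R -> R).
Hypotheses (T0 : 0 < T) (pv0 : periodic1 v0) (mv0 : measurable_fun setT v0)
  (v0M : forall u, `|v0 u| <= M).

Let iv0 : circle_integrable v0.
Proof. exact: circle_integrable_bounded mv0 v0M. Qed.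

Local Notation v := (heat_sol alpha v0).

Lemma heat_sol0 : v 0 = v0.
Proof. by apply/funext => u; rewrite /heat_sol eqxx. Qed.

Lemma fourier_heat_sol k t : 0 <= t ->
  fourier_cos (v t) k = heat_cos alpha v0 k t /\
  fourier_sin (v t) k = heat_sin alpha v0 k t.
Proof.
move=> t0; have [vi vF _ _] := heat_sol_moments alpha mv0 v0M t0.
case: k => n; first exact: vF.
have [h1 h2] := vF n.+1.
rewrite NegzE fourier_cosN fourier_sinN// h1 h2 /heat_cos /heat_sin /decay_cos /decay_sin.
rewrite fourier_cosN fourier_sinN//.
have -> : freq (- n.+1%:Z) = - freq n.+1 :> R by rewrite /freq mulrNz mulrN.
by rewrite sqrrN !mulrN !mulNr cosN sinN; split; ring.
Qed.

Lemma periodic_heat_sol t : periodic1 (v t).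
Proof.
move=> u; rewrite /heat_sol; case: ifP => _; first exact: pv0.
congr (limn _); apply/funext => n.
by have [+ _] := trigpoly_smooth (trigpoly_trig_sum n
  (fun k : nat => heat_cos alpha v0 k t) (fun k : nat => heat_sin alpha v0 k t)); exact.
Qed.

Lemma measurable_space_time : measurable (space_time T).
Proof.
have -> : space_time T = (`[0, T]%classic : set R) `*` (`[0, 1]%classic : set R).
  by apply/seteqP; split => z /=; rewrite /space_time/= !in_itv/=.
by apply: measurableX; exact: measurable_itv.
Qed.

Lemma measurable_heat_sol : measurable_fun (space_time T) (fun z : R * R => v z.1 z.2).
Proof.
(* Jointly measurable approximations; the slice t = 0 is treated apart because the partial sums need
   not converge to [v0] there. *)
pose w n (z : R * R) := if z.1 == 0 then v0 z.2 else heat_sum alpha v0 n z.1 z.2.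
have m1 (f : R -> R) : measurable_fun setT f -> measurable_fun setT (fun z : R * R => f z.1).
  by move=> mf; apply: measurableT_comp => //; exact: measurable_fst.
have m2 (f : R -> R) : measurable_fun setT f -> measurable_fun setT (fun z : R * R => f z.2).
  by move=> mf; apply: measurableT_comp => //; exact: measurable_snd.
have mc k : measurable_fun setT (heat_cos alpha v0 k).
  apply: continuous_measurable_fun.
  exact: (is_derive_continuous (fun t => (is_derive_decay (freq k ^+ 2) (2 * alpha * freq k) (fourier_cos v0 k) (fourier_sin v0 k) t).1)).
have ms k : measurable_fun setT (heat_sin alpha v0 k).
  apply: continuous_measurable_fun.
  exact: (is_derive_continuous (fun t => (is_derive_decay (freq k ^+ 2) (2 * alpha * freq k) (fourier_cos v0 k) (fourier_sin v0 k) t).2)).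
have mec k : measurable_fun setT (@ecos R k).
  by apply: continuous_measurable_fun; exact: continuous_ecos.
have mes k : measurable_fun setT (@esin R k).
  by apply: continuous_measurable_fun; exact: continuous_esin.
have mw n : measurable_fun setT (w n).
  apply: measurable_fun_ifT.
  - by apply: measurable_fun_eqr; [exact: measurable_fst|exact: measurable_cst].
  - exact: m2.
  - rewrite /heat_sum /trig_sum; apply: measurable_funD; first exact: m1.
    apply: measurable_sum => k; apply: measurable_funM => //.
    by apply: measurable_funD; apply: measurable_funM; (exact: m1 || exact: m2).
apply/measurable_EFinP.
apply: (emeasurable_fun_cvg (fun n z => (w n z)%:E)).
- by move=> n; apply/measurable_EFinP/measurable_funTS.
- move=> z [/andP[z0 _] _]; apply: cvg_EFin; first exact: nearW.
  rewrite /w /=; have [->|zn] := eqVneq z.1 0.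
    by rewrite heat_sol0; exact: cvg_cst.
  have z10 : 0 < z.1 by rewrite lt_def zn.
  by have [+ _] := heat_sum_cvg alpha mv0 v0M z10; exact.
Qed.

(** From |x| <= 1 + x^2. The bound is uniform in time, so it can dominate the time integral of the
    weak equation. *)
Lemma heat_sol_norm t : 0 <= t -> circle_integral (fun u => `|v t u|) <= 1 + M ^+ 2.
Proof.
move=> t0; have [vi _ vi2 vM] := heat_sol_moments alpha mv0 v0M t0.
have i1 := @circle_integrable_cst R 1.
apply: (@le_trans _ _ (circle_integral (fun u => 1 + v t u ^+ 2))).
  apply: circle_integral_le; [exact: circle_integrable_norm|exact: circle_integrableD|].
  move=> u _; have := sqr_ge0 (`|v t u| - 1); have := normr_ge0 (v t u).
  rewrite -[v t u ^+ 2]real_normK ?num_real//; nra.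
by rewrite circle_integralD// circle_integral_cst lerD2l.
Qed.

(** By Tonelli, since every time slice has squared L^2 norm at most M^2. *)
Lemma heat_sol_L2 :
  (\int[mu \x mu]_(z in space_time T) ((v z.1 z.2) ^+ 2)%:E < +oo)%E.
Proof.
pose f (z : R * R) := ((v z.1 z.2) ^+ 2)%:E.
have mf : measurable_fun (space_time T) f.
  by apply/measurable_EFinP; apply: measurable_funX; exact: measurable_heat_sol.
have mp : measurable_fun setT (f \_ (space_time T)).
  exact: (measurable_restrictT f measurable_space_time).1 mf.
have p0 z : (0 <= (f \_ (space_time T)) z)%E.
  by rewrite /patch; case: ifP => // _; rewrite lee_fin sqr_ge0.
rewrite integral_mkcond fubini_tonelli1; [rewrite /=|exact: mp|exact: p0].
have fin : (\int[mu]_(t in `[0%R, T]) (M ^+ 2)%:E < +oo)%E.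
  by rewrite integral_cst//= lebesgue_measure_itv/= lte_fin T0 -EFinB -EFinM ltry.
apply: le_lt_trans fin.
rewrite [leRHS]integral_mkcond; apply: ge0_le_integral => //=.
- by move=> t _; apply: integral_ge0 => u _; exact: p0.
- exact: measurable_fun_fubini_tonelli_F.
- exact: (measurable_restrictT (fun=> (M ^+ 2)%:E) (measurable_itv _)).1 (measurable_cst _).
move=> t _; rewrite [leRHS]/patch; case: ifPn => [|tT].
  rewrite inE/= in_itv/= => /andP[t0 tT].
  have [vi _ vi2 vM] := heat_sol_moments alpha mv0 v0M t0.
  apply: (@le_trans _ _ (\int[mu]_(u in `[0%R, 1%R]) (v t u ^+ 2)%:E)%E).
    rewrite [leRHS]integral_mkcond le_eqVlt; apply/orP; left; apply/eqP.
    apply: eq_integral => u _; rewrite /patch/=; congr (if _ then _ else _).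
    by apply/idP/idP; rewrite !inE/= /space_time/= in_itv/= t0 tT => // -[].
  have -> : (\int[mu]_(u in `[0%R, 1%R]) (v t u ^+ 2)%:E =
      (circle_integral (fun u => v t u ^+ 2))%:E)%E.
    by rewrite /circle_integral /Rintegral fineK//; exact: integrable_fin_num.
  by rewrite lee_fin.
rewrite /fubini_F integral0_eq// => u _; rewrite /patch/= memNset// /space_time/= => -[h _].
by move: tT; rewrite notin_setE/= in_itv/=.
Qed.

End weak_solution_existence.

(** * The limit solves the weak equation *)

Section heat_flow_weak_equation.
Context {R : realType}.
Implicit Types (k : int) (t s u : R) (f G p q : R -> R).
Local Notation mu := (@lebesgue_measure R).

Variables (T alpha M : R) (v0 : R -> R).
Hypotheses (T0 : 0 < T) (pv0 : periodic1 v0) (mv0 : measurable_fun setT v0)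
  (v0M : forall u, `|v0 u| <= M).

Local Notation v := (heat_sol alpha v0).

Let iv t : 0 <= t -> circle_integrable (v t).
Proof. by move=> t0; have [] := heat_sol_moments alpha mv0 v0M t0. Qed.

Lemma circle_integral_mode f k (a b : R) : circle_integrable f ->
  circle_integral (fun u => f u * (a * ecos k u + b * esin k u)) =
  a * fourier_cos f k + b * fourier_sin f k.
Proof.
move=> fi.
have i1 := circle_integrableMl fi (@continuous_ecos _ k).
have i2 := circle_integrableMl fi (@continuous_esin _ k).
rewrite (_ : (fun u => _) = (fun u => a * (f u * ecos k u) + b * (f u * esin k u))).
  by rewrite circle_integralD ?circle_integralZ//; exact: circle_integrableZ.
by apply/funext => u; ring.
Qed.

(** Here [Phi] is the pairing of the limit with p and [phi] its time derivative, which is the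
    pairing with p'' - 2 alpha p'. Both come from the explicit flow and are defined for every real
    s, so the fundamental theorem applies on [0, t] without one-sided derivatives at 0, although the
    pairing identities hold only for s >= 0. *)
Lemma trigpoly_heat_sol p : trigpoly p ->
  exists q1 q2 Phi phi, [/\ trigpoly q1 /\ trigpoly q2,
    forall u, is_derive u 1 p (q1 u), forall u, is_derive u 1 q1 (q2 u),
    continuous phi /\ (forall s, is_derive s 1 Phi (phi s)) &
    forall s, 0 <= s -> circle_integral (fun u => v s u * p u) = Phi s /\
      circle_integral (fun u => v s u * (q2 u - 2 * alpha * q1 u)) = phi s].
Proof.
elim=> [|k a b {}p tp [q1 [q2 [Phi [phi [[tq1 tq2] dp dq1 [cphi dPhi] H]]]]]].
  exists (fun=> 0), (fun=> 0), (fun=> 0), (fun=> 0); split.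
  - by split; exact: trigpoly0.
  - by move=> u; exact: is_derive_cst.
  - by move=> u; exact: is_derive_cst.
  - by split => u; [exact: cvg_cst|exact: is_derive_cst].
  - move=> s s0; split; rewrite -[RHS](circle_integral_cst 0); congr circle_integral.
      by apply/funext => u; rewrite mulr0.
    by apply/funext => u; rewrite mulr0 subr0 mulr0.
pose F := freq k : R.
pose hc := heat_cos alpha v0 k; pose hs := heat_sin alpha v0 k.
pose A := F ^+ 2; pose B := 2 * alpha * F.
have dc s : is_derive s 1 hc (- A * hc s + B * hs s) by exact: (is_derive_decay _ _ _ _ s).1.
have ds s : is_derive s 1 hs (- A * hs s - B * hc s) by exact: (is_derive_decay _ _ _ _ s).2.
have cc := is_derive_continuous dc; have cs := is_derive_continuous ds.
exists (fun u => ((F * b) * ecos k u + (- F * a) * esin k u) + q1 u).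
exists (fun u => ((F * (- F * a)) * ecos k u + (- F * (F * b)) * esin k u) + q2 u).
exists (fun s => (a * hc s + b * hs s) + Phi s).
exists (fun s => (a * (- A * hc s + B * hs s) + b * (- A * hs s - B * hc s)) + phi s).
split.
- by split; exact: trigpolyS.
- by move=> u; have h1 := is_derive_mode k a b u; have h2 := dp u; exact: (is_deriveD h1 h2).
- move=> u; have h1 := is_derive_mode k (F * b) (- F * a) u; have h2 := dq1 u.
  exact: (is_deriveD h1 h2).
- split.
    move=> s; apply: cvgD; last exact: cphi.
    apply: cvgD; apply: cvgM; try exact: cvg_cst.
      by apply: cvgD; (apply: cvgM; first exact: cvg_cst); [exact: cc|exact: cs].
    by apply: cvgB; (apply: cvgM; first exact: cvg_cst); [exact: cs|exact: cc].
  move=> s; have h1 := dc s; have h2 := ds s; have h3 := dPhi s.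
  by apply: is_derive_eq; rewrite /GRing.scale/=; ring.
move=> s s0; have [H1 H2] := H s s0.
have vi := iv s0; have [C S] := fourier_heat_sol alpha mv0 v0M k s0.
have cm (x y : R) : continuous (fun u => x * ecos k u + y * esin k u).
  exact/smooth_cont/trigpoly_smooth/trigpoly_mode.
split.
  rewrite (_ : (fun u => _) = (fun u => v s u * (a * ecos k u + b * esin k u) + v s u * p u)).
    rewrite circle_integralD.
    - by rewrite circle_integral_mode// H1 C S.
    - exact: circle_integrableMl.
    - by apply: circle_integrableMl => //; exact/smooth_cont/trigpoly_smooth.
  by apply/funext => u; rewrite mulrDr.
(* The coefficients of the mode after applying the second derivative minus 2 alpha times the first.
   The same numbers arise when the linear system for [hc] and [hs] is tested against (a, b). *)
pose x := - A * a - B * b; pose y := - A * b + B * a.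
rewrite (_ : (fun u => _) = (fun u => v s u * (x * ecos k u + y * esin k u) +
    v s u * (q2 u - 2 * alpha * q1 u))).
  rewrite circle_integralD.
  - by rewrite circle_integral_mode// H2 C S -/hc -/hs /x /y; ring.
  - exact: circle_integrableMl.
  - apply: circle_integrableMl => // u; apply: cvgB; first exact: (smooth_cont (trigpoly_smooth tq2)).
    by apply: cvgM; [exact: cvg_cst|exact: (smooth_cont (trigpoly_smooth tq1))].
by apply/funext => u; rewrite /x /y /A /B; ring.
Qed.

(** The equation holds for the Fejer means of G. Their first two derivatives are the Fejer means of
    G' and G'', hence converge pointwise and stay bounded, so dominated convergence applies first in
    space, then in time. *)
Lemma heat_sol_weak_eq t G : 0 <= t -> C2_circle G ->
  circle_integral (fun u => v t u * G u) - circle_integral (fun u => v0 u * G u)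
  - \int[mu]_(s in `[0, t]) circle_integral (fun u =>
      v s u * (derive1n 2 G u - 2 * alpha * derive1 G u)) = 0.
Proof.
move=> t0 [pG dG dG' cG2].
have h1 u : is_derive u 1 G (derive1 G u) by rewrite derive1E; exact: derivableP.
have h2 u : is_derive u 1 (derive1 G) (derive1n 2 G u).
  by rewrite derive1nS derive1n1 [X in is_derive _ _ _ X]derive1E; exact: derivableP.
have cG := is_derive_continuous h1; have cG1 := is_derive_continuous h2.
have pG1 := periodic_derive1 pG.
have pG2 : periodic1 (derive1n 2 G) by exact: periodic_derive1 pG1.
set G1 := derive1 G in h1 h2 cG1 pG1 *; set G2 := derive1n 2 G in h2 cG2 pG2 *.
have [B1 HB1] := periodic_bounded pG1 cG1; have [B2 HB2] := periodic_bounded pG2 cG2.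
have cfe n (f : R -> R) : continuous (fejer n f).
  exact/smooth_cont/trigpoly_smooth/trigpoly_fejer.
pose H n u := fejer n G2 u - 2 * alpha * fejer n G1 u.
have cH n : continuous (H n).
  by move=> u; apply: cvgB; [exact: cfe|apply: cvgM; [exact: cvg_cst|exact: cfe]].
pose B := B2 + `|2 * alpha| * B1.
have HB n u : `|H n u| <= B.
  apply: (le_trans (ler_normB _ _)); apply: lerD; first exact: fejer_bound.
  by rewrite normrM ler_wpM2l//; exact: fejer_bound.
have B0 : 0 <= B by apply: le_trans (HB 0%N 0).
have eqn n : mu.-integrable `[0, t] (EFin \o (fun s => circle_integral (fun u => v s u * H n u))) /\
    \int[mu]_(s in `[0, t]) circle_integral (fun u => v s u * H n u) =
    circle_integral (fun u => v t u * fejer n G u) - circle_integral (fun u => v0 u * fejer n G u).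
  have [q1 [q2 [Phi [phi [_ d1 d2 [cphi dPhi] E]]]]] := trigpoly_heat_sol (trigpoly_fejer n G).
  have q1E : q1 = fejer n G1.
    rewrite -(derive1_eq d1).
    by apply: derive1_eq => u; exact: is_derive_fejer.
  have q2E : q2 = fejer n G2.
    move: d2; rewrite q1E => d2.
    rewrite -(derive1_eq d2).
    by apply: derive1_eq => u; exact: is_derive_fejer.
  have Ephi s : s \in (`[0, t]%classic : set R) -> phi s = circle_integral (fun u => v s u * H n u).
    by rewrite inE/= in_itv/= => /andP[s0 _]; have [_ <-] := E s s0; rewrite q1E q2E.
  split.
    apply: eq_integrable (cont_integrable 0 t cphi) => // s st.
    by rewrite /= Ephi.
  transitivity (\int[mu]_(s in `[0, t]) phi s).
    by apply: eq_Rintegral => s st; rewrite Ephi.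
  rewrite (itv_FTC t0 cphi dPhi).
  by have [<- _] := E t t0; have [<- _] := E 0 (lexx 0); rewrite heat_sol0.
have lim1 : \int[mu]_(s in `[0, t]) circle_integral (fun u => v s u * H n u) @[n --> \oo] -->
    \int[mu]_(s in `[0, t]) circle_integral (fun u => v s u * (G2 u - 2 * alpha * G1 u)).
  apply: (proj2 (itv_dominated (fun n => (eqn n).1) (g := fun=> B * (1 + M ^+ 2)) _ _ _)).
  - by apply: cont_integrable => s; exact: cvg_cst.
  - move=> s /andP[s0 _].
    have cD : continuous (fun u => G2 u - 2 * alpha * G1 u).
      by move=> u; apply: cvgB; [exact: cG2|apply: cvgM; [exact: cvg_cst|exact: cG1]].
    apply: (proj2 (circle_dominated (g := fun u => B * `|v s u|) _ _ _ _)).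
    + by move=> n; apply: circle_integrableMl => //; exact: iv.
    + by apply: circle_integrableZ; apply: circle_integrable_norm; exact: iv.
    + move=> u _; apply: cvgM; first exact: cvg_cst.
      apply: cvgB; first exact: fejer_pointwise_cvg.
      by apply: cvgM; [exact: cvg_cst|exact: fejer_pointwise_cvg].
    + by move=> n u _; rewrite normrM mulrC ler_wpM2r.
  - move=> n s /andP[s0 _].
    have i := circle_integrableMl (iv s0) (cH n).
    apply: (le_trans (circle_integral_norm i)).
    apply: (@le_trans _ _ (circle_integral (fun u => B * `|v s u|))).
      apply: circle_integral_le.
      + exact: circle_integrable_norm.
      + by apply: circle_integrableZ; apply: circle_integrable_norm; exact: iv.
      + by move=> u _; rewrite normrM mulrC ler_wpM2r.
    rewrite circle_integralZ; last by apply: circle_integrable_norm; exact: iv.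
    by rewrite ler_wpM2l// heat_sol_norm.
have iv0 : circle_integrable v0 by rewrite -(heat_sol0 alpha v0); exact: iv.
have lim2 : circle_integral (fun u => v t u * fejer n G u) -
    circle_integral (fun u => v0 u * fejer n G u) @[n --> \oo] -->
    circle_integral (fun u => v t u * G u) - circle_integral (fun u => v0 u * G u).
  by apply: cvgB; apply: fejer_integral_cvg => //; exact: iv.
have E : (fun n => \int[mu]_(s in `[0, t]) circle_integral (fun u => v s u * H n u)) =
    (fun n => circle_integral (fun u => v t u * fejer n G u) -
    circle_integral (fun u => v0 u * fejer n G u)).
  by apply/funext => n; rewrite (eqn n).2.
rewrite E in lim1.
by rewrite (cvg_unique (@Rhausdorff R) lim1 lim2) subrr.
Qed.

Lemma heat_sol_weak_solution : weak_solution T alpha v0 v.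
Proof.
split.
- exact: periodic_heat_sol.
- exact: measurable_heat_sol mv0 v0M.
- exact: heat_sol_L2 T0 mv0 v0M.
- by move=> t /andP[t0 _]; exact: iv.
- by move=> t G /andP[t0 _] CG; exact: heat_sol_weak_eq.
Qed.

End heat_flow_weak_equation.

(** * Uniqueness of the weak solution *)

Section weak_solution_uniqueness.
Context {R : realType}.
Implicit Types (k : int) (T t s u a b : R) (f g G : R -> R).
Local Notation mu := (@lebesgue_measure R).

(** Converts an integral equation into the increment estimates that [rotation_ode] asks for. *)
Lemma itv_integral_increment (q : R -> R) T s h (c K : R) :
  mu.-integrable `[0, T] (EFin \o q) -> 0 <= s -> 0 < h -> s + h <= T ->
  (forall r, s <= r <= s + h -> `|q r - c| <= K) ->
  `|\int[mu]_(r in `[0, s + h]) q r - \int[mu]_(r in `[0, s]) q r - h * c| <= h * K.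
Proof.
move=> qi s0 h0 sT qK.
have q1 : mu.-integrable `[0, s + h] (EFin \o q).
  apply: integrableS qi => //; apply: subset_itvScc; rewrite bnd_simp//.
have q2 : mu.-integrable `]s, s + h] (EFin \o q).
  by apply: integrableS qi => //; apply: subset_itvScc; rewrite bnd_simp.
have cst (x : R) : mu.-integrable `]s, s + h] (EFin \o (fun=> x)).
  have : mu.-integrable `[s, s + h] (EFin \o (fun=> x)).
    by apply: cont_integrable => u; exact: cvg_cst.
  apply: integrableS => //; apply: subset_itvScc; rewrite bnd_simp//.
have cstE (x : R) : \int[mu]_(r in `]s, s + h]) x = x * h.
  rewrite Rintegral_cst//=; have -> := @lebesgue_measure_itv R `]s, s + h].
  by rewrite /= lte_fin ltrDl h0 -EFinB/=; congr (_ * _); ring.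
rewrite Rintegral_itvB//; last by rewrite bnd_simp lerDl ltW.
rewrite mulrC -cstE -RintegralB//.
apply: (le_trans (le_normr_Rintegral _ _)) => //.
  exact: (integrableB _ q2 (cst c)).
rewrite [leRHS]mulrC -cstE; apply: le_Rintegral => //.
  by apply: integrable_norm; exact: (integrableB _ q2 (cst c)).
by move=> r /=; rewrite in_itv/= => /andP[sr rs]; apply: qK; rewrite ltW.
Qed.

(** A bootstrap: f and g are only integrable, but the equation first makes them bounded by [B], then
    Lipschitz with constant [L * B], and the right-hand sides then vary little enough over a short
    step for [rotation_ode] to apply. *)
Lemma integral_rotation f g a b (f0 g0 : R) T : 0 <= a ->
  mu.-integrable `[0, T] (EFin \o f) -> mu.-integrable `[0, T] (EFin \o g) ->
  (forall t, 0 <= t <= T ->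
    f t = f0 + \int[mu]_(s in `[0, t]) (- a * f s + b * g s) /\
    g t = g0 + \int[mu]_(s in `[0, t]) (- a * g s - b * f s)) ->
  forall t, 0 <= t <= T -> f t = decay_cos a b f0 g0 t /\ g t = decay_sin a b f0 g0 t.
Proof.
move=> a0 fi gi H t tT.
pose p s := - a * f s + b * g s; pose q s := - a * g s - b * f s.
have pi_ : mu.-integrable `[0, T] (EFin \o p).
  by apply: (integrableD _ (integrableZl _ (- a) fi) (integrableZl _ b gi)).
have qi : mu.-integrable `[0, T] (EFin \o q).
  by apply: (integrableB _ (integrableZl _ (- a) gi) (integrableZl _ b fi)).
have sub s : 0 <= s <= T -> (`[0, s] `<=` `[0, T])%classic.
  by move=> /andP[s0 sT]; apply: subset_itvScc; rewrite bnd_simp.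
have bound (r : R -> R) : mu.-integrable `[0, T] (EFin \o r) -> forall s, 0 <= s <= T ->
    `|\int[mu]_(u in `[0, s]) r u| <= \int[mu]_(u in `[0, T]) `|r u|.
  move=> ri s sT; have rs : mu.-integrable `[0, s] (EFin \o r) by apply: integrableS ri => //; exact: sub.
  apply: (le_trans (le_normr_Rintegral _ rs)) => //.
  have nT := integrable_norm ri; have ns := integrable_norm rs.
  rewrite /Rintegral fine_le//; try exact: integrable_fin_num.
  apply: ge0_subset_integral => //.
  - by have /integrableP[] := nT.
  - exact: sub.
pose I1 := \int[mu]_(u in `[0, T]) `|p u|; pose I2 := \int[mu]_(u in `[0, T]) `|q u|.
have I10 : 0 <= I1 by apply: Rintegral_ge0.
have I20 : 0 <= I2 by apply: Rintegral_ge0.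
pose B := `|f0| + `|g0| + I1 + I2.
have B0 : 0 <= B by rewrite !addr_ge0.
have fgB s : 0 <= s <= T -> `|f s| <= B /\ `|g s| <= B.
  move=> sT; have [-> ->] := H s sT; rewrite /B -!addrA; split.
    apply: (le_trans (ler_normD _ _)); rewrite lerD2l.
    apply: (le_trans (bound _ pi_ s sT)).
    by rewrite addrCA lerDl addr_ge0.
  rewrite [leRHS]addrCA; apply: (le_trans (ler_normD _ _)); rewrite lerD2l.
  apply: (le_trans (bound _ qi s sT)).
  by rewrite addrA lerDr addr_ge0.
pose L := a + `|b|; have L0 : 0 <= L by rewrite addr_ge0.
have lin1 (x y K : R) : `|x| <= K -> `|y| <= K -> `|- a * x + b * y| <= L * K.
  move=> xK yK; apply: (le_trans (ler_normD _ _)); rewrite !normrM normrN (ger0_norm a0) /L mulrDl.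
  by apply: lerD; rewrite ler_wpM2l.
have lin2 (x y K : R) : `|x| <= K -> `|y| <= K -> `|- a * x - b * y| <= L * K.
  by move=> xK yK; rewrite -mulrN; apply: lin1 => //; rewrite normrN.
have inc s h : 0 <= s -> 0 < h -> s + h <= T ->
    f (s + h) - f s = \int[mu]_(r in `[0, s + h]) p r - \int[mu]_(r in `[0, s]) p r /\
    g (s + h) - g s = \int[mu]_(r in `[0, s + h]) q r - \int[mu]_(r in `[0, s]) q r.
  move=> s0 h0 shT.
  have s1 : 0 <= s <= T by rewrite s0 (le_trans _ shT)// lerDl ltW.
  have s2 : 0 <= s + h <= T by rewrite shT addr_ge0// ltW.
  have [-> ->] := H _ s2; have [-> ->] := H _ s1; rewrite -/p -/q; split; ring.
have lip s h : 0 <= s -> 0 < h -> s + h <= T ->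
    `|f (s + h) - f s| <= h * (L * B) /\ `|g (s + h) - g s| <= h * (L * B).
  move=> s0 h0 shT; have [-> ->] := inc s h s0 h0 shT; split.
    rewrite -[X in `|X|]subr0 -[X in _ - X](mulr0 h).
    apply: (itv_integral_increment pi_) => // r /andP[sr rh]; rewrite subr0.
    have [x1 x2] := fgB r (introT andP (conj (le_trans s0 sr) (le_trans rh shT))).
    exact: lin1.
  rewrite -[X in `|X|]subr0 -[X in _ - X](mulr0 h).
  apply: (itv_integral_increment qi) => // r /andP[sr rh]; rewrite subr0.
  have [x1 x2] := fgB r (introT andP (conj (le_trans s0 sr) (le_trans rh shT))).
  exact: lin2.
have z0 : 0 <= (0 : R) <= T by case/andP: tT => t0 tT; rewrite lexx (le_trans t0 tT).
have [f0E g0E] : f 0 = f0 /\ g 0 = g0.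
  by have [-> ->] := H 0 z0; rewrite set_itv1 !Rintegral_set1 !addr0.
rewrite -f0E -g0E.
apply: (rotation_ode a0 fgB) tT => e e0.
(* A Lipschitz constant for the right-hand sides: over a step h they change by at most h K, which
   the threshold e / (K + 1) keeps below e. *)
pose K := L * (L * B); have K0 : 0 <= K by rewrite !mulr_ge0.
exists (e / (K + 1)); first by rewrite divr_gt0// ltr_wpDl.
move=> s h s0 /andP[h0]; rewrite ltr_pdivlMr ?ltr_wpDl// => hK shT.
have [-> ->] := inc s h s0 h0 shT.
have hKe : h * K <= e by lra.
have close r : s <= r <= s + h -> `|f r - f s| <= h * (L * B) /\ `|g r - g s| <= h * (L * B).
  move=> /andP[]; rewrite le_eqVlt => /predU1P[<-|sr] rh.
    by rewrite !subrr normr0 !mulr_ge0// ltW.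
  have := lip s (r - s) s0; rewrite subr_gt0 => /(_ sr).
  have -> : s + (r - s) = r by ring.
  move=> /(_ (le_trans rh shT))[x1 x2].
  have le : (r - s) * (L * B) <= h * (L * B) by rewrite ler_wpM2r ?mulr_ge0// lerBlDl.
  by split; [exact: le_trans x1 le|exact: le_trans x2 le].
have fin x : x <= L * (h * (L * B)) -> x <= e.
  by move=> h1; apply: (le_trans h1); rewrite (_ : L * _ = h * K)// /K; ring.
split.
  apply: (itv_integral_increment pi_) => // r rh; have [x1 x2] := close r rh.
  apply: fin; rewrite (_ : _ - _ = - a * (f r - f s) + b * (g r - g s)); first exact: lin1.
  by rewrite /p; ring.
apply: (itv_integral_increment qi) => // r rh; have [x1 x2] := close r rh.
apply: fin; rewrite (_ : _ - _ = - a * (g r - g s) - b * (f r - f s)); first exact: lin2.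
by rewrite /q; ring.
Qed.

(** Joint square integrability on a set of finite measure dominates |w g| by the integrable 1 + w^2;
    Fubini then gives integrability in time of the spatial pairing, as the integral equation for the
    coefficients requires. *)
Lemma space_time_integrable T (w : R -> R -> R) g : 0 < T ->
  measurable_fun (space_time T) (fun z : R * R => w z.1 z.2) ->
  (\int[mu \x mu]_(z in space_time T) ((w z.1 z.2) ^+ 2)%:E < +oo)%E ->
  (forall t, 0 <= t <= T -> circle_integrable (w t)) ->
  continuous g -> (forall u, `|g u| <= 1) ->
  mu.-integrable `[0, T] (EFin \o (fun s => circle_integral (fun u => w s u * g u))).
Proof.
move=> T0 mw w2 wi cg g1.
have mST := measurable_space_time T : measurable (space_time T : set (R * R)).
have STfin : ((mu \x mu) (space_time T) < +oo)%E.
  have -> : space_time T = (`[0, T]%classic : set R) `*` (`[0, 1]%classic : set R).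
    by apply/seteqP; split => z /=; rewrite /space_time/= !in_itv/=.
  rewrite product_measure1E//= !lebesgue_measure_itv/= !lte_fin T0 ltr01 -!EFinB -EFinM ltry//.
have i1 : (mu \x mu)%E.-integrable (space_time T) (EFin \o (fun=> 1 : R)).
  apply/integrableP; split; first exact/measurable_EFinP.
  by under eq_integral do rewrite /= normr1; rewrite integral_cst// mul1e.
have i2 : (mu \x mu)%E.-integrable (space_time T) (EFin \o (fun z : R * R => w z.1 z.2 ^+ 2)).
  apply/integrableP; split; first by apply/measurable_EFinP; exact: measurable_funX.
  by under eq_integral do rewrite /= ger0_norm ?sqr_ge0//.
have mg : measurable_fun (space_time T) (fun z : R * R => g z.2).
  apply: measurable_funTS; apply: (measurableT_comp _ measurable_snd).
  exact: continuous_measurable_fun.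
have i3 : (mu \x mu)%E.-integrable (space_time T) (EFin \o (fun z : R * R => w z.1 z.2 * g z.2)).
  apply: (le_integrable _ _ _ (integrableD _ i1 i2)) => //.
    by apply/measurable_EFinP; exact: measurable_funM.
  move=> z _; rewrite /= lee_fin [leRHS]ger0_norm ?addr_ge0 ?sqr_ge0//.
  rewrite normrM; apply: (@le_trans _ _ (`|w z.1 z.2| * 1)); first by rewrite ler_wpM2l.
  have := sqr_ge0 (`|w z.1 z.2| - 1); have := normr_ge0 (w z.1 z.2).
  rewrite -[w z.1 z.2 ^+ 2]real_normK ?num_real//; nra.
move: i3; rewrite integrable_mkcond// => i3.
have iF := integrable_fubini_F i3.
have : mu.-integrable `[0, T] (fubini_F mu ((EFin \o (fun z : R * R => w z.1 z.2 * g z.2)) \_ (space_time T))).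
  exact: integrableS iF.
apply: eq_integrable => // s; rewrite inE/= in_itv/= => sT.
rewrite /fubini_F /=.
have is_ : circle_integrable (fun u => w s u * g u) by apply: circle_integrableMl => //; exact: wi.
rewrite /circle_integral /Rintegral fineK; last exact: integrable_fin_num.
rewrite [RHS]integral_mkcond; apply: eq_integral => u _; rewrite /patch/=.
congr (if _ then _ else _).
by apply/idP/idP; rewrite !inE/= /space_time/= in_itv/= sT => // -[].
Qed.

Lemma C2_circle_trigpoly (p : R -> R) : trigpoly p -> C2_circle p.
Proof.
move=> tp; have [pp dp] := trigpoly_smooth tp; split => //.
- exact: (dp 0%N).
- exact: (dp 1%N).
- exact: (smooth_cont (smooth_derive1n 2 (trigpoly_smooth tp))).
Qed.

Variables (T alpha M : R) (v0 : R -> R).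
Hypotheses (T0 : 0 < T) (pv0 : periodic1 v0) (mv0 : measurable_fun setT v0)
  (v0M : forall u, `|v0 u| <= M).

(** A single mode is an admissible test function, and the equation sends the plane of the k-th
    cosine and sine to itself. Testing with (a, b) equal to (1, 0) and to (0, 1) closes the
    system. *)
Lemma weak_solution_fourier w : weak_solution T alpha v0 w ->
  forall k t, 0 <= t <= T -> fourier_cos (w t) k = heat_cos alpha v0 k t /\
    fourier_sin (w t) k = heat_sin alpha v0 k t.
Proof.
move=> [pw mw w2 wi weq] k.
have ic := space_time_integrable T0 mw w2 wi (@continuous_ecos _ k) (fun u => cos_max _).
have is_ := space_time_integrable T0 mw w2 wi (@continuous_esin _ k) (fun u => sin_max _).
apply: (integral_rotation (sqr_ge0 _) ic is_) => t tT.
have modeE (a b : R) : C2_circle (fun u => a * ecos k u + b * esin k u) /\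
    forall s, 0 <= s <= T -> circle_integral (fun u => w s u *
       (derive1n 2 (fun u => a * ecos k u + b * esin k u) u -
        2 * alpha * derive1 (fun u => a * ecos k u + b * esin k u) u)) =
    (- freq k ^+ 2 * a - 2 * alpha * freq k * b) * fourier_cos (w s) k +
    (- freq k ^+ 2 * b + 2 * alpha * freq k * a) * fourier_sin (w s) k.
  split; first exact/C2_circle_trigpoly/trigpoly_mode.
  move=> s sT.
  have D1 := derive1_eq (is_derive_mode k a b).
  have D2 := derive1_eq (is_derive_mode k (freq k * b) (- freq k * a)).
  rewrite derive1nS derive1n1 D1 D2 -circle_integral_mode; last exact: wi.
  by congr circle_integral; apply/funext => u; ring.
have key a b : a * fourier_cos (w t) k + b * fourier_sin (w t) k =
    a * fourier_cos v0 k + b * fourier_sin v0 k + \int[mu]_(s in `[0, t])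
    ((- freq k ^+ 2 * a - 2 * alpha * freq k * b) * fourier_cos (w s) k +
     (- freq k ^+ 2 * b + 2 * alpha * freq k * a) * fourier_sin (w s) k).
  have [C2 E] := modeE a b; have := weq t _ tT C2.
  rewrite !circle_integral_mode//; [|exact: circle_integrable_bounded mv0 v0M|exact: wi].
  move=> /eqP; rewrite subr_eq0 subr_eq => /eqP ->; rewrite addrC.
  congr (_ + _); apply: eq_Rintegral => s; rewrite inE/= in_itv/= => /andP[s0 st].
  by rewrite E// s0 (le_trans st)//; case/andP: tT.
split; [have E := key 1 0|have E := key 0 1]; rewrite !mul1r !mul0r ?addr0 ?add0r in E;
  apply: (etrans E); congr (_ + _); apply: eq_Rintegral => s _; rewrite /fourier_cos /fourier_sin; ring.
Qed.

Lemma weak_solution_unique w w' : weak_solution T alpha v0 w ->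
  weak_solution T alpha v0 w' -> forall t, 0 <= t <= T ->
  {ae mu, forall u, u \in `[0, 1] -> w t u = w' t u}.
Proof.
move=> ww ww' t tT.
have [_ _ _ wi _] := ww; have [_ _ _ wi' _] := ww'.
have i1 := wi t tT; have i2 := wi' t tT.
have := @fourier_unique _ (fun u => w t u - w' t u) (circle_integrableB i1 i2).
move=> H; have {}H := H _.
have : {ae mu, forall u, u \in `[0, 1] -> w t u - w' t u = 0}.
  apply: H => k; have [c1 s1] := weak_solution_fourier ww k tT.
  have [c2 s2] := weak_solution_fourier ww' k tT.
  split.
    rewrite /fourier_cos (_ : (fun u => _) = (fun u => w t u * ecos k u - w' t u * ecos k u)).
      rewrite circle_integralB.
      - by rewrite -!/(fourier_cos _ _) c1 c2 subrr.
      - exact: (circle_integrableMl i1 (@continuous_ecos _ k)).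
      - exact: (circle_integrableMl i2 (@continuous_ecos _ k)).
    by apply/funext => u; rewrite mulrBl.
  rewrite /fourier_sin (_ : (fun u => _) = (fun u => w t u * esin k u - w' t u * esin k u)).
    rewrite circle_integralB.
    - by rewrite -!/(fourier_sin _ _) s1 s2 subrr.
    - exact: (circle_integrableMl i1 (@continuous_esin _ k)).
    - exact: (circle_integrableMl i2 (@continuous_esin _ k)).
  by apply/funext => u; rewrite mulrBl.
apply: filterS; first exact: (ae_filter_ringOfSetsType mu).
by move=> u hu /hu /eqP; rewrite subr_eq0 => /eqP.
Qed.

End weak_solution_uniqueness.

(** * Smooth functions of configurations and the energy cutoff *)

Section test_functions.
Context {R : realType} {N : nat}.
Implicit Types (eta v : config R N) (f g : config R N -> R) (x y : 'I_N) (c : 'I_N -> R).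

Definition energy2 eta : R := \sum_(x < N) eta ord0 x ^+ 2.

Definition linear_form c eta : R := \sum_(x < N) c x * eta ord0 x.

(** [C1_compact_support] without the support condition, so that coordinates, constants, sums and
    products can be handled first; the cutoff supplies the compact support at the end. *)
Definition C1 f := (forall eta, differentiable f eta) /\
  forall x, continuous (partial x f).

Lemma is_derive_coord eta v x : is_derive eta v (fun z : config R N => z ord0 x) (v ord0 x).
Proof.
have : (fun h : R => h^-1 *: ((h *: v + eta) ord0 x - eta ord0 x)) @ 0^' --> v ord0 x.
  apply: cvg_near_cst; near=> h.
  have h0 : h != 0 by near: h; exact: nbhs_dnbhs_neq.
  by rewrite !mxE addrK /GRing.scale/= mulrA mulVf// mul1r.
move=> cv; apply: DeriveDef; first by apply/cvg_ex; exists (v ord0 x).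
exact/cvg_lim.
Unshelve. all: by end_near. Qed.

Lemma differentiable_config_coord eta x : differentiable (fun z : config R N => z ord0 x) eta.
Proof. exact: differentiable_coord. Qed.

Lemma partial_is_derive x f eta (df : R) : is_derive eta (delta_mx ord0 x : config R N) f df ->
  partial x f eta = df.
Proof. by move=> [_ <-]. Qed.

Lemma C1_is_derive f eta v : C1 f -> is_derive eta v f ('D_v f eta).
Proof. by move=> [df _]; apply/derivableP/diff_derivable. Qed.

Lemma C1_continuous f : C1 f -> continuous f.
Proof. by move=> [df _] eta; exact: differentiable_continuous. Qed.

Lemma C1M f g : C1 f -> C1 g -> C1 (fun eta => f eta * g eta) /\
  forall x eta, partial x (fun eta => f eta * g eta) eta =
    f eta * partial x g eta + g eta * partial x f eta.
Proof.
move=> Cf Cg; have [df pf] := Cf; have [dg pg] := Cg.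
have E x eta : partial x (fun eta => f eta * g eta) eta =
    f eta * partial x g eta + g eta * partial x f eta.
  apply: partial_is_derive.
  exact: (is_deriveM (C1_is_derive eta _ Cf) (C1_is_derive eta _ Cg)).
split=> //; split; first by move=> eta; exact: differentiableM.
move=> x; have -> : partial x (fun eta => f eta * g eta) =
    fun eta => f eta * partial x g eta + g eta * partial x f eta.
  by apply/funext => eta; exact: E.
move=> eta.
exact: (cvgD (cvgM (C1_continuous Cf (x := eta)) (pg x eta))
             (cvgM (C1_continuous Cg (x := eta)) (pf x eta))).
Qed.

Lemma C1D f g : C1 f -> C1 g -> C1 (fun eta => f eta + g eta) /\
  forall x eta, partial x (fun eta => f eta + g eta) eta = partial x f eta + partial x g eta.
Proof.
move=> Cf Cg; have [df pf] := Cf; have [dg pg] := Cg.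
have E x eta : partial x (fun eta => f eta + g eta) eta = partial x f eta + partial x g eta.
  apply: partial_is_derive.
  exact: (is_deriveD (C1_is_derive eta _ Cf) (C1_is_derive eta _ Cg)).
split=> //; split; first by move=> eta; exact: differentiableD.
move=> x; have -> : partial x (fun eta => f eta + g eta) =
    fun eta => partial x f eta + partial x g eta.
  by apply/funext => eta; exact: E.
by move=> eta; exact: (cvgD (pf x eta) (pg x eta)).
Qed.

Lemma C1_coord x : C1 (fun z : config R N => z ord0 x) /\
  forall y eta, partial y (fun z : config R N => z ord0 x) eta = (x == y)%:R.
Proof.
have E y eta : partial y (fun z : config R N => z ord0 x) eta = (x == y)%:R.
  by rewrite (partial_is_derive (is_derive_coord _ _ _)) mxE eqxx.
split=> //; split; first by move=> eta; exact: differentiable_config_coord.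
move=> y; have -> : partial y (fun z : config R N => z ord0 x) = fun=> (x == y)%:R.
  by apply/funext => eta; exact: E.
by move=> eta; exact: cst_continuous.
Qed.

Lemma C1_cst (a : R) : C1 (fun=> a) /\ forall y eta, partial y (fun=> a) eta = 0.
Proof.
have E y eta : partial y (fun=> a) eta = 0 by exact: derive_cst.
split=> //; split; first by move=> eta; exact: differentiable_cst.
move=> y; have -> : partial y (fun=> a) = fun=> 0 by apply/funext => eta; exact: E.
by move=> eta; exact: cst_continuous.
Qed.

Lemma C1_sum (r : seq 'I_N) (F : 'I_N -> config R N -> R) : (forall x, C1 (F x)) ->
  C1 (fun eta => \sum_(x <- r) F x eta) /\
  forall y eta, partial y (fun eta => \sum_(x <- r) F x eta) eta =
    \sum_(x <- r) partial y (F x) eta.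
Proof.
move=> CF; elim: r => [|x r [IH1 IH2]].
  have -> : (fun eta => \sum_(x <- [::]) F x eta) = (fun=> 0).
    by apply/funext => eta; rewrite big_nil.
  by have [h1 h2] := C1_cst 0; split=> // y eta; rewrite h2 big_nil.
have -> : (fun eta => \sum_(x <- x :: r) F x eta) =
    (fun eta => F x eta + \sum_(x <- r) F x eta).
  by apply/funext => eta; rewrite big_cons.
have [h1 h2] := C1D (CF x) IH1; split=> // y eta.
by rewrite h2 IH2 big_cons.
Qed.

Lemma C1_linear_form c : C1 (linear_form c) /\
  forall y eta, partial y (linear_form c) eta = c y.
Proof.
have H x : C1 (fun z : config R N => c x * z ord0 x) /\
    forall y eta, partial y (fun z : config R N => c x * z ord0 x) eta = c x * (x == y)%:R.
  have [C1x Px] := C1_coord x; have [C1c Pc] := C1_cst (c x).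
  have [h1 h2] := C1M C1c C1x; split=> // y eta.
  by rewrite h2 Px Pc mulr0 addr0.
have [h1 h2] := C1_sum (index_enum _) (fun x => (H x).1); split=> // y eta.
rewrite h2 (bigD1 y)//= (H y).2 eqxx mulr1 big1 ?addr0// => x /negbTE xy.
by rewrite (H x).2 xy mulr0.
Qed.

Lemma C1_energy2 : C1 energy2 /\ forall y eta, partial y energy2 eta = 2 * eta ord0 y.
Proof.
have H x : C1 (fun z : config R N => z ord0 x ^+ 2) /\
    forall y eta, partial y (fun z : config R N => z ord0 x ^+ 2) eta =
      2 * eta ord0 x * (x == y)%:R.
  have [Cx Px] := C1_coord x; have [h1 h2] := C1M Cx Cx; split=> // y eta.
  by apply: (etrans (h2 y eta)); rewrite Px; ring.
have [h1 h2] := C1_sum (index_enum _) (fun x => (H x).1); split=> // y eta.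
rewrite h2 (bigD1 y)//= (H y).2 eqxx mulr1 big1 ?addr0// => x /negbTE xy.
by rewrite (H x).2 xy mulr0.
Qed.

(** The positive part is squared to make the function C^1. No plateau around [r0] is needed: the
    energy is conserved, so the value 1 at the single level [r0] suffices. *)
Definition bump (r0 r : R) : R := Num.max 0 (1 - (r - r0) ^+ 2) ^+ 2.

Definition bump' (r0 r : R) : R :=
  - 4 * Num.max 0 (1 - (r - r0) ^+ 2) * (r - r0).

Lemma is_derive_max0_sqr (x : R) : is_derive x 1 (fun r : R => Num.max 0 r ^+ 2) (2 * Num.max 0 x).
Proof.
(* The first-order remainder is at most h^2 whatever the signs of x and h + x; this covers the kink
   at 0. *)
have key (h : R) : `|Num.max 0 (h + x) ^+ 2 - Num.max 0 x ^+ 2 - h * (2 * Num.max 0 x)| <= h ^+ 2.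
  rewrite ler_norml; case: (lerP 0 x) => x0; case: (lerP 0 (h + x)) => hx0;
    apply/andP; split; nra.
have : (fun h : R => h^-1 *: (Num.max 0 (h *: (1 : R) + x) ^+ 2 - Num.max 0 x ^+ 2)) @ 0^' --> 2 * Num.max 0 x.
  apply/cvgrPdist_le => e e0; near=> h.
  have h0 : h != 0 by near: h; exact: nbhs_dnbhs_neq.
  have he : `|h| <= e.
    by near: h; apply: dnbhs0_le.
  rewrite /GRing.scale/= mulr1.
  have -> : 2 * Num.max 0 x - h^-1 * (Num.max 0 (h + x) ^+ 2 - Num.max 0 x ^+ 2) =
     - (h^-1 * (Num.max 0 (h + x) ^+ 2 - Num.max 0 x ^+ 2 - h * (2 * Num.max 0 x))) by field.
  rewrite normrN normrM normfV ler_pdivrMl ?normr_gt0//.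
  apply: (le_trans (key h)); rewrite -real_normK ?num_real// expr2.
  by rewrite ler_wpM2l.
move=> cv; apply: DeriveDef; first by apply/cvg_ex; exists (2 * Num.max 0 x).
exact/cvg_lim.
Unshelve. all: by end_near. Qed.

Lemma is_derive_bump r0 (r : R) : is_derive r 1 (bump r0) (bump' r0 r).
Proof.
have h1 := is_derive_max0_sqr (1 - (r - r0) ^+ 2).
have h2 : is_derive r 1 (fun r : R => 1 - (r - r0) ^+ 2) (- 2 * (r - r0)).
  by apply: is_derive_eq; rewrite /GRing.scale/=; ring.
have h3 := @is_derive1_comp _ (fun r : R => Num.max 0 r ^+ 2) (fun r => 1 - (r - r0) ^+ 2) r _ _ h1 h2.
apply: (is_derive_eq h3); rewrite /bump'; ring.
Qed.

Lemma continuous_bump' r0 : continuous (bump' r0).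
Proof.
have c0 : continuous (fun r : R => r - r0).
  by move=> r; apply: cvgB; [exact: cvg_id|exact: cvg_cst].
move=> r; apply: cvgM; last exact: c0.
apply: cvgM; first exact: cvg_cst.
apply: (@continuous_max _ _ (fun=> 0) (fun r => 1 - (r - r0) ^+ 2)); first exact: cvg_cst.
by apply: cvgB; [exact: cvg_cst|apply: cvgM; exact: c0].
Qed.

Lemma bump_bounds r0 r : 0 <= bump r0 r <= 1.
Proof.
rewrite /bump sqr_ge0 expr_le1 ?le_max ?lexx// ge_max ler01/=.
by rewrite gerBl sqr_ge0.
Qed.

Lemma bump_center r0 : bump r0 r0 = 1.
Proof. by rewrite /bump subrr expr0n/= subr0 max_r ?ler01// expr1n. Qed.

Lemma bump_supp r0 r : bump r0 r != 0 -> r < r0 + 1 /\ r0 - 1 < r.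
Proof.
rewrite /bump expf_eq0/=; case: (lerP 0 (1 - (r - r0) ^+ 2)) => h; last by rewrite eqxx.
move=> h0; have {h0} h' : 0 < 1 - (r - r0) ^+ 2 by rewrite lt_def h0.
split; nra.
Qed.

Definition radial (r0 : R) eta : R := bump r0 (energy2 eta).

Lemma C1_radial (r0 : R) : C1 (radial r0) /\
  forall y eta, partial y (radial r0) eta = bump' r0 (energy2 eta) * (2 * eta ord0 y).
Proof.
have [Ce Pe] := C1_energy2.
have db r : differentiable (bump r0) r.
  by apply/derivable1_diffP; have [] := is_derive_bump r0 r.
have de eta : differentiable (radial r0) eta.
  by apply: (@differentiable_comp _ _ _ _ energy2 (bump r0)); [exact: Ce.1|exact: db].
have E y eta : partial y (radial r0) eta = bump' r0 (energy2 eta) * (2 * eta ord0 y).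
  rewrite /partial deriveE; last exact: de.
  rewrite (@diff_comp _ _ _ _ energy2 (bump r0)); [|exact: Ce.1|exact: db].
  have De : 'd energy2 eta (delta_mx ord0 y : config R N) = partial y energy2 eta.
    by rewrite /partial deriveE//; exact: Ce.1.
  rewrite /= De Pe.
  rewrite deriv1E; last by have [] := is_derive_bump r0 (energy2 eta).
  rewrite (derive1_eq (is_derive_bump r0)) /GRing.scale/=; ring.
split=> //; split=> // y; have -> : partial y (radial r0) = fun eta => bump' r0 (energy2 eta) * (2 * eta ord0 y).
  by apply/funext => eta; exact: E.
move=> eta.
have c1 : continuous (fun z : config R N => bump' r0 (energy2 z)).
  move=> z; apply: (@continuous_comp _ _ _ energy2 (bump' r0)); last exact: continuous_bump'.
  exact: C1_continuous.
have c2 : continuous (fun z : config R N => 2 * z ord0 y).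
  have [[d1 _] _] := C1M (C1_cst 2).1 (C1_coord y).1.
  by move=> z; apply: differentiable_continuous; exact: d1.
exact: (cvgM (c1 eta) (c2 eta)).
Qed.

End test_functions.

(** * Expectations under probability kernels *)

Section probability_kernels.
Context {d : measure_display} {X : measurableType d} {R : realType}.
Implicit Types (f g : X -> R) (k : R.-pker X ~> X) (x : X) (B : R).

Definition kexp k f x : R := \int[k x]_z f z.

Definition bounded_measurable f :=
  measurable_fun setT f /\ exists B, forall z, `|f z| <= B.

Lemma kernel_integrable k f x : bounded_measurable f ->
  (k x).-integrable setT (EFin \o f).
Proof.
move=> [mf [B fB]]; apply: measurable_bounded_integrable => //.
- by rewrite prob_kernel ltry.
- by exists B; split; [exact: num_real|move=> y /ltW By z _; exact: le_trans (fB z) By].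
Qed.

Lemma kexp_cst k (a : R) x : kexp k (fun=> a) x = a.
Proof. by rewrite /kexp Rintegral_cst// prob_kernel mulr1. Qed.

Lemma bounded_measurable_cst (a : R) : bounded_measurable (fun=> a).
Proof. by split; [exact: measurable_cst|exists `|a|]. Qed.

Lemma bounded_measurableD f g : bounded_measurable f -> bounded_measurable g ->
  bounded_measurable (fun z => f z + g z) /\
  forall k x, kexp k (fun z => f z + g z) x = kexp k f x + kexp k g x.
Proof.
move=> bf bg; split=> [|k x]; last by apply: RintegralD => //; exact: kernel_integrable.
case: bf bg => [mf [B fB]] [mg [C gC]]; split; first exact: measurable_funD.
by exists (B + C) => z; apply: (le_trans (ler_normD _ _)); exact: lerD.
Qed.

Lemma bounded_measurableZ (a : R) f : bounded_measurable f ->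
  bounded_measurable (fun z => a * f z) /\
  forall k x, kexp k (fun z => a * f z) x = a * kexp k f x.
Proof.
move=> bf; split=> [|k x]; last by apply: RintegralZl => //; exact: kernel_integrable.
case: bf => [mf [B fB]]; split; first exact: measurable_funM.
by exists (`|a| * B) => z; rewrite normrM ler_wpM2l.
Qed.

Lemma bounded_measurable_linear (a b : R) f g :
  bounded_measurable f -> bounded_measurable g ->
  bounded_measurable (fun z => a * f z + b * g z) /\
  forall k x, kexp k (fun z => a * f z + b * g z) x = a * kexp k f x + b * kexp k g x.
Proof.
move=> /(bounded_measurableZ a)[bf Ef] /(bounded_measurableZ b)[bg Eg].
by have [bfg E] := bounded_measurableD bf bg; split=> // k x; rewrite E Ef Eg.
Qed.

Lemma kexp_le k f g x : bounded_measurable f -> bounded_measurable g ->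
  (forall z, f z <= g z) -> kexp k f x <= kexp k g x.
Proof. by move=> bf bg fg; apply: le_Rintegral => //; exact: kernel_integrable. Qed.

Lemma kexp_norm k f B x : measurable_fun setT f -> (forall z, `|f z| <= B) ->
  `|kexp k f x| <= B.
Proof.
move=> mf fB; have bf : bounded_measurable f by split=> //; exists B.
have i := kernel_integrable k x bf.
apply: (le_trans (le_normr_Rintegral _ i)) => //.
rewrite -[leRHS](kexp_cst k B x); apply: le_Rintegral => //.
  exact: integrable_norm.
exact: (kernel_integrable _ _ (bounded_measurable_cst B)).
Qed.

Lemma bounded_measurable_kexp k f : bounded_measurable f -> bounded_measurable (kexp k f).
Proof.
move=> bf; have [mf [B fB]] := bf.
split; last by exists B => x; exact: kexp_norm.
(* Measurability of kernel integrals is applied to a nonnegative function, hence the shift by the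
   bound B. *)
have -> : kexp k f = (fun x => fine (\int[k x]_z (f z + B)%:E)%E - B).
  apply/funext => x; have [_ E] := bounded_measurableD bf (bounded_measurable_cst B).
  by rewrite -[X in X - B]/(kexp k (fun z => f z + B) x) E kexp_cst addrK.
apply: measurable_funB => //.
apply: (measurableT_comp (f := fine)) => //.
apply: measurable_fun_integral_kernel => [U mU|z|].
- exact: measurable_kernel.
- by rewrite lee_fin -lerBlDr sub0r; have := fB z; rewrite ler_norml => /andP[].
- by apply/measurable_EFinP; exact: measurable_funD.
Qed.

(** The hypothesis is the Chapman-Kolmogorov relation on sets. It extends to nonnegative functions
    through the composition of kernels, and to bounded ones after a shift by B. *)
Lemma kexp_comp (k1 k2 k3 : R.-pker X ~> X) f x :
  (forall A, measurable A -> k3 x A = \int[k1 x]_y k2 y A)%E ->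
  bounded_measurable f -> kexp k3 f x = kexp k1 (kexp k2 f) x.
Proof.
move=> k3E bf; have [mf [B fB]] := bf; have bB := bounded_measurable_cst B.
have nn z : (0 <= (f z + B)%:E)%E.
  by rewrite lee_fin -lerBlDr sub0r; have := fB z; rewrite ler_norml => /andP[].
have [bfB E1] := bounded_measurableD bf bB.
have [_ E2] := bounded_measurableD (bounded_measurable_kexp k2 bf) bB.
have mfE : measurable_fun setT (fun z => (f z + B)%:E) by exact/measurable_EFinP/bfB.1.
have E : (\int[k3 x]_z (f z + B)%:E = \int[k1 x]_y \int[k2 y]_z (f z + B)%:E)%E.
  rewrite -(integral_kcomp k1 (kernel.kernel_snd k2) x nn mfE).
  by apply: eq_measure_integral => A mA _; rewrite k3E.
apply: (@addIr _ B).
rewrite -{1}[B](kexp_cst k3 B x) -E1 -{2}[B](kexp_cst k1 B x) -E2.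
rewrite {1}/kexp /Rintegral E /kexp /Rintegral; congr fine.
apply: eq_integral => y _; rewrite -/(Rintegral _ _ _).
rewrite -[X in (X + B)%:E]/(kexp k2 f y) -{2}[B](kexp_cst k2 B y) -E1.
rewrite /kexp /Rintegral fineK//.
by apply: (integrable_fin_num measurableT); exact: (kernel_integrable k2 y bfB).
Qed.

Lemma measurable_superlevel f (c : R) : measurable_fun setT f ->
  measurable [set z | c <= f z].
Proof.
move=> mf; have := mf measurableT _ (measurable_itv `[c, +oo[); rewrite setTI.
by congr (measurable _); apply/seteqP; split=> z /=; rewrite in_itv/= andbT.
Qed.

Lemma measurable_strict_superlevel f (c : R) : measurable_fun setT f ->
  measurable [set z | c < f z].
Proof.
move=> mf; have := mf measurableT _ (measurable_itv `]c, +oo[); rewrite setTI.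
by congr (measurable _); apply/seteqP; split=> z /=; rewrite in_itv/= andbT.
Qed.

Lemma kernel_set_le k x (A : set X) g : measurable A -> bounded_measurable g ->
  (forall z, 0 <= g z) -> (forall z, A z -> 1 <= g z) ->
  (k x A <= (kexp k g x)%:E)%E.
Proof.
move=> mA bg g0 g1.
have fin : k x A \is a fin_num.
  have kT : (k x setT < +oo)%E by rewrite prob_kernel ltry.
  rewrite ge0_fin_numE//; apply: le_lt_trans kT.
  by apply: le_measure; rewrite ?inE.
have E : fine (k x A) = kexp k (\1_A) x.
  by rewrite /kexp /Rintegral integral_indic// setIT.
rewrite -(fineK fin) lee_fin E.
have b1 : bounded_measurable (\1_A : X -> R).
  split; first exact: measurable_indic.
  by exists 1 => z; rewrite indicE; case: (z \in A); rewrite ?normr1 ?normr0.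
apply: (kexp_le k x b1 bg) => z; rewrite indicE.
by have [/set_mem/g1//|_] := boolP (z \in A); exact: g0.
Qed.

End probability_kernels.

(** * The generator on linear and quadratic functions *)

Section generator.
Context {R : realType} {N : nat}.
Implicit Types (eta : config R N) (h : config R N -> R) (x y : 'I_N) (c : 'I_N -> R) (F : R -> R).

Lemma coord_le_energy2 eta x : eta ord0 x ^+ 2 <= energy2 eta.
Proof.
by rewrite /energy2 (bigD1 x)//= lerDl sumr_ge0// => i _; rewrite sqr_ge0.
Qed.

Lemma energy2_ge0 eta : 0 <= energy2 eta.
Proof. by rewrite sumr_ge0// => i _; rewrite sqr_ge0. Qed.

Lemma energy2_compact (K : R) (A : set (config R N)) :
  (forall eta, A eta -> energy2 eta <= K) -> compact (closure A).
Proof.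
move=> AK.
have cl : closed [set eta : config R N | energy2 eta <= K].
  apply: (@closed_comp _ _ energy2 [set r | r <= K]); last exact: closed_le.
  by move=> z _; exact: (C1_continuous (C1_energy2).1).
have co : compact [set v : 'rV[R]_N | forall i, `[(- (1 + K)), (1 + K)]%classic (v ord0 i)].
  by apply: (@rV_compact _ _ (fun=> `[(- (1 + K)), (1 + K)]%classic)) => i; exact: segment_compact.
apply: (subclosed_compact _ co); first exact: closed_closure.
move=> v /(closure_subset (B := [set eta : config R N | energy2 eta <= K])) Hv i.
have {Hv}vK : energy2 v <= K by move: (Hv AK); rewrite -(closure_id _).1.
have := coord_le_energy2 v i => /= /le_trans/(_ vK) h; rewrite in_itv/=.
by apply/andP; split; nra.
Qed.

Lemma energy2_swap x y eta : energy2 (swap x y eta) = energy2 eta.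
Proof.
rewrite /energy2 /swap [RHS](reindex_inj (@perm_inj _ (tperm x y)))/=.
by apply: eq_bigr => z _; rewrite mxE.
Qed.

Lemma C1_compact_support_radial h (r0 : R) : C1 h ->
  C1_compact_support (fun eta => h eta * radial r0 eta).
Proof.
move=> Ch; have [Cr _] := @C1_radial R N r0; have [[d c] _] := C1M Ch Cr.
split=> //; apply: (@energy2_compact (r0 + 1)) => eta /=.
by rewrite mulf_eq0 negb_or => /andP[_] /bump_supp[/ltW].
Qed.

(* The drift field is tangent to the spheres energy2 = constant. *)
Lemma generator_radial (alpha kappa : R) h (r0 : R) : C1 h -> forall eta,
  generator alpha kappa (fun eta => h eta * radial r0 eta) eta =
  generator alpha kappa h eta * radial r0 eta.
Proof.
move=> Ch eta; rewrite /generator [RHS]mulrDl -[X in _ = X + _]mulrA -[X in _ = _ + X]mulrA.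
congr (_ * _ + _ * _).
  rewrite /exchange_generator mulr_suml; apply: eq_bigr => x _.
  by rewrite /radial energy2_swap mulrBl.
have [Cr Pr] := @C1_radial R N r0; have [_ P] := C1M Ch Cr.
rewrite /drift_generator mulr_suml.
have -> : \sum_(x < N) (eta ord0 (ordS x) - eta ord0 (ord_pred x)) *
     partial x (fun eta => h eta * radial r0 eta) eta =
   \sum_(x < N) (eta ord0 (ordS x) - eta ord0 (ord_pred x)) * partial x h eta * radial r0 eta +
   2 * h eta * bump' r0 (energy2 eta) *
    (\sum_(x < N) eta ord0 (ordS x) * eta ord0 x - \sum_(x < N) eta ord0 (ord_pred x) * eta ord0 x).
  rewrite -sumrB mulr_sumr -big_split/=; apply: eq_bigr => x _.
  by rewrite P Pr; ring.
have -> : \sum_(x < N) eta ord0 (ord_pred x) * eta ord0 x = \sum_(x < N) eta ord0 (ordS x) * eta ord0 x.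
  rewrite [LHS](reindex_inj (can_inj (@ordSK N)))/=; apply: eq_bigr => x _.
  by rewrite ordSK mulrC.
by rewrite subrr mulr0 addr0.
Qed.

Lemma linear_form_swap c x y eta :
  linear_form c (swap x y eta) - linear_form c eta =
  (eta ord0 y - eta ord0 x) * (c x - c y).
Proof.
rewrite /linear_form -sumrB.
(* This case does occur: for N = 1 the successor of x is x itself. *)
have [<-|xy] := eqVneq x y.
  rewrite subrr mul0r big1// => z _; rewrite mxE tperm1 perm1; ring.
rewrite (bigD1 x)//= (bigD1 y) 1?eq_sym//= big1 => [|z /andP[zx zy]].
  by rewrite !mxE tpermL tpermR; ring.
by rewrite mxE tpermD 1?eq_sym// subrr.
Qed.

Lemma exchange_linear_form c eta :
  exchange_generator (linear_form c) eta =
  linear_form (fun x => c (ordS x) + c (ord_pred x) - 2 * c x) eta.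
Proof.
rewrite /exchange_generator.
under eq_bigr => x _ do rewrite linear_form_swap.
have -> : \sum_(x < N) (eta ord0 (ordS x) - eta ord0 x) * (c x - c (ordS x)) =
  \sum_(x < N) (c x * eta ord0 (ordS x)) - \sum_(x < N) (c (ordS x) * eta ord0 (ordS x))
  - \sum_(x < N) (c x * eta ord0 x) + \sum_(x < N) (c (ordS x) * eta ord0 x).
  by rewrite -!sumrB -big_split/=; apply: eq_bigr => x _; ring.
rewrite (reindex_inj (can_inj (@ord_predK N)))/=.
under eq_bigr => x _ do rewrite ord_predK.
have -> : \sum_(x < N) (c (ordS x) * eta ord0 (ordS x)) = \sum_(x < N) (c x * eta ord0 x).
  by rewrite [RHS](reindex_inj (can_inj (@ordSK N))).
rewrite -!sumrB -big_split/= /linear_form; apply: eq_bigr => x _; ring.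
Qed.

(** Shifting the summation index moves the central difference to the coefficients with the opposite
    sign. This antisymmetry is the discrete source of the minus sign in front of 2 alpha times the
    derivative of the test function. *)
Lemma drift_linear_form c eta :
  drift_generator (linear_form c) eta =
  linear_form (fun x => c (ord_pred x) - c (ordS x)) eta.
Proof.
rewrite /drift_generator; under eq_bigr => x _ do rewrite (C1_linear_form c).2.
have -> : \sum_(x < N) (eta ord0 (ordS x) - eta ord0 (ord_pred x)) * c x =
  \sum_(x < N) (c x * eta ord0 (ordS x)) - \sum_(x < N) (c x * eta ord0 (ord_pred x)).
  by rewrite -sumrB; apply: eq_bigr => x _; ring.
rewrite (reindex_inj (can_inj (@ord_predK N)))/=.
under eq_bigr => x _ do rewrite ord_predK.
rewrite [X in _ - X](reindex_inj (can_inj (@ordSK N)))/=.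
under [X in _ - X]eq_bigr => x _ do rewrite ordSK.
by rewrite -sumrB /linear_form; apply: eq_bigr => x _; rewrite mulrBl.
Qed.

Definition dx : R := N%:R^-1.

(** At x = N - 1 the cyclic successor jumps back to 0; the discrepancy is an integer shift, absorbed
    by periodicity. *)
Lemma periodic_ordS F x : periodic1 F ->
  F ((ordS x)%:R / N%:R) = F (x%:R / N%:R + dx).
Proof.
move=> pF; have N0 : (0 < N)%N by exact: leq_ltn_trans (ltn_ord x).
have Nn : N%:R != 0 :> R by rewrite pnatr_eq0 -lt0n.
have := divn_eq x.+1 N; rewrite -/(nat_of_ord (ordS x)) => E.
have -> : x%:R / N%:R + dx = (ordS x)%:R / N%:R + (x.+1 %/ N)%N%:Z%:~R.
  rewrite /dx -[X in _ + X]mul1r -mulrDl natr1 {1}E natrD natrM -pmulrn.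
  by field.
by rewrite periodic1_int.
Qed.

Lemma periodic_ord_pred F x : periodic1 F ->
  F ((ord_pred x)%:R / N%:R) = F (x%:R / N%:R - dx).
Proof.
move=> pF; have pG : periodic1 (fun u => F (u - dx)).
  by move=> u; rewrite addrAC pF.
have := periodic_ordS (ord_pred x) pG; rewrite ord_predK addrK => <-.
by [].
Qed.

Definition mode_cos k eta : R := empirical_form eta (@ecos R k).
Definition mode_sin k eta : R := empirical_form eta (@esin R k).

Lemma empirical_formE F :
  (fun eta => empirical_form eta F) = linear_form (fun x => dx * F (x%:R / N%:R)).
Proof.
apply/funext => eta; rewrite /empirical_form /linear_form mulr_sumr.
by apply: eq_bigr => x _; rewrite /dx; ring.
Qed.

Lemma mode_cosE k : mode_cos k = linear_form (fun x => dx * ecos k (x%:R / N%:R)).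
Proof. exact: empirical_formE. Qed.

Lemma mode_sinE k : mode_sin k = linear_form (fun x => dx * esin k (x%:R / N%:R)).
Proof. exact: empirical_formE. Qed.

Lemma empirical_formZ (a : R) F eta :
  empirical_form eta (fun u => a * F u) = a * empirical_form eta F.
Proof.
by rewrite /empirical_form mulrCA [in RHS]mulr_sumr; congr (_ * _); apply: eq_bigr => x _; ring.
Qed.

Lemma generator_empirical F eta : periodic1 F ->
  exchange_generator (fun z => empirical_form z F) eta =
    empirical_form eta (fun u => F (u + dx) + F (u - dx) - 2 * F u) /\
  drift_generator (fun z => empirical_form z F) eta =
    empirical_form eta (fun u => F (u - dx) - F (u + dx)).
Proof.
move=> pF; rewrite empirical_formE exchange_linear_form drift_linear_form.
have E H : empirical_form eta H = linear_form (fun x => dx * H (x%:R / N%:R)) eta.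
  by rewrite -empirical_formE.
by rewrite !E; split; congr linear_form; apply/funext => x;
  rewrite (periodic_ordS _ pF) (periodic_ord_pred _ pF); ring.
Qed.

Definition angle (k : int) : R := freq k * dx.

Definition disc_rate (k : int) : R := 2 * N%:R ^+ 2 * (1 - cos (angle k)).
Definition disc_drift (alpha kappa : R) (k : int) : R :=
  2 * (alpha_seq alpha kappa N * N%:R ^+ 2) * sin (angle k).

Lemma ecosD_dx k u : ecos k (u + dx) = cos (angle k) * ecos k u - sin (angle k) * esin k u.
Proof. by rewrite /ecos /esin mulrDr cosD -/(angle k); ring. Qed.

Lemma ecosB_dx k u : ecos k (u - dx) = cos (angle k) * ecos k u + sin (angle k) * esin k u.
Proof. by rewrite /ecos /esin mulrBr cosB -/(angle k); ring. Qed.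

Lemma esinD_dx k u : esin k (u + dx) = cos (angle k) * esin k u + sin (angle k) * ecos k u.
Proof. by rewrite /ecos /esin mulrDr sinD -/(angle k); ring. Qed.

Lemma esinB_dx k u : esin k (u - dx) = cos (angle k) * esin k u - sin (angle k) * ecos k u.
Proof. by rewrite /ecos /esin mulrBr sinB -/(angle k); ring. Qed.

Lemma modes_exchange k eta :
  exchange_generator (mode_cos k) eta = - (2 * (1 - cos (angle k))) * mode_cos k eta /\
  exchange_generator (mode_sin k) eta = - (2 * (1 - cos (angle k))) * mode_sin k eta.
Proof.
rewrite -!empirical_formZ; split.
  rewrite [LHS](generator_empirical eta (@periodic_ecos _ k)).1.
  by congr empirical_form; apply/funext => u; rewrite ecosD_dx ecosB_dx; ring.
rewrite [LHS](generator_empirical eta (@periodic_esin _ k)).1.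
by congr empirical_form; apply/funext => u; rewrite esinD_dx esinB_dx; ring.
Qed.

Lemma modes_drift k eta :
  drift_generator (mode_cos k) eta = 2 * sin (angle k) * mode_sin k eta /\
  drift_generator (mode_sin k) eta = - (2 * sin (angle k)) * mode_cos k eta.
Proof.
rewrite -!empirical_formZ; split.
  rewrite [LHS](generator_empirical eta (@periodic_ecos _ k)).2.
  by congr empirical_form; apply/funext => u; rewrite ecosD_dx ecosB_dx; ring.
rewrite [LHS](generator_empirical eta (@periodic_esin _ k)).2.
by congr empirical_form; apply/funext => u; rewrite esinD_dx esinB_dx; ring.
Qed.

Lemma modes_generator (alpha kappa : R) k eta :
  generator alpha kappa (mode_cos k) eta =
    - disc_rate k * mode_cos k eta + disc_drift alpha kappa k * mode_sin k eta /\
  generator alpha kappa (mode_sin k) eta =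
    - disc_rate k * mode_sin k eta - disc_drift alpha kappa k * mode_cos k eta.
Proof.
rewrite /generator /disc_rate /disc_drift.
by have [-> ->] := modes_exchange k eta; have [-> ->] := modes_drift k eta; split; ring.
Qed.

(** The squared modulus of the k-th Fourier coefficient. The drift only rotates the pair of modes,
    so its generator vanishes on this function. *)
Definition mode_sqr k eta : R := mode_cos k eta * mode_cos k eta + mode_sin k eta * mode_sin k eta.

Lemma C1_mode k : C1 (mode_cos k) /\ C1 (mode_sin k).
Proof. by rewrite mode_cosE mode_sinE; split; apply: (C1_linear_form _).1. Qed.

Lemma C1_mode_sqr k : C1 (mode_sqr k).
Proof.
have [c s] := C1_mode k.
exact: (C1D (C1M c c).1 (C1M s s).1).1.
Qed.

Definition gradient2 eta : R := \sum_(x < N) (eta ord0 (ordS x) - eta ord0 x) ^+ 2.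

Lemma gradient2_bounds eta : 0 <= gradient2 eta <= 4 * energy2 eta.
Proof.
rewrite sumr_ge0/=; last by move=> x _; exact: sqr_ge0.
have E : \sum_(x < N) eta ord0 (ordS x) ^+ 2 = energy2 eta.
  by rewrite /energy2 [RHS](reindex_inj (can_inj (@ordSK N))).
apply: (@le_trans _ _ (\sum_(x < N) (2 * eta ord0 (ordS x) ^+ 2 + 2 * eta ord0 x ^+ 2))).
  apply: ler_sum => x _; have := sqr_ge0 (eta ord0 (ordS x) + eta ord0 x); nra.
rewrite big_split/= -!mulr_sumr E -/(energy2 eta); lra.
Qed.

(* The gradient2 term is the carre du champ of the exchanges. *)
Lemma mode_sqr_generator (alpha kappa : R) k eta : (0 < N)%N ->
  generator alpha kappa (mode_sqr k) eta =
  - (2 * disc_rate k) * mode_sqr k eta + disc_rate k / N%:R ^+ 2 * gradient2 eta.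
Proof.
move=> N0; have Nn : N%:R != 0 :> R by rewrite pnatr_eq0 -lt0n.
have [Cc Cs] := C1_mode k.
have [C1c P1] := C1M Cc Cc; have [C2s P2] := C1M Cs Cs; have [_ P] := C1D C1c C2s.
have dE : drift_generator (mode_sqr k) eta = 0.
  rewrite /drift_generator.
  under eq_bigr => x _ do rewrite /mode_sqr P P1 P2.
  have [h1 h2] := modes_drift k eta.
  transitivity (2 * mode_cos k eta * drift_generator (mode_cos k) eta +
     2 * mode_sin k eta * drift_generator (mode_sin k) eta); last by rewrite h1 h2; ring.
  rewrite /drift_generator !mulr_sumr -big_split/=; apply: eq_bigr => x _; ring.
have eE : exchange_generator (mode_sqr k) eta =
    2 * mode_cos k eta * exchange_generator (mode_cos k) eta +
    2 * mode_sin k eta * exchange_generator (mode_sin k) eta +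
    2 * (1 - cos (angle k)) / N%:R ^+ 2 * gradient2 eta.
  rewrite /exchange_generator /gradient2 !mulr_sumr -!big_split/=; apply: eq_bigr => x _.
  have A : mode_cos k (swap x (ordS x) eta) = mode_cos k eta +
      (eta ord0 (ordS x) - eta ord0 x) * (dx * ecos k (x%:R / N%:R) - dx * ecos k (x%:R / N%:R + dx)).
    rewrite -(periodic_ordS x (@periodic_ecos _ k)) mode_cosE.
    by rewrite -(linear_form_swap (fun x => dx * ecos k (x%:R / N%:R))); ring.
  have B : mode_sin k (swap x (ordS x) eta) = mode_sin k eta +
      (eta ord0 (ordS x) - eta ord0 x) * (dx * esin k (x%:R / N%:R) - dx * esin k (x%:R / N%:R + dx)).
    rewrite -(periodic_ordS x (@periodic_esin _ k)) mode_sinE.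
    by rewrite -(linear_form_swap (fun x => dx * esin k (x%:R / N%:R))); ring.
  rewrite /mode_sqr A B ecosD_dx esinD_dx.
  have cs1 := cos2Dsin2 (angle k).
  have cs2 : ecos k (x%:R / N%:R) ^+ 2 + esin k (x%:R / N%:R) ^+ 2 = 1 :> R.
    exact: cos2Dsin2.
  move: (eta ord0 (ordS x) - eta ord0 x) (mode_cos k eta) (mode_sin k eta) => e X Y.
  move: cs1 cs2; move: (cos (angle k)) (sin (angle k)) => p q.
  move: (ecos k _) (esin k _) => u v pq uv.
  rewrite /dx.
  (* Exchanging a bond moves the k-th Fourier coefficient by a vector of squared length |1 - exp(i
     theta)|^2 e^2 / N^2, where theta is the angle and p, q are its cosine and sine; the squared
     modulus is 1 - 2 p + (p^2 + q^2) = 2 (1 - p). *)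
  transitivity (2 * X * (X + e * (N%:R^-1 * u - N%:R^-1 * (p * u - q * v)) - X) +
    2 * Y * (Y + e * (N%:R^-1 * v - N%:R^-1 * (p * v + q * u)) - Y) +
    ((1 - 2 * p + (p ^+ 2 + q ^+ 2)) * (u ^+ 2 + v ^+ 2)) / N%:R ^+ 2 * e ^+ 2).
    by field.
  by rewrite pq uv; congr (_ + _); field.
rewrite /generator dE eE /disc_rate; have [-> ->] := modes_exchange k eta.
by rewrite /mode_sqr; field.
Qed.

End generator.

(** * Measurability and bounds of the test functions *)

Section measurable_test_functions.
Context {R : realType} {N : nat}.
Implicit Types (eta zeta : config R N) (x : 'I_N) (k : int).

Lemma measurable_config_coord x : measurable_fun setT (fun z : config R N => z ord0 x).
Proof.
move=> _ B mB; rewrite setTI; apply: sub_sigma_algebra.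
rewrite (bigD1 x)//=; left; exists B => //; by rewrite setTI.
Qed.

Lemma measurable_linear_form (c : 'I_N -> R) : measurable_fun setT (@linear_form R N c).
Proof.
apply: measurable_sum => x; apply: measurable_funM => //; exact: measurable_config_coord.
Qed.

Lemma measurable_energy2 : measurable_fun setT (@energy2 R N).
Proof.
by apply: measurable_sum => x; apply: measurable_funX; exact: measurable_config_coord.
Qed.

Lemma measurable_radial (r0 : R) : measurable_fun setT (@radial R N r0).
Proof.
apply: (measurableT_comp (f := bump r0)); last exact: measurable_energy2.
exact: continuous_measurable_fun (is_derive_continuous (is_derive_bump r0)).
Qed.

Lemma measurable_modes k : measurable_fun setT (@mode_cos R N k) /\
  measurable_fun setT (@mode_sin R N k).
Proof. by rewrite mode_cosE mode_sinE; split; exact: measurable_linear_form. Qed.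

Lemma measurable_mode_sqr k : measurable_fun setT (@mode_sqr R N k).
Proof.
have [mc ms] := measurable_modes k.
by apply: measurable_funD; exact: measurable_funM.
Qed.

Lemma measurable_gradient2 : measurable_fun setT (@gradient2 R N).
Proof.
apply: measurable_sum => x; apply: measurable_funX.
by apply: measurable_funB; exact: measurable_config_coord.
Qed.

Lemma modes_bound k eta : (0 < N)%N ->
  `|mode_cos k eta| <= 1 + energy2 eta /\ `|mode_sin k eta| <= 1 + energy2 eta.
Proof.
move=> N0.
have H (F : R -> R) : (forall u, `|F u| <= 1) -> `|empirical_form eta F| <= 1 + energy2 eta.
  move=> F1; rewrite /empirical_form normrM ger0_norm ?invr_ge0//.
  rewrite ler_pdivrMl ?ltr0n//.
  apply: (le_trans (ler_norm_sum _ _ _)).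
  apply: (@le_trans _ _ (\sum_(x < N) (1 + energy2 eta))).
    apply: ler_sum => x _; rewrite normrM.
    apply: (@le_trans _ _ (`|eta ord0 x| * 1)); first by rewrite ler_wpM2l.
    rewrite mulr1; have := coord_le_energy2 eta x.
    have := sqr_ge0 (`|eta ord0 x| - 1); rewrite -[eta ord0 x ^+ 2]real_normK ?num_real//.
    by have := normr_ge0 (eta ord0 x); nra.
  by rewrite sumr_const card_ord [leRHS]mulr_natl.
by split; apply: H => u; [exact: cos_max|exact: sin_max].
Qed.

Lemma bounded_radial (r0 : R) : bounded_measurable (@radial R N r0).
Proof.
split; first exact: measurable_radial.
by exists 1 => z; have /andP[h0 h1] := bump_bounds r0 (energy2 z); rewrite ger0_norm.
Qed.

(** The cutoff vanishes unless the energy is below r0 + 1, so h has to be bounded on that ball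
    only. *)
Lemma bounded_mul_radial (r0 H : R) (h : config R N -> R) : measurable_fun setT h -> 0 <= H ->
  (forall eta, energy2 eta <= r0 + 1 -> `|h eta| <= H) ->
  bounded_measurable (fun eta => h eta * radial r0 eta).
Proof.
move=> mh H0 hH; split; first by apply: measurable_funM => //; exact: measurable_radial.
exists H => eta; have /andP[b0 b1] := bump_bounds r0 (energy2 eta).
rewrite normrM (ger0_norm b0).
have [E|n0] := eqVneq (bump r0 (energy2 eta)) 0; first by rewrite /radial E mulr0.
have [/ltW s1 _] := bump_supp n0.
by apply: (le_trans (ler_wpM2l (normr_ge0 _) b1)); rewrite mulr1 hH.
Qed.

Lemma bounded_modes k (r0 : R) : (0 < N)%N -> 0 <= r0 ->
  [/\ bounded_measurable (fun z : config R N => mode_cos k z * radial r0 z),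
      bounded_measurable (fun z : config R N => mode_sin k z * radial r0 z) &
      bounded_measurable (fun z : config R N => mode_sqr k z * radial r0 z)].
Proof.
move=> N0 r00; have [mc ms] := measurable_modes k.
have r2 : 0 <= r0 + 2 by lra.
have b (w : config R N) : energy2 w <= r0 + 1 ->
    `|mode_cos k w| <= r0 + 2 /\ `|mode_sin k w| <= r0 + 2.
  by move=> hw; have [c1 s1] := modes_bound k w N0; split; lra.
split.
- by apply: (bounded_mul_radial mc r2) => w /b[].
- by apply: (bounded_mul_radial ms r2) => w /b[].
- have B0 : 0 <= 2 * (r0 + 2) ^+ 2 by rewrite mulr_ge0 ?sqr_ge0.
  apply: (bounded_mul_radial (measurable_mode_sqr k) B0) => w /b[c2 s2].
  apply: (le_trans (ler_normD _ _)); rewrite (normrM (mode_cos k w)) (normrM (mode_sin k w)).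
  have := ler_pM (normr_ge0 _) (normr_ge0 _) c2 c2.
  have := ler_pM (normr_ge0 _) (normr_ge0 _) s2 s2.
  rewrite -!expr2; lra.
Qed.

End measurable_test_functions.

(** * The semigroup on the cut-off modes *)

Section particle_semigroup.
Context {R : realType} {N : nat}.
Variables (alpha kappa : R) (p : R -> R.-pker (config R N) ~> (config R N)).
Hypotheses (N0 : (0 < N)%N) (sp : transition_semigroup p)
  (gp : has_generator p (@generator R alpha kappa N)).
Implicit Types (eta zeta : config R N) (x : 'I_N) (k : int) (f g : config R N -> R) (s t B : R).
Local Notation L := (@generator R alpha kappa N).

Lemma kexp0 f eta : measurable_fun setT f -> kexp (p 0) f eta = f eta.
Proof.
move=> mf; have [p0 _] := sp; rewrite /kexp /Rintegral.
rewrite (eq_measure_integral (\d_eta : measure _ _)); last by move=> A mA _; exact: p0.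
rewrite integral_dirac//; last exact/measurable_EFinP.
by rewrite diracT mul1e.
Qed.

(** The semigroup property writes time s + h as time s followed by time h. The expansion over h is
    uniform in the configuration reached at time s, so it survives integration against [p s], with a
    threshold d independent of s. *)
Lemma semigroup_expansion f (e : R) : C1_compact_support f ->
  bounded_measurable f -> bounded_measurable (L f) -> 0 < e ->
  exists2 d, 0 < d & forall s h eta, 0 <= s -> 0 < h < d ->
    `|kexp (p (s + h)) f eta - kexp (p s) f eta - h * kexp (p s) (L f) eta| <= h * e.
Proof.
move=> Cf bf bL e0.
have := gp Cf e0; rewrite near_withinE => /nbhs_ballP[d d0 Hd].
exists d => // s h eta s0 /andP[h0 hd].
have st zeta : `|kexp (p h) f zeta - f zeta - h * L f zeta| <= h * e.
  have := Hd h; rewrite /ball/= sub0r normrN gtr0_norm// => /(_ hd h0 zeta)/ltW.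
  rewrite -/(kexp (p h) f zeta) => H.
  rewrite (_ : _ - _ = h * (h^-1 * (kexp (p h) f zeta - f zeta) - L f zeta)).
    by rewrite normrM (gtr0_norm h0) ler_wpM2l// ltW.
  by rewrite mulrBr mulrA divff ?gt_eqF// mul1r.
have [_ sg] := sp; have bk := bounded_measurable_kexp (p h) bf.
have [b1 E1] := bounded_measurable_linear (-1) (- h) bf bL.
have [b2 E2] := bounded_measurableD bk b1.
rewrite (kexp_comp (fun A mA => sg s h eta A s0 (ltW h0) mA) bf).
rewrite (_ : _ - _ = kexp (p s) (fun z => kexp (p h) f z + (-1 * f z + - h * L f z)) eta).
  apply: kexp_norm => [|z]; first exact: b2.1.
  by rewrite mulN1r mulNr addrA.
by rewrite E2 E1; ring.
Qed.

Lemma L_cst (a : R) eta : L (fun=> a) eta = 0.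
Proof.
rewrite /generator /exchange_generator /drift_generator big1 => [|x _]; last by rewrite subrr.
rewrite big1 ?mulr0 ?addr0// => x _.
by rewrite (C1_cst a).2 mulr0.
Qed.

(** Conservation of the energy: the cutoff is 1 times itself, and the generator, which factors the
    cutoff out, annihilates the constant 1. *)
Lemma kexp_radial (r0 : R) t eta : 0 <= t -> kexp (p t) (radial r0) eta = radial r0 eta.
Proof.
move=> t0.
have C := C1_compact_support_radial r0 (C1_cst (1 : R)).1 : C1_compact_support (fun eta : config R N => 1 * radial r0 eta).
have E1 : (fun eta : config R N => 1 * radial r0 eta) = radial r0.
  by apply/funext => z; rewrite mul1r.
have L0 : L (radial r0) = fun=> 0.
  apply/funext => z; rewrite -E1 generator_radial; last exact: (C1_cst 1).1.
  by rewrite L_cst mul0r.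
rewrite E1 in C.
have br := @bounded_radial R N r0.
rewrite -[RHS](kexp0 _ br.1).
apply: (@zero_derivative_constant _ (fun t => kexp (p t) (radial r0) eta) t); last by rewrite t0 lexx.
move=> e e0.
have bL : bounded_measurable (L (radial r0)) by rewrite L0; exact: bounded_measurable_cst.
have [d d0 H] := semigroup_expansion C br bL e0.
exists d => // s h s0 hd _; have := H s h eta s0 hd.
by rewrite L0 kexp_cst mulr0 subr0.
Qed.

Lemma disc_rate_ge0 k : 0 <= @disc_rate R N k.
Proof. by rewrite /disc_rate !mulr_ge0// subr_ge0 cos_le1. Qed.

Lemma kexp_modes k (r0 : R) t eta : 0 <= r0 -> 0 <= t ->
  kexp (p t) (fun z => mode_cos k z * radial r0 z) eta =
    decay_cos (@disc_rate R N k) (@disc_drift R N alpha kappa k)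
      (mode_cos k eta * radial r0 eta) (mode_sin k eta * radial r0 eta) t /\
  kexp (p t) (fun z => mode_sin k z * radial r0 z) eta =
    decay_sin (@disc_rate R N k) (@disc_drift R N alpha kappa k)
      (mode_cos k eta * radial r0 eta) (mode_sin k eta * radial r0 eta) t.
Proof.
move=> r00 t0; set a := disc_rate k; set b := disc_drift _ _ k.
have [Cc Cs] := @C1_mode R N k; have [bX bY _] := bounded_modes k N0 r00.
set X := fun z => mode_cos k z * _ in bX *; set Y := fun z => mode_sin k z * _ in bY *.
have LX : L X = fun z => - a * X z + b * Y z.
  apply/funext => z; rewrite generator_radial//.
  by rewrite (modes_generator alpha kappa k z).1 /X /Y /a /b; ring.
have LY : L Y = fun z => - a * Y z + - b * X z.
  apply/funext => z; rewrite generator_radial//.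
  by rewrite (modes_generator alpha kappa k z).2 /X /Y /a /b; ring.
have [bLX EX] := bounded_measurable_linear (- a) b bX bY.
have [bLY EY] := bounded_measurable_linear (- a) (- b) bY bX.
rewrite -LX in bLX; rewrite -LY in bLY.
have CX : C1_compact_support X by exact: C1_compact_support_radial.
have CY : C1_compact_support Y by exact: C1_compact_support_radial.
have X0 : kexp (p 0) X eta = X eta by exact: kexp0 bX.1.
have Y0 : kexp (p 0) Y eta = Y eta by exact: kexp0 bY.1.
have [[mX [B XB]] [mY [B' YB]]] := (bX, bY).
rewrite -/(X eta) -/(Y eta) -X0 -Y0.
apply: (@rotation_ode _ (fun t => kexp (p t) X eta) (fun t => kexp (p t) Y eta) a b (Num.max B B') t); last by rewrite t0 lexx.
- exact: disc_rate_ge0.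
- by move=> s _; rewrite !le_max; split; apply/orP; [left|right]; exact: kexp_norm.
move=> e e0.
have [d1 d10 H1] := semigroup_expansion CX bX bLX e0.
have [d2 d20 H2] := semigroup_expansion CY bY bLY e0.
exists (Num.min d1 d2); first by rewrite lt_min d10.
move=> s h s0 /andP[h0]; rewrite lt_min => /andP[h1 h2] _.
have := H1 s h eta s0; rewrite h0 h1 LX EX => /(_ isT) A1.
have := H2 s h eta s0; rewrite h0 h2 LY EY => /(_ isT) A2.
have E (x y : R) : - a * x - b * y = - a * x + - b * y by ring.
by split => //; rewrite E.
Qed.

(** On the support of the cutoff [gradient2] is at most 4 times the energy, hence at most 4 (r0 +
    1). This bounds the forcing term of the equation for the squared modulus, and [gronwall_step]
    with rate 2 a concludes. *)
Lemma kexp_mode_sqr k (r0 : R) t eta : 0 <= r0 -> 0 <= t ->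
  kexp (p t) (fun z => mode_sqr k z * radial r0 z) eta <=
  expR (- (2 * @disc_rate R N k) * t) * (mode_sqr k eta * radial r0 eta) +
  t * (4 * @disc_rate R N k * (r0 + 1) / N%:R ^+ 2).
Proof.
move=> r00 t0; set a := disc_rate k.
have a0 : 0 <= a by exact: disc_rate_ge0.
have N20 : 0 < N%:R ^+ 2 :> R by rewrite exprn_gt0// ltr0n.
have [_ _ bQ] := bounded_modes k N0 r00; set Q := (X in bounded_measurable X) in bQ *.
have Q0 z : 0 <= Q z.
  rewrite /Q mulr_ge0//; last by have /andP[] := bump_bounds r0 (energy2 z).
  by rewrite /mode_sqr -!expr2 addr_ge0 ?sqr_ge0.
have r4 : 0 <= 4 * (r0 + 1) by lra.
have gB (w : config R N) : energy2 w <= r0 + 1 -> gradient2 w <= 4 * (r0 + 1).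
  move=> hw; have /andP[_ g1] := gradient2_bounds w.
  by apply: (le_trans g1); rewrite ler_wpM2l.
pose G := fun z : config R N => gradient2 z * radial r0 z.
have bG : bounded_measurable G.
  apply: (bounded_mul_radial (@measurable_gradient2 R N) r4) => w hw.
  by have /andP[g0 _] := gradient2_bounds w; rewrite ger0_norm ?gB.
have GB z : G z <= 4 * (r0 + 1).
  have /andP[b0 b1] := bump_bounds r0 (energy2 z).
  have [E|n0] := eqVneq (bump r0 (energy2 z)) 0; first by rewrite /G /radial E mulr0.
  have [/ltW/gB h _] := bump_supp n0; have /andP[g0 _] := gradient2_bounds z.
  by rewrite -[leRHS]mulr1; exact: ler_pM.
have LQ : L Q = fun z => - (2 * a) * Q z + a / N%:R ^+ 2 * G z.
  apply/funext => z; rewrite generator_radial; last exact: C1_mode_sqr.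
  by rewrite mode_sqr_generator// /Q /G -/a; ring.
have [bLQ EQ] := bounded_measurable_linear (- (2 * a)) (a / N%:R ^+ 2) bQ bG.
rewrite -LQ in bLQ.
have aN0 : 0 <= a / N%:R ^+ 2 by rewrite divr_ge0// ltW.
have CQ : C1_compact_support Q by apply: C1_compact_support_radial; exact: C1_mode_sqr.
set K := 4 * a * (r0 + 1) / N%:R ^+ 2.
have K0 : 0 <= K by rewrite /K divr_ge0 ?(ltW N20)// !mulr_ge0//; lra.
rewrite -/(Q eta) -[Q eta](kexp0 _ bQ.1).
apply: (@gronwall_step _ (fun t => kexp (p t) Q eta) (2 * a) K) => //.
- by rewrite mulr_ge0.
- by move=> s s0; apply: Rintegral_ge0 => z _; exact: Q0.
move=> e e0.
have [d d0 H] := semigroup_expansion CQ bQ bLQ e0.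
exists d => // s h s0 hd; have := H s h eta s0 hd; have /andP[h0 _] := hd.
have LE : kexp (p s) (L Q) eta <= - (2 * a) * kexp (p s) Q eta + K.
  rewrite LQ EQ lerD2l (_ : K = a / N%:R ^+ 2 * (4 * (r0 + 1))); last by rewrite /K; ring.
  rewrite ler_wpM2l// -[leRHS](kexp_cst (p s) _ eta).
  by apply: kexp_le => //; exact: bounded_measurable_cst.
rewrite ler_norml => /andP[_ H1].
have := ler_wpM2l (ltW h0) LE; lra.
Qed.

End particle_semigroup.

(** * Energy conservation and concentration of the modes under the kernel *)

Section particle_kernel_bounds.
Context {R : realType} {N : nat}.
Variables (alpha kappa : R) (p : R -> R.-pker (config R N) ~> (config R N)).
Hypotheses (N0 : (0 < N)%N) (sp : transition_semigroup p)
  (gp : has_generator p (@generator R alpha kappa N)).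
Implicit Types (eta zeta : config R N) (k : int) (t : R).

(** One minus the cutoff centred at the starting energy equals 1 on this set, and its expectation
    keeps its initial value 0. *)
Lemma kernel_energy eta t : 0 <= t ->
  p t eta [set zeta | energy2 eta + 1 <= energy2 zeta] = 0%E.
Proof.
move=> t0; apply/eqP; rewrite eq_le measure_ge0 andbT.
have br := @bounded_radial R N (energy2 eta).
have [b1 e1] := bounded_measurableZ (-1) br.
have [b2 e2] := bounded_measurableD (bounded_measurable_cst 1) b1.
apply: (le_trans (kernel_set_le (p t) eta _ b2 _ _)).
- by apply: measurable_superlevel; exact: measurable_energy2.
- by move=> z; have /andP[_ h] := bump_bounds (energy2 eta) (energy2 z); rewrite mulN1r subr_ge0.
- move=> z /= hz; have [E|/bump_supp[/lt_le_trans/(_ hz)]] := eqVneq (bump (energy2 eta) (energy2 z)) 0.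
    by rewrite /radial E mulr0 addr0.
  by rewrite ltxx.
by rewrite e2 kexp_cst e1 (kexp_radial sp gp)// /radial bump_center mulr1 subrr.
Qed.

(** Chebyshev's inequality for both modes at once. Centring the cutoff at the energy of [eta] makes
    it 1 at the start, so the formulas for cut-off modes hold with the bare values of the modes of
    [eta]. *)
Lemma kernel_modes k eta t (dl : R) : 0 <= t -> 0 < dl ->
  let a := @disc_rate R N k in let b := @disc_drift R N alpha kappa k in
  let zc := decay_cos a b (mode_cos k eta) (mode_sin k eta) t in
  let zs := decay_sin a b (mode_cos k eta) (mode_sin k eta) t in
  let K := t * (4 * a * (energy2 eta + 1) / N%:R ^+ 2) / dl ^+ 2 in
  (p t eta [set zeta | (dl <= `|mode_cos k zeta - zc|)%R] <= K%:E)%E /\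
  (p t eta [set zeta | (dl <= `|mode_sin k zeta - zs|)%R] <= K%:E)%E.
Proof.
move=> t0 dl0 a b zc zs K; set r0 := energy2 eta in K *.
have r00 : 0 <= r0 by exact: energy2_ge0.
have [mc ms] := @measurable_modes R N k.
have br := @bounded_radial R N r0; have [bX bY bQ] := bounded_modes k N0 r00.
(* Markov's inequality for g below, which is 1 off the cutoff and the squared
   deviation of the modes over dl ^+ 2 on it. *)
pose D := (dl ^+ 2)^-1.
have dl20 : 0 < dl ^+ 2 by rewrite exprn_gt0.
have D0 : 0 < D by rewrite invr_gt0.
have [b1 e1] := bounded_measurableZ (D * (zc ^+ 2 + zs ^+ 2) - 1) br.
have [b2 e2] := bounded_measurableZ D bQ.
have [b3 e3] := bounded_measurableZ (- (2 * D * zc)) bX.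
have [b4 e4] := bounded_measurableZ (- (2 * D * zs)) bY.
have [b5 e5] := bounded_measurableD (bounded_measurable_cst 1) b1.
have [b6 e6] := bounded_measurableD b5 b2.
have [b7 e7] := bounded_measurableD b6 b3.
have [b8 e8] := bounded_measurableD b7 b4.
move: b8 e8; set g := (fun z => _ + _) => b8 e8.
have gE z : g z = (1 - radial r0 z) + radial r0 z *
    (((mode_cos k z - zc) ^+ 2 + (mode_sin k z - zs) ^+ 2) * D).
  by rewrite /g /mode_sqr; ring.
have kg : kexp (p t) g eta <= K.
  rewrite e8 e7 e6 e5 e4 e3 e2 e1 kexp_cst (kexp_radial sp gp r0 eta t0).
  have [-> ->] := kexp_modes N0 sp gp k eta r00 t0.
  have c1 : radial r0 eta = 1 by exact: bump_center.
  rewrite c1 !mulr1 -/a -/b -/zc -/zs.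
  have := kexp_mode_sqr N0 sp gp k eta r00 t0; rewrite c1 mulr1 -/a => H.
  (* The squared modulus of the predicted point equals the leading term of the second moment bound,
     because the squared modulus decays at exactly twice the rate of the modes. The variance is thus
     reduced to the forcing term. *)
  have E : expR (- (2 * a) * t) * mode_sqr k eta = zc ^+ 2 + zs ^+ 2.
    rewrite decay_sqr /mode_sqr -!expr2; congr (_ * _).
    by rewrite expr2 -expRD; congr expR; ring.
  rewrite E in H; have := ler_wpM2l (ltW D0) H.
  have -> : K = D * (t * (4 * a * (r0 + 1) / N%:R ^+ 2)) by rewrite /K /D mulrC.
  set Z := kexp _ _ _; lra.
have g0 z : 0 <= g z.
  have /andP[h0 h1] := bump_bounds r0 (energy2 z).
  rewrite gE addr_ge0 ?subr_ge0// mulr_ge0// mulr_ge0 ?(ltW D0)//.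
  by rewrite addr_ge0 ?sqr_ge0.
have g1 z : dl ^+ 2 <= (mode_cos k z - zc) ^+ 2 + (mode_sin k z - zs) ^+ 2 -> 1 <= g z.
  move=> hz; have /andP[h0 h1] := bump_bounds r0 (energy2 z).
  have := ler_wpM2r (ltW D0) hz; rewrite {1}/D divff ?gt_eqF// => /(ler_wpM2l h0).
  rewrite gE -/(radial r0 z); lra.
split; apply: (le_trans (kernel_set_le (p t) eta _ b8 g0 _)); rewrite ?lee_fin//.
- apply: (@measurable_superlevel _ _ _ (fun z => `|mode_cos k z - zc|)).
  by apply: measurableT_comp => //; exact: measurable_funB.
- move=> z /= hz; apply: g1;
  rewrite -[leLHS]addr0 lerD ?sqr_ge0// -[leRHS]real_normK ?num_real// ler_sqr ?nnegrE// ltW//.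
- apply: (@measurable_superlevel _ _ _ (fun z => `|mode_sin k z - zs|)).
  by apply: measurableT_comp => //; exact: measurable_funB.
- move=> z /= hz; apply: g1.
  rewrite -[leLHS]add0r lerD ?sqr_ge0// -[leRHS]real_normK ?num_real// ler_sqr ?nnegrE// ltW//.
Qed.

End particle_kernel_bounds.

(** * Pairing of the empirical measure with continuous functions *)

Section empirical_pairing.
Context {R : realType}.
Local Notation finite_meas :=
  {finite_measure set (measurableTypeR R) -> \bar R}.

(** Each pair lists the mass and the position of an atom; the measure is built by adding one Dirac
    mass at a time. *)
Lemma finite_atomic_measure (r : seq (R * R)) :
  (forall z, z \in r -> 0 <= z.1 /\ 0 <= z.2 < 1) ->
  exists nu : finite_meas, forall f : R -> R, measurable_fun setT f -> (forall u, 0 <= f u) ->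
    (\int[nu]_(u in `[0%R, 1%R[) (f u)%:E = (\sum_(z <- r) z.1 * f z.2)%:E)%E.
Proof.
elim: r => [|z r IH] rP.
  exists mzero => f mf f0.
  by rewrite integral_measure_zero big_nil.
have [nu Hnu] : exists nu : finite_meas, forall f : R -> R, measurable_fun setT f -> (forall u, 0 <= f u) ->
    (\int[nu]_(u in `[0%R, 1%R[) (f u)%:E = (\sum_(z <- r) z.1 * f z.2)%:E)%E.
  by apply: IH => y yr; apply: rP; rewrite inE yr orbT.
have [z1 z2] := rP z (mem_head _ _).
pose m1 : finite_meas := mscale (NngNum z1) (\d_(z.2 : measurableTypeR R)).
have fin : fin_num_fun (measure_add m1 nu).
  by move=> A mA; rewrite measure_addE fin_numD !fin_num_measure.
pose m2 (n : nat) : {measure set (measurableTypeR R) -> \bar R} :=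
  if n is 0%N then (m1 : {measure set _ -> \bar R}) else nu.
pose F := Measure_isFinite.Build _ _ _ (msum m2 2) fin.
pose nu' : finite_meas := HB.pack (msum m2 2) F.
exists nu' => f mf f0.
have mfE : measurable_fun (`[0%R, 1%R[%classic : set (measurableTypeR R)) (EFin \o f).
  by apply/measurable_EFinP; exact: measurable_funTS.
transitivity (\int[measure_add m1 nu]_(u in `[0%R, 1%R[) (f u)%:E)%E; first by [].
rewrite ge0_integral_measure_add//.
rewrite Hnu// big_cons EFinD; congr (_ + _)%E.
rewrite ge0_integral_mscale//; last by move=> u _; rewrite lee_fin.
rewrite EFinM; congr (_ * _)%E.
apply: (etrans (integral_dirac _ _ mfE)) => //.
by rewrite diracE mem_set ?mul1e//= in_itv/=.
by move=> u _; rewrite lee_fin.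
Qed.


Section finite_measure_integral.
Variable nu : finite_meas.
Local Notation I := (`[0%R, 1%R[%classic : set (measurableTypeR R)).

Let mI : measurable I. Proof. exact: measurable_itv. Qed.

Lemma bounded_integrable (f : R -> R) B : measurable_fun setT f -> (forall u, `|f u| <= B) ->
  nu.-integrable I (EFin \o f).
Proof.
move=> mf fB; apply: measurable_bounded_integrable => //.
- by rewrite ltey_eq fin_num_measure.
- exact: measurable_funTS.
- exists B; split; first exact: num_real.
  by move=> x Bx u _; exact: le_trans (fB u) (ltW Bx).
Qed.

Lemma bounded_integral_close (f g : R -> R) B e : measurable_fun setT f -> measurable_fun setT g ->
  (forall u, `|f u| <= B) -> (forall u, `|f u - g u| <= e) ->
  `|\int[nu]_(u in I) f u - \int[nu]_(u in I) g u| <= e * fine (nu I).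
Proof.
move=> mf mg fB fg.
have gB u : `|g u| <= B + e.
  by rewrite (_ : g u = f u - (f u - g u)); [exact: le_trans (ler_normB _ _) (lerD _ _)|ring].
rewrite -RintegralB//; [|exact: bounded_integrable fB|exact: bounded_integrable gB].
have mfg : measurable_fun setT (fun u => f u - g u) by exact: measurable_funB.
have ifg := bounded_integrable mfg fg.
apply: le_trans (le_normr_Rintegral mI ifg) _.
rewrite -Rintegral_cst//; apply: le_Rintegral => //.
- have mn : measurable_fun setT (fun u => `|f u - g u|) by exact: measurableT_comp.
  by apply: (@bounded_integrable _ e) => // u; rewrite normr_id.
- exact: finite_measure_integrable_cst.
Qed.

End finite_measure_integral.

(** Adding the bound B makes f nonnegative; the integral of the constant is then subtracted. *)
Lemma atomic_integral (r : seq (R * R)) :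
  (forall z, z \in r -> 0 <= z.1 /\ 0 <= z.2 < 1) ->
  exists nu : finite_meas, forall (f : R -> R) B, measurable_fun setT f -> (forall u, `|f u| <= B) ->
    \int[nu]_(u in `[0, 1[) f u = \sum_(z <- r) z.1 * f z.2.
Proof.
move=> rP; have [nu Hnu] := finite_atomic_measure rP; exists nu => f B mf fB.
have H (g : R -> R) : measurable_fun setT g -> (forall u, 0 <= g u) ->
    \int[nu]_(u in `[0, 1[) g u = \sum_(z <- r) z.1 * g z.2.
  by move=> mg g0; rewrite /Rintegral Hnu.
have B0 : 0 <= B by exact: le_trans (normr_ge0 _) (fB 0).
have mfB : measurable_fun setT (fun u => f u + B) by exact: measurable_funD.
have fB' u : `|f u + B| <= B + B.
  by apply: le_trans (ler_normD _ _) _; rewrite (ger0_norm B0) lerD2r.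
have -> : \int[nu]_(u in `[0, 1[) f u = \int[nu]_(u in `[0, 1[) (f u + B - B).
  by congr Rintegral; apply/funext => u; rewrite addrK.
rewrite RintegralB//; last 2 first.
- exact: bounded_integrable mfB fB'.
- exact: finite_measure_integrable_cst.
rewrite !H//; last first.
  by move=> u; have := fB u; rewrite ler_norml => /andP[]; rewrite -lerBlDr sub0r.
rewrite -sumrB; apply: eq_bigr => z _; ring.
Qed.

(** The pairing is a choice from a relation, so existence and uniqueness of the value are both
    needed. Existence: the positive and negative parts of the configuration give two atomic
    measures. Uniqueness: any representing pair agrees with the empirical form on smooth functions,
    in particular on Fejer means, which converge uniformly to G while all masses are finite. *)
Lemma dual_pairing_empirical m (m0 : (0 < m)%N) N (eta : config R N) G : (0 < N)%N ->
  periodic1 G -> continuous G ->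
  dual_pairing (empirical_dual m0 eta) G = empirical_form eta G.
Proof.
move=> N0 pG cG; have N0' : 0 < N%:R :> R by rewrite ltr0n.
have [B GB] := periodic_bounded pG cG.
have mcont (f : R -> R) : continuous f -> measurable_fun setT f.
  by move=> cf; apply: continuous_measurable_fun; exact: cf.
rewrite /dual_pairing; set S := (X in xget _ X).
suff [S1 S2] : S !=set0 /\ forall r, S r -> r = empirical_form eta G.
  by apply: S2; case: S1 => r Sr; exact: (xgetPex 0 (ex_intro _ r Sr)).
split.
  pose pts (w : 'I_N -> R) : seq (R * R) := [seq (w x, x%:R / N%:R) | x <- index_enum 'I_N].
  have ptsP (w : 'I_N -> R) : (forall x, 0 <= w x) ->
      forall z, z \in pts w -> 0 <= z.1 /\ 0 <= z.2 < 1.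
    move=> w0 z /mapP[x _ ->] /=; split => //.
    by rewrite divr_ge0//= ltr_pdivrMr// mul1r ltr_nat.
  have N1 : 0 <= N%:R^-1 :> R by rewrite invr_ge0.
  have max0 (y : R) : 0 <= Num.max y 0 by rewrite le_max lexx orbT.
  have [nu1 H1] := atomic_integral (ptsP (fun x => N%:R^-1 * Num.max (eta ord0 x) 0)
    (fun x => mulr_ge0 N1 (max0 _))).
  have [nu2 H2] := atomic_integral (ptsP (fun x => N%:R^-1 * Num.max (- eta ord0 x) 0)
    (fun x => mulr_ge0 N1 (max0 _))).
  have H (f : R -> R) C : measurable_fun setT f -> (forall u, `|f u| <= C) ->
      signed_integral nu1 nu2 f = empirical_form eta f.
    move=> mf fC; rewrite /signed_integral (H1 _ _ mf fC) (H2 _ _ mf fC) !big_map -sumrB.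
    rewrite /empirical_form mulr_sumr; apply: eq_bigr => x _ /=.
    rewrite -mulrBl -mulrBr mulrA; congr (_ * _ * _).
    have E (y : R) : Num.max y 0 - Num.max (- y) 0 = y.
      by rewrite /Num.max; case: (ltP y 0) => h1; case: (ltP (- y) 0) => h2; lra.
    exact: E.
  exists (signed_integral nu1 nu2 G), nu1, nu2; split=> // f.
  have [C fC] := periodic_bounded (smooth_valP f).1 (smooth_cont (smooth_valP f)).
  by rewrite (H f C)//; apply: mcont; exact: smooth_cont (smooth_valP f).
move=> r [nu1 [nu2 [Hl ->]]]; apply/eqP; rewrite -subr_eq0 -normr_le0.
apply/ler_addgt0Pr => e e0; rewrite add0r.
(* The total mass against which the uniform error is integrated: two measures and the empirical
   form. The error is divided by 1 + A, which cannot vanish. *)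
pose A := fine (nu1 `[0, 1[%classic) + fine (nu2 `[0, 1[%classic)
  + N%:R^-1 * \sum_(x < N) `|eta ord0 x|.
have A0 : 0 <= A.
  by rewrite !addr_ge0 ?fine_ge0// mulr_ge0 ?invr_ge0// sumr_ge0.
have e'0 : 0 < e / (1 + A) by rewrite divr_gt0// ltr_wpDr.
have [n0 /(_ n0.+1) Hn] := fejer_cvg pG cG e'0.
set p := fejer n0.+1 G in Hn.
have sp : smooth p by apply: trigpoly_smooth; exact: trigpoly_fejer.
have mG := mcont _ cG; have mp := mcont _ (smooth_cont sp).
have Gp u : `|G u - p u| <= e / (1 + A) by rewrite distrC; exact: Hn.
have h1 := bounded_integral_close nu1 mG mp GB Gp.
have h2 := bounded_integral_close nu2 mG mp GB Gp.
have h3 : `|empirical_form eta p - empirical_form eta G| <=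
    e / (1 + A) * (N%:R^-1 * \sum_(x < N) `|eta ord0 x|).
  rewrite /empirical_form -mulrBr -sumrB normrM ger0_norm ?invr_ge0//.
  rewrite [leRHS]mulrCA ler_wpM2l ?invr_ge0// mulr_sumr.
  apply: le_trans (ler_norm_sum _ _ _) _; apply: ler_sum => x _.
  by rewrite -mulrBr normrM mulrC ler_wpM2r// Hn.
have := Hl (SmoothCircle sp); rewrite /= => Ep.
have -> : signed_integral nu1 nu2 G - empirical_form eta G =
  (\int[nu1]_(u in `[0, 1[) G u - \int[nu1]_(u in `[0, 1[) p u)
  - (\int[nu2]_(u in `[0, 1[) G u - \int[nu2]_(u in `[0, 1[) p u)
  + (empirical_form eta p - empirical_form eta G).
  by rewrite Ep /signed_integral; ring.
apply: le_trans (ler_normD _ _) _.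
apply: le_trans (lerD (ler_normB _ _) (lexx _)) _.
apply: le_trans (lerD (lerD h1 h2) h3) _.
rewrite -!mulrDr -/A mulrAC ler_pdivrMr ?ltr_wpDr//.
by rewrite ler_pM2l//; lra.
Qed.

End empirical_pairing.

(** * From kernel bounds to probabilities of events of the process *)

Section markov_events.
Context {R : realType} {d : measure_display} {W : measurableType d} {N : nat}.
Variables (P : probability W R) (eta : W -> cadlag (config R N)).
Variable mu : probability (config R N) R.

Hypothesis meta : forall t, 0 <= t -> measurable_fun setT (fun w => eta w t).

Lemma measurable_event t (B : set (config R N)) : 0 <= t -> measurable B ->
  measurable [set w | B (eta w t)].
Proof. by move=> t0 mB; have := meta t0 measurableT mB; rewrite setTI. Qed.

Hypothesis init : forall B, measurable B -> P [set w | B (eta w 0)] = mu B.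

(** The Markov property between times 0 and t handles initial configurations in A; the others cost
    at most their initial probability. *)
Lemma event_bound p t (A B : set (config R N)) (c : R) : 0 <= t ->
  markov_property P eta p -> measurable A -> measurable B -> 0 <= c ->
  (forall z, A z -> p t z B <= c%:E)%E ->
  (P [set w | B (eta w t)] <= mu (~` A) + c%:E)%E.
Proof.
move=> t0 mp mA mB c0 AB.
pose A0 := [set w | A (eta w 0)]; pose Bt := [set w | B (eta w t)].
have mA0 : measurable A0 by exact: measurable_event.
have mBt : measurable Bt by exact: measurable_event.
have mnA0 : measurable (~` A0) by exact: measurableC.
have H1 : (P (A0 `&` Bt) <= c%:E)%E.
  rewrite (mp 0 t A0 B) ?lexx//; last first.
    apply: sub_sigma_algebra; exists 0, A; split=> //; rewrite lexx//.
  rewrite subr0.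
  apply: (@le_trans _ _ (\int[P]_(w in A0) (cst c%:E w))%E).
    apply: ge0_le_integral => //.
    - apply: measurable_funTS.
      apply: (measurableT_comp (measurable_kernel (p t) _ mB)); exact: meta.
    - by move=> w Aw; exact: AB.
  rewrite integral_cst//= -[leRHS]mule1 lee_pmul// ?measure_ge0//.
  exact: probability_le1.
have H2 : (P (~` A0) = mu (~` A))%E by rewrite -(init (measurableC mA)).
have : (P Bt <= P (A0 `&` Bt `|` ~` A0))%E.
  apply: le_measure; rewrite ?inE//; first by apply: measurableU => //; exact: measurableI.
  by move=> w Bw; have [Aw|nA] := pselect (A0 w); [left|right].
move=> /le_trans; apply.
have mI : measurable (A0 `&` Bt) by exact: measurableI.
apply: (le_trans (measureU2 P mI mnA0)).
by rewrite addeC; apply: leeD => //; rewrite -H2.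
Qed.

End markov_events.

Section mode_events.
Context {R : realType} {d : measure_display} {W : measurableType d} {N : nat}.
Variables (P : probability W R) (eta : W -> cadlag (config R N)).
Variable mu : probability (config R N) R.
Variables alpha kappa : R.
Hypotheses (N0 : (0 < N)%N)
  (heta : is_markov_process P eta mu (@generator R alpha kappa N)).

(** From an energy at most K the level K + 1 is reached with probability zero, so only a large
    initial energy contributes. *)
Lemma energy_event (K : R) t : 0 <= t ->
  (P [set w | (K + 1 <= energy2 (eta w t))%R] <= mu [set z | (K < energy2 z)%R])%E.
Proof.
move=> t0; have [meta init [p [sp gp mp]]] := heta.
have mE := @measurable_energy2 R N.
have mK : measurable [set z : config R N | K < energy2 z].
  by apply: measurable_strict_superlevel.
rewrite -[leRHS]adde0 -[X in (_ <= mu X + _)%E]setCK.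
have mB : measurable [set z : config R N | (K + 1 <= energy2 z)%R] by exact: measurable_superlevel.
apply: (@event_bound _ _ _ _ P eta mu meta init p t _ [set z : config R N | (K + 1 <= energy2 z)%R]) => //.
  exact: measurableC.
move=> z /= /negP; rewrite -leNgt => zK.
rewrite -[leRHS]/(0%E : \bar R) -(kernel_energy sp gp z t0).
apply: le_measure; rewrite ?inE//; first exact: measurable_superlevel.
by move=> y /=; apply: le_trans; rewrite lerD2r.
Qed.

(** Three initial events are excluded: large energy and a deviation above [rho] of either mode.
    Outside them the flow of the actual modes stays within [2 * rho] of the flow of (xc, xs), and
    [kernel_modes] bounds the remaining deviation [dl]. *)
Lemma mode_event k (K rho dl xc xs t : R) : 0 <= t -> 0 < dl -> 0 <= K -> 0 <= rho ->
  let a := @disc_rate R N k in let b := @disc_drift R N alpha kappa k in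
  let c := t * (4 * a * (K + 1) / N%:R ^+ 2) / dl ^+ 2 in
  let m := (mu [set z | (K < energy2 z)%R] + mu [set z | (rho < `|mode_cos k z - xc|)%R] +
            mu [set z | (rho < `|mode_sin k z - xs|)%R] + c%:E)%E in
  (P [set w | (dl + 2 * rho <= `|mode_cos k (eta w t) - decay_cos a b xc xs t|)%R] <= m)%E /\
  (P [set w | (dl + 2 * rho <= `|mode_sin k (eta w t) - decay_sin a b xc xs t|)%R] <= m)%E.
Proof.
move=> t0 dl0 K0 rho0 a b c.
have a0 : 0 <= a by exact: disc_rate_ge0.
have c0 : 0 <= c.
  by rewrite /c divr_ge0 ?sqr_ge0// mulr_ge0// divr_ge0 ?sqr_ge0// !mulr_ge0// addr_ge0.
have [meta init [p [sp gp mp]]] := heta.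
have [mc ms] := @measurable_modes R N k.
have mE := @measurable_energy2 R N.
have mdist (f : config R N -> R) (y : R) : measurable_fun setT f ->
    measurable_fun setT (fun z => `|f z - y|).
  by move=> mf; apply: measurableT_comp => //; apply: measurable_funB.
pose A1 := [set z : config R N | K < energy2 z].
pose A2 := [set z : config R N | rho < `|mode_cos k z - xc|].
pose A3 := [set z : config R N | rho < `|mode_sin k z - xs|].
have mA1 : measurable A1 by exact: measurable_strict_superlevel.
have mA2 : measurable A2 by apply: measurable_strict_superlevel; exact: mdist.
have mA3 : measurable A3 by apply: measurable_strict_superlevel; exact: mdist.
have mA12 : measurable (A1 `|` A2) by exact: measurableU.
have mA : measurable (~` (A1 `|` A2 `|` A3)) by apply: measurableC; exact: measurableU.
have Amu : (mu (A1 `|` A2 `|` A3) <= mu A1 + mu A2 + mu A3)%E.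
  apply: le_trans (measureU2 _ mA12 mA3) _.
  by rewrite leeD2r//; apply: (measureU2 _ mA1 mA2).
have cA z : (~` (A1 `|` A2 `|` A3)) z ->
   [/\ energy2 z <= K, `|mode_cos k z - xc| <= rho & `|mode_sin k z - xs| <= rho].
  rewrite !setCU => -[[/= /negP h1 /negP h2] /negP h3].
  by rewrite !leNgt.
have H (f : config R N -> R) (g : R) : measurable_fun setT f ->
    (forall z, (~` (A1 `|` A2 `|` A3)) z -> (p t z [set y | (dl + 2 * rho <= `|f y - g|)%R] <= c%:E)%E) ->
    (P [set w | (dl + 2 * rho <= `|f (eta w t) - g|)%R] <= mu A1 + mu A2 + mu A3 + c%:E)%E.
  move=> mf Hp.
  have mB : measurable [set y | (dl + 2 * rho <= `|f y - g|)%R].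
    by apply: measurable_superlevel; exact: mdist.
  apply: le_trans (event_bound meta init t0 mp mA mB c0 Hp) _.
  by rewrite setCK leeD2r.
have Kz z : energy2 z <= K -> t * (4 * a * (energy2 z + 1) / N%:R ^+ 2) / dl ^+ 2 <= c.
  move=> zK; rewrite /c ler_wpM2r ?invr_ge0 ?sqr_ge0// ler_wpM2l//.
  rewrite ler_wpM2r ?invr_ge0 ?sqr_ge0// ler_wpM2l ?mulr_ge0// lerD2r//.
have step z (f : config R N -> R) (g g' : R) : measurable_fun setT f -> energy2 z <= K ->
    `|g' - g| <= 2 * rho ->
    (p t z [set y | (dl <= `|f y - g'|)%R] <= (t * (4 * a * (energy2 z + 1) / N%:R ^+ 2) / dl ^+ 2)%:E)%E ->
    (p t z [set y | (dl + 2 * rho <= `|f y - g|)%R] <= c%:E)%E.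
  move=> mf zK gg; have := Kz _ z zK; rewrite -lee_fin => h1 h2.
  apply: le_trans (le_trans h2 h1); apply: le_measure; rewrite ?inE.
  - by apply: measurable_superlevel; exact: mdist.
  - by apply: measurable_superlevel; exact: mdist.
  move=> y /= hy.
  have := ler_distD g' (f y) g; lra.
split; apply: H => // z /cA[zK zc zs];
  have [l1 l2] := decay_lipschitz b a0 t0 zc zs;
  have [k1 k2] := kernel_modes N0 sp gp k z t0 dl0.
- exact: step k1.
- exact: step k2.
Qed.

End mode_events.

(** * The initial energy is of order N *)

Section initial_energy.
Context {R : realType}.

Lemma limn_esup_lt_near (u : (\bar R)^nat) (c : \bar R) : (limn_esup u < c)%E ->
  \forall n \near \oo, (u n < c)%E.
Proof.
move=> /ereal_inf_lt[_ [V nV <-] Vc]; apply: filterS nV => n Vn.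
by apply: le_lt_trans Vc; apply: ereal_sup_ubound; exists n.
Qed.

Lemma markov_energy N (mu : probability (config R N) R) (M K : R) : (0 < N)%N -> 0 < K ->
  (forall x, (second_moment mu x <= M%:E)%E) ->
  (mu [set z | (K * N%:R < energy2 z)%R] <= (M / K)%:E)%E.
Proof.
move=> N0 K0 hM; have N0' : 0 < N%:R :> R by rewrite ltr0n.
set A := [set z | _].
have mE := @measurable_energy2 R N.
have mA : measurable A by exact: measurable_strict_superlevel.
have mEE : measurable_fun setT (EFin \o @energy2 R N) by exact/measurable_EFinP.
have h1 : ((K * N%:R)%:E * mu A <= \int[mu]_z (energy2 z)%:E)%E.
  rewrite -(integral_cst mu mA).
  apply: (@le_trans _ _ (\int[mu]_(z in A) (energy2 z)%:E)%E).
    apply: ge0_le_integral => //.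
    - by move=> z _; rewrite lee_fin mulr_ge0// ltW.
    - exact: measurable_funTS mEE.
    - by move=> z /= /ltW; rewrite lee_fin.
  by apply: ge0_subset_integral => // z _; rewrite lee_fin energy2_ge0.
have h2 : (\int[mu]_z (energy2 z)%:E <= (M * N%:R)%:E)%E.
  under eq_integral => z _ do rewrite /energy2 -sumEFin.
  rewrite ge0_integral_sum//; last 2 first.
  - by move=> x; apply/measurable_EFinP; apply: measurable_funX; exact: measurable_config_coord.
  - by move=> x z _; rewrite lee_fin sqr_ge0.
  apply: (@le_trans _ _ (\sum_(x < N) M%:E)%E).
    by apply: lee_sum => x _; exact: hM.
  by rewrite sumEFin sumr_const card_ord mulr_natr.
have h3 := le_trans h1 h2.
have mf : mu A \is a fin_num by exact: fin_num_measure.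
move: h3; rewrite -(fineK mf) -EFinM !lee_fin => h3.
rewrite ler_pdivlMr// -(ler_pM2r N0'); apply: le_trans h3.
by rewrite -mulrA mulrC.
Qed.

(** The limit superior is at most C, so C + 1 bounds the second moments for all large N. The rank of
    N does not depend on K, which may thus be chosen afterwards from the target probability. *)
Lemma initial_energy_tail (mu : forall N, probability (config R N) R) : assumption_IM mu ->
  exists2 C : R, 0 < C & \forall N \near \oo, forall K, 0 < K ->
    (mu N [set z | (K * N%:R < energy2 z)%R] <= (C / K)%:E)%E.
Proof.
move=> [C C0 [_ _ hC _]]; exists (C + 1); first by rewrite addr_gt0.
have hC' : (limn_esup (fun N => \big[maxe/0%E]_(x < N)
        maxe `|second_moment (mu N) x|%E
             `|discrete_grad (second_moment (mu N)) x|%E) < (C + 1)%:E)%E.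
  by apply: le_lt_trans hC _; rewrite lte_fin ltrDl.
near=> N => K K0; apply: markov_energy => // [|x]; first by near: N; exact: nbhs_infty_gt.
have H : (\big[maxe/0%E]_(x < N) maxe `|second_moment (mu N) x|%E
             `|discrete_grad (second_moment (mu N)) x|%E < (C + 1)%:E)%E.
  by near: N; exact: limn_esup_lt_near.
apply: ltW; apply: le_lt_trans H; apply: le_trans (lee_abs _) _.
apply: le_trans (le_bigmax _ _ x) => /=.
by rewrite le_max lexx.
Unshelve. all: by end_near.
Qed.

End initial_energy.

(** * Limits of the discrete rate and drift *)

Section discrete_limits.
Context {R : realType}.

Lemma natr_sin_cvg (f : R) : (fun N => N%:R * sin (f * N%:R^-1)) @ \oo --> f.
Proof.
apply/cvgrPdist_le => e e0.
have D : is_derive (0 : R) 1 (fun x : R => sin (f * x)) f.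
  have h : is_derive (f * 0) 1 (@sin R) (cos (f * 0)) by exact: is_derive_sin.
  have l : is_derive (0 : R) 1 (fun x : R => f * x) f.
    have : is_derive (0 : R) 1 ( *%R f : R -> R) (f *: (1 : R)) by exact: is_deriveZ.
    by rewrite /GRing.scale/= mulr1.
  have := @is_derive1_comp _ (@sin R) (fun x : R => f * x) 0 _ _ h l.
  by rewrite mulr0 cos0 /GRing.scale/= mul1r.
have [d d0 Hd] := is_derive_expansion D e0.
near=> N.
have N0 : 0 < N%:R :> R by rewrite ltr0n; near: N; exact: nbhs_infty_gt.
have hN : 0 < (N%:R^-1 : R) < d.
  apply/andP; split; first by rewrite invr_gt0.
  rewrite -[ltRHS]invrK ltf_pV2 ?posrE ?invr_gt0//.
  by near: N; exact: nbhs_infty_gtr.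
have := Hd _ hN; rewrite add0r mulr0 sin0 subr0 => H.
have N1 : 0 < (N%:R^-1 : R) by rewrite invr_gt0.
rewrite distrC -(ler_pM2l N1).
rewrite -[X in X * `|_|](ger0_norm (ltW N1)) -normrM mulrBr mulKf ?gt_eqF//.
Unshelve. all: by end_near.
Qed.

(** The half-angle formula writes the rate as the square of 2 N sin(freq k / (2 N)), whose limit is
    [freq k]. *)
Lemma disc_rate_cvg k : (fun N => @disc_rate R N k) @ \oo --> freq k ^+ 2.
Proof.
have E N : @disc_rate R N k =
    (2 * (N%:R * sin (freq k / 2 * N%:R^-1))) * (2 * (N%:R * sin (freq k / 2 * N%:R^-1))).
  rewrite /disc_rate (_ : cos (angle k) = 1 - 2 * sin (freq k / 2 * N%:R^-1) ^+ 2); first by ring.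
  rewrite /angle /dx (_ : freq k * N%:R^-1 = (freq k / 2 * N%:R^-1) + (freq k / 2 * N%:R^-1)); last by rewrite -mulrDl -splitr.
  by rewrite cosD -!expr2 cos2sin2; ring.
under eq_cvg do rewrite E.
have : (fun N => 2 * (N%:R * sin (freq k / 2 * N%:R^-1))) @ \oo --> (2 * (freq k / 2) : R).
  by apply: cvgMr; exact: natr_sin_cvg.
rewrite mulrCA divff ?mulr1// => h.
by rewrite expr2; exact: (cvgM h h).
Qed.

(** With kappa = 1 the prefactor alpha_N N^2 is alpha N, exactly what balances the sine of an angle
    of order 1 / N. *)
Lemma disc_drift_cvg (alpha : R) k :
  (fun N => @disc_drift R N alpha 1 k) @ \oo --> 2 * alpha * freq k.
Proof.
have h : (fun N => (2 * alpha) * (N%:R * sin (freq k * N%:R^-1))) @ \oo --> (2 * alpha * freq k : R).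
  by apply: cvgMr; exact: natr_sin_cvg.
apply: cvg_trans h; apply: near_eq_cvg; near=> N.
have N0 : (0 < N)%N by near: N; exact: nbhs_infty_gt.
have Nn : N%:R != 0 :> R by rewrite pnatr_eq0 -lt0n.
rewrite /disc_drift /alpha_seq powRN powRr1// /angle /dx.
by field.
Unshelve. all: by end_near.
Qed.

Lemma decay_cvg (a b : R^nat) (a0 b0 x y t : R) : a @ \oo --> a0 -> b @ \oo --> b0 ->
  (fun N => decay_cos (a N) (b N) x y t) @ \oo --> decay_cos a0 b0 x y t /\
  (fun N => decay_sin (a N) (b N) x y t) @ \oo --> decay_sin a0 b0 x y t.
Proof.
move=> ha hb.
have he : (fun N => expR (- a N * t)) @ \oo --> expR (- a0 * t).
  have h : (fun N => - a N * t) @ \oo --> - a0 * t by apply: cvgMl; exact: cvgN.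
  exact: (cvg_comp _ _ h (@continuous_expR R (- a0 * t))).
have hbt : (fun N => b N * t) @ \oo --> b0 * t by exact: cvgMl.
have hc : (fun N => cos (b N * t)) @ \oo --> cos (b0 * t).
  exact: (cvg_comp _ _ hbt (@continuous_cos R (b0 * t))).
have hs : (fun N => sin (b N * t)) @ \oo --> sin (b0 * t).
  exact: (cvg_comp _ _ hbt (@continuous_sin R (b0 * t))).
by split; apply: cvgM => //; [apply: cvgD|apply: cvgB]; exact: cvgMl.
Qed.

End discrete_limits.

(** * Sequences of events with vanishing probability *)

Section vanishing_events.
Context {R : realType} {d : nat -> measure_display} {W : forall N, measurableType (d N)}.
Variable P : forall N, probability (W N) R.
Implicit Types S T : forall N, set (W N).

(** Measurability is bundled because monotonicity and subadditivity use it, and is asked only for N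
    > 0, where the process is given. *)
Definition vanishing S := (forall N, (0 < N)%N -> measurable (S N)) /\
  forall e : R, 0 < e -> \forall N \near \oo, (P N (S N) <= e%:E)%E.

Lemma vanishing_sub S T : (forall N, (0 < N)%N -> measurable (S N)) ->
  (\forall N \near \oo, S N `<=` T N) -> vanishing T -> vanishing S.
Proof.
move=> mS ST [mT vT]; split=> // e e0; near=> N.
have N0 : (0 < N)%N by near: N; exact: nbhs_infty_gt.
have h : (P N (T N) <= e%:E)%E by near: N; exact: vT.
apply: le_trans h; apply: le_measure; rewrite ?inE; [exact: mS|exact: mT|].
by near: N.
Unshelve. all: by end_near.
Qed.

Lemma vanishingU S T : vanishing S -> vanishing T -> vanishing (fun N => S N `|` T N).
Proof.
move=> [mS vS] [mT vT]; split=> [N N0|e e0].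
  by apply: measurableU; [exact: mS|exact: mT].
have e20 : 0 < e / 2 by rewrite divr_gt0.
near=> N.
have N0 : (0 < N)%N by near: N; exact: nbhs_infty_gt.
have h1 : (P N (S N) <= (e / 2)%:E)%E by near: N; exact: vS.
have h2 : (P N (T N) <= (e / 2)%:E)%E by near: N; exact: vT.
apply: (le_trans (measureU2 (P N) (mS N N0) (mT N N0))).
by rewrite [e]splitr EFinD; apply: leeD.
Unshelve. all: by end_near.
Qed.

Lemma vanishing_cvg S : vanishing S -> (fun N => P N (S N)) @ \oo --> 0%E.
Proof.
move=> [mS vS].
have fin N : (0 < N)%N -> P N (S N) \is a fin_num.
  by move=> N0; apply: fin_num_measure; exact: mS.
apply/fine_cvgP; split.
  by near=> N; apply: fin; near: N; exact: nbhs_infty_gt.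
apply/cvgrPdist_le => e e0; near=> N.
have N0 : (0 < N)%N by near: N; exact: nbhs_infty_gt.
rewrite sub0r normrN ger0_norm ?fine_ge0//= -lee_fin fineK ?fin//.
by near: N; exact: vS.
Unshelve. all: by end_near.
Qed.

End vanishing_events.

(** * Convergence of the empirical measure at a fixed time *)

Section hydrodynamic_limit.
Context {R : realType}.
Variables (alpha M : R) (v0 : R -> R).
Hypotheses (mv0 : measurable_fun setT v0) (pv0 : periodic1 v0)
  (v0M : forall u, `|v0 u| <= M).
Variable mu : forall N, probability (config R N) R.
Hypotheses (hmu : associated mu v0) (hIM : assumption_IM mu).
Context {d : nat -> measure_display} {W : forall N, measurableType (d N)}.
Variables (P : forall N, probability (W N) R)
  (eta : forall N, W N -> cadlag (config R N)).
Arguments eta : clear implicits.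
Hypothesis heta : forall N, (0 < N)%N ->
  is_markov_process (P N) (eta N) (mu N) (@generator R alpha 1 N).
Variable t : R.
Hypothesis t0 : 0 <= t.

Local Notation v := (heat_sol alpha v0).

Lemma measurable_deviation (f : forall N, config R N -> R) (y dl : R) :
  (forall N, (0 < N)%N -> measurable_fun setT (f N)) ->
  forall N, (0 < N)%N -> measurable [set w | dl < `|f N (eta N w t) - y|].
Proof.
move=> mf N N0; have [meta _ _] := heta N0.
apply: (@measurable_event _ _ _ _ (eta N) meta t [set z | dl < `|f N z - y|]) => //.
apply: measurable_strict_superlevel; apply: measurableT_comp => //.
by apply: measurable_funB => //; exact: mf.
Qed.

Lemma measurable_empirical_form G N : measurable_fun setT (fun z : config R N => empirical_form z G).
Proof.
apply: measurable_funM => //; apply: measurable_sum => x.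
by apply: measurable_funM => //; exact: measurable_config_coord.
Qed.

Lemma initial_mode G (rho e : R) : periodic1 G -> continuous G -> 0 < rho -> 0 < e ->
  \forall N \near \oo, (mu N [set z | (rho < `|empirical_form z G -
    circle_integral (fun u => v0 u * G u)|)%R] <= e%:E)%E.
Proof.
move=> pG cG rho0 e0; have /fine_cvgP[_ /cvgrPdist_le/(_ _ e0) H] := hmu pG cG rho0.
near=> N.
have h : `|fine (mu N [set z | rho < `|empirical_form z G -
    circle_integral (fun u => G u * v0 u)|])| <= e.
  by near: N; apply: filterS H => n; rewrite /= sub0r normrN.
move: h; rewrite ger0_norm ?fine_ge0// -lee_fin fineK ?fin_num_measure//; last first.
  apply: measurable_strict_superlevel; apply: measurableT_comp => //.
  by apply: measurable_funB => //; exact: measurable_empirical_form.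
have -> // : (fun u => G u * v0 u) = fun u => v0 u * G u.
by apply/funext => u; rewrite mulrC.
Unshelve. all: by end_near.
Qed.

(** The probability e is split into four quarters: initial energy, the two initial modes, and the
    Chebyshev term. The distance is at most dl / 4 for Chebyshev, 2 (dl / 8) for the initial modes
    and dl / 4 for the convergence of the discrete flow, which stays below dl. *)
Lemma modes_vanishing k dl : 0 < dl ->
  vanishing P (fun N => [set w | dl < `|mode_cos k (eta N w t) - heat_cos alpha v0 k t|]) /\
  vanishing P (fun N => [set w | dl < `|mode_sin k (eta N w t) - heat_sin alpha v0 k t|]).
Proof.
move=> dl0.
have meas1 : forall N, (0 < N)%N ->
    measurable [set w | dl < `|mode_cos k (eta N w t) - heat_cos alpha v0 k t|].
  by apply: (measurable_deviation (f := fun N => @mode_cos R N k)) => N _; have [] := @measurable_modes R N k.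
have meas2 : forall N, (0 < N)%N ->
    measurable [set w | dl < `|mode_sin k (eta N w t) - heat_sin alpha v0 k t|].
  by apply: (measurable_deviation (f := fun N => @mode_sin R N k)) => N _; have [] := @measurable_modes R N k.
suff H e : 0 < e -> \forall N \near \oo,
    (P N [set w | (dl < `|mode_cos k (eta N w t) - heat_cos alpha v0 k t|)%R] <= e%:E)%E /\
    (P N [set w | (dl < `|mode_sin k (eta N w t) - heat_sin alpha v0 k t|)%R] <= e%:E)%E.
  by split; split=> // e /H; apply: filterS => N [].
move=> e0; have e40 : 0 < e / 4 by rewrite divr_gt0.
have [C C0 HC] := initial_energy_tail hIM.
pose K := C / (e / 4).
have K0 : 0 < K by rewrite divr_gt0.
(* At energy K N the Chebyshev term is at most D / N: for large N the rate is below
   [freq k ^+ 2 + 1], and K N + 1 <= (K + 1) N. *)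
pose D := t * (4 * (freq k ^+ 2 + 1) * (K + 1)) / (dl / 4) ^+ 2.
have dl40 : 0 < dl / 4 by rewrite divr_gt0.
have dl80 : 0 < dl / 8 by rewrite divr_gt0.
have D0 : 0 <= D.
  rewrite /D divr_ge0 ?sqr_ge0// mulr_ge0// !mulr_ge0//; first by rewrite addr_ge0// sqr_ge0.
  by rewrite addr_ge0// ltW.
have /cvgrPdist_le Hr := @disc_rate_cvg R k.
have [/cvgrPdist_le dc /cvgrPdist_le ds] := @decay_cvg R _ _ _ _ (fourier_cos v0 k) (fourier_sin v0 k) t (@disc_rate_cvg R k) (@disc_drift_cvg R alpha k).
near=> N.
have N0 : (0 < N)%N by near: N; exact: nbhs_infty_gt.
have N0' : 0 < N%:R :> R by rewrite ltr0n.
have N1 : 1 <= N%:R :> R by rewrite ler1n.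
have [E1 E2] := @mode_event _ _ _ _ _ _ _ _ _ N0 (heta N0) k _ _ _ (fourier_cos v0 k) (fourier_sin v0 k) t t0 dl40
  (ltW (mulr_gt0 K0 N0')) (ltW dl80).
have h1 : (mu N [set z | (K * N%:R < energy2 z)%R] <= (e / 4)%:E)%E.
  have -> : e / 4 = C / K by rewrite /K invf_div mulrCA divff ?mulr1// gt_eqF.
  (* Generalizing over K turns the goal into the very statement that [HC] provides near infinity. *)
  by move: (K) (K0); near: N.
have h2 : (mu N [set z | (dl / 8 < `|mode_cos k z - fourier_cos v0 k|)%R] <= (e / 4)%:E)%E.
  near: N; apply: initial_mode => //; [exact: periodic_ecos|exact: continuous_ecos].
have h3 : (mu N [set z | (dl / 8 < `|mode_sin k z - fourier_sin v0 k|)%R] <= (e / 4)%:E)%E.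
  near: N; apply: initial_mode => //; [exact: periodic_esin|exact: continuous_esin].
have ha : @disc_rate R N k <= freq k ^+ 2 + 1.
  have : `|freq k ^+ 2 - @disc_rate R N k| <= 1.
    by near: N; exact: Hr.
  by rewrite ler_norml => /andP[]; lra.
have h4 : t * (4 * @disc_rate R N k * (K * N%:R + 1) / N%:R ^+ 2) / (dl / 4) ^+ 2 <= e / 4.
  apply: (@le_trans _ _ (D / N%:R)).
    have -> : D / N%:R = t * (4 * (freq k ^+ 2 + 1) * (K + 1) / N%:R) / (dl / 4) ^+ 2.
      by rewrite /D; field; rewrite !gt_eqF.
    rewrite ler_wpM2r ?invr_ge0 ?sqr_ge0// ler_wpM2l//.
    rewrite ler_pdivrMr ?exprn_gt0//.
    have -> : 4 * (freq k ^+ 2 + 1) * (K + 1) / N%:R * N%:R ^+ 2 =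
        4 * (freq k ^+ 2 + 1) * ((K + 1) * N%:R) by field; rewrite gt_eqF.
    apply: ler_pM.
    - by rewrite mulr_ge0// disc_rate_ge0.
    - by rewrite addr_ge0// mulr_ge0// ltW.
    - by rewrite ler_wpM2l.
    - by rewrite mulrDl mul1r lerD2l.
  rewrite ler_pdivrMr// mulrC -ler_pdivrMr//; near: N; exact: nbhs_infty_ger.
have hc : `|heat_cos alpha v0 k t - decay_cos (@disc_rate R N k) (@disc_drift R N alpha 1 k)
    (fourier_cos v0 k) (fourier_sin v0 k) t| <= dl / 4.
  by near: N; exact: dc.
have hs : `|heat_sin alpha v0 k t - decay_sin (@disc_rate R N k) (@disc_drift R N alpha 1 k)
    (fourier_cos v0 k) (fourier_sin v0 k) t| <= dl / 4.
  by near: N; exact: ds.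
have tot : (mu N [set z | (K * N%:R < energy2 z)%R]
    + mu N [set z | (dl / 8 < `|mode_cos k z - fourier_cos v0 k|)%R]
    + mu N [set z | (dl / 8 < `|mode_sin k z - fourier_sin v0 k|)%R]
    + (t * (4 * @disc_rate R N k * (K * N%:R + 1) / N%:R ^+ 2) / (dl / 4) ^+ 2)%:E <= e%:E)%E.
  have -> : e = e / 4 + e / 4 + e / 4 + e / 4 by field.
  by rewrite !EFinD; apply: leeD => //; apply: leeD => //; apply: leeD.
have [meta _ _] := heta N0.
have fin (f : config R N -> R) (y y' : R) : measurable_fun setT f -> `|y - y'| <= dl / 4 ->
    measurable [set w | dl < `|f (eta N w t) - y|] ->
    (P N [set w | (dl < `|f (eta N w t) - y|)%R] <=
     P N [set w | (dl / 4 + 2 * (dl / 8) <= `|f (eta N w t) - y'|)%R])%E.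
  move=> mf yy mS; apply: le_measure; rewrite ?inE//.
    apply: (@measurable_event _ _ _ _ (eta N) meta t [set z | dl / 4 + 2 * (dl / 8) <= `|f z - y'|]) => //.
    by apply: measurable_superlevel; apply: measurableT_comp => //; exact: measurable_funB.
  move=> w /= hw; have := ler_distD y' (f (eta N w t)) y.
  rewrite (distrC y' y); lra.
have [mc ms] := @measurable_modes R N k.
split.
- by apply: le_trans (fin _ _ _ mc hc (meas1 N N0)) _; exact: le_trans E1 tot.
- by apply: le_trans (fin _ _ _ ms hs (meas2 N N0)) _; exact: le_trans E2 tot.
Unshelve. all: by end_near.
Qed.


(** Adding one mode splits the deviation into three parts of dl / 3: cosine, sine and the rest. The
    thresholds are divided by |a| + 1 and |b| + 1 so that zero coefficients need no separate
    case. *)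
Lemma empirical_vanishing_trigpoly p dl : trigpoly p -> 0 < dl ->
  vanishing P (fun N => [set w | dl <
    `|empirical_form (eta N w t) p - circle_integral (fun u => v t u * p u)|]).
Proof.
have [vi _ _ _] := heat_sol_moments alpha mv0 v0M t0.
move=> tp; elim: tp dl => [|k a b {}p tp IH] dl dl0.
  apply: (vanishing_sub (T := fun=> set0)).
  - by apply: (measurable_deviation (f := fun N z => empirical_form z (fun=> 0))) => N _;
      exact: measurable_empirical_form.
  - apply: nearW => N w /=; rewrite /empirical_form.
    under eq_bigr do rewrite mulr0; rewrite big1// mulr0.
    have -> : (fun u => v t u * 0) = (fun=> 0) by apply/funext => u; rewrite mulr0.
    by rewrite circle_integral_cst subrr normr0 ltNge (ltW dl0).
  - by split=> // e e0; apply: nearW => N; rewrite measure0 lee_fin ltW.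
have dl30 : 0 < dl / 3 by rewrite divr_gt0.
have thr (x : R) : 0 < dl / 3 / (`|x| + 1) by rewrite divr_gt0// ltr_wpDl.
have [vc _] := modes_vanishing k (thr a).
have [_ vs] := modes_vanishing k (thr b).
apply: vanishing_sub (vanishingU (vanishingU vc vs) (IH _ dl30)).
  by apply: (measurable_deviation (f := fun N z => empirical_form z _)) => N _;
    exact: measurable_empirical_form.
apply: nearW => N w /=.
have cp : continuous p by exact/smooth_cont/trigpoly_smooth.
have cm : continuous (fun u => a * ecos k u + b * esin k u).
  move=> u; apply: cvgD; apply: cvgMr; [exact: continuous_ecos|exact: continuous_esin].
have -> : circle_integral (fun u => v t u * (a * ecos k u + b * esin k u + p u)) =
    a * heat_cos alpha v0 k t + b * heat_sin alpha v0 k t + circle_integral (fun u => v t u * p u).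
  have [<- <-] := fourier_heat_sol alpha mv0 v0M k t0.
  rewrite -circle_integral_mode// -circle_integralD; [|exact: circle_integrableMl..].
  by congr circle_integral; apply/funext => u; rewrite mulrDr.
have -> : empirical_form (eta N w t) (fun u => a * ecos k u + b * esin k u + p u) =
    a * mode_cos k (eta N w t) + b * mode_sin k (eta N w t) + empirical_form (eta N w t) p.
  rewrite /mode_cos /mode_sin /empirical_form !mulr_sumr -!big_split/=.
  by apply: eq_bigr => x _; ring.
have bnd (x r y : R) : `|r - y| <= dl / 3 / (`|x| + 1) -> `|x * (r - y)| <= dl / 3.
  have x1 : 0 < `|x| + 1 by rewrite ltr_wpDl.
  rewrite ler_pdivlMr// => h; rewrite normrM mulrC; apply: le_trans h.
  by rewrite ler_wpM2l// lerDl.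
set mc := mode_cos k _; set ms := mode_sin k _; set ep := empirical_form _ p.
set hc := heat_cos _ _ _ _; set hs := heat_sin _ _ _ _; set ip := circle_integral _.
move=> dlt.
have [h3|h3] := ltP (dl / 3) `|ep - ip|; first by right.
have [h1|h1] := ltP (dl / 3 / (`|a| + 1)) `|mc - hc|; first by left; left.
have [h2|h2] := ltP (dl / 3 / (`|b| + 1)) `|ms - hs|; first by left; right.
exfalso; move: dlt; rewrite (_ : _ - _ = a * (mc - hc) + b * (ms - hs) + (ep - ip)); last by ring.
rewrite ltNge => /negP; apply.
apply: le_trans (ler_normD _ _) _; apply: le_trans (lerD (ler_normD _ _) (lexx _)) _.
have := bnd _ _ _ h1; have := bnd _ _ _ h2; lra.
Qed.

(** G is replaced by a Fejer mean uniformly close to it. On the particle side the cost is controlled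
    by the average of |eta(x)|, hence by the energy over N; on the limit side by the L^1 norm of the
    solution. Both factors are fixed before the degree of the Fejer mean is chosen. *)
Lemma empirical_vanishing G dl : periodic1 G -> continuous G -> 0 < dl ->
  vanishing P (fun N => [set w | dl <
    `|empirical_form (eta N w t) G - circle_integral (fun u => v t u * G u)|]).
Proof.
move=> pG cG dl0.
have mS : forall N, (0 < N)%N -> measurable [set w | dl <
    `|empirical_form (eta N w t) G - circle_integral (fun u => v t u * G u)|].
  by apply: (measurable_deviation (f := fun N z => empirical_form z G)) => N _;
    exact: measurable_empirical_form.
have [vi _ _ _] := heat_sol_moments alpha mv0 v0M t0.
split=> // e e0; have e20 : 0 < e / 2 by rewrite divr_gt0.
have [C C0 HC] := initial_energy_tail hIM.
pose K := C / (e / 2).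
have K0 : 0 < K by rewrite divr_gt0.
(* K + 2 bounds 1 + energy / N when the energy is below K N + 1, and 1 + M^2 bounds the L^1 norm of
   the limit; the two errors together are then at most dl / 2. *)
pose A := (K + 2) + (1 + M ^+ 2).
have A0 : 0 < A by have := sqr_ge0 M; rewrite /A; lra.
have d0 : 0 < dl / 2 / A by rewrite !divr_gt0.
have [n0 /(_ n0.+1) Hn] := fejer_cvg pG cG d0.
set p := fejer n0.+1 G in Hn.
have tp : trigpoly p by exact: trigpoly_fejer.
have cp : continuous p by exact/smooth_cont/trigpoly_smooth.
have dl20 : 0 < dl / 2 by rewrite divr_gt0.
have [mT vT] := empirical_vanishing_trigpoly tp dl20.
have pG_le u : `|p u - G u| <= dl / 2 / A by exact: Hn.
have I1 : `|circle_integral (fun u => v t u * p u) - circle_integral (fun u => v t u * G u)|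
    <= dl / 2 / A * (1 + M ^+ 2).
  have i1 := circle_integrableMl vi cp; have i2 := circle_integrableMl vi cG.
  rewrite -circle_integralB//.
  apply: le_trans (circle_integral_norm _) _; first exact: circle_integrableB.
  apply: (@le_trans _ _ (circle_integral (fun u => dl / 2 / A * `|v t u|))).
    apply: circle_integral_le.
    - by apply: circle_integrable_norm; exact: circle_integrableB.
    - by apply: circle_integrableZ; exact: circle_integrable_norm.
    - by move=> u _; rewrite -mulrBr normrM mulrC ler_wpM2r.
  rewrite circle_integralZ; last exact: circle_integrable_norm.
  by rewrite ler_wpM2l ?(ltW d0)//; exact: heat_sol_norm.
near=> N.
have N0 : (0 < N)%N by near: N; exact: nbhs_infty_gt.
have N0' : 0 < N%:R :> R by rewrite ltr0n.
have N1 : 1 <= N%:R :> R by rewrite ler1n.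
have h1 : (mu N [set z | (K * N%:R < energy2 z)%R] <= (e / 2)%:E)%E.
  have -> : e / 2 = C / K by rewrite /K invf_div mulrCA divff ?mulr1// gt_eqF.
  by move: (K) (K0); near: N.
have h2 : (P N [set w | (dl / 2 < `|empirical_form (eta N w t) p -
    circle_integral (fun u => v t u * p u)|)%R] <= (e / 2)%:E)%E.
  by near: N; exact: vT.
have [meta _ _] := heta N0.
have mE : measurable [set w | K * N%:R + 1 <= energy2 (eta N w t)].
  apply: (@measurable_event _ _ _ _ (eta N) meta t [set z | K * N%:R + 1 <= energy2 z]) => //.
  by apply: measurable_superlevel; exact: measurable_energy2.
have h3 := le_trans (energy_event (heta N0) (K * N%:R) t0) h1.
have -> : e = e / 2 + e / 2 by exact: splitr.
rewrite EFinD; apply: le_trans (leeD h3 h2).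
apply: le_trans (measureU2 (P N) mE (mT N N0)); apply: le_measure; rewrite ?inE.
- exact: mS.
- by apply: measurableU => //; exact: mT.
move=> w /= dlt.
set z : config R N := eta N w t in dlt *.
have [hE|hE] := leP (K * N%:R + 1) (energy2 z); first by left.
right; rewrite ltNge; apply/negP => hp; move: dlt; rewrite ltNge => /negP; apply.
have E1 : `|empirical_form z G - empirical_form z p| <= dl / 2 / A * (K + 2).
  rewrite /empirical_form -mulrBr -sumrB normrM ger0_norm ?invr_ge0//.
  rewrite ler_pdivrMl//; apply: le_trans (ler_norm_sum _ _ _) _.
  apply: (@le_trans _ _ (\sum_(x < N) dl / 2 / A * (1 + z ord0 x ^+ 2))).
    apply: ler_sum => x _; rewrite -mulrBr normrM mulrC distrC; apply: ler_pM => //.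
    by have := sqr_ge0 (`|z ord0 x| - 1); rewrite -[z ord0 x ^+ 2]real_normK ?num_real//; nra.
  rewrite -mulr_sumr mulrCA ler_wpM2l ?(ltW d0)// big_split/= sumr_const card_ord -/(energy2 z).
  nra.
have -> : empirical_form z G - circle_integral (fun u => v t u * G u) =
  (empirical_form z G - empirical_form z p)
  + (empirical_form z p - circle_integral (fun u => v t u * p u))
  + (circle_integral (fun u => v t u * p u) - circle_integral (fun u => v t u * G u)) by ring.
apply: le_trans (ler_normD _ _) _; apply: le_trans (lerD (ler_normD _ _) (lexx _)) _.
have := lerD (lerD E1 hp) I1; move/le_trans; apply.
rewrite addrAC -mulrDr -/A divfK ?gt_eqF// -splitr//.
Unshelve. all: by end_near.
Qed.

End hydrodynamic_limit.

Theorem theorem2p7 (R : realType) (T alpha kappa : R)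
  (hT : 0 < T) (halpha : 0 < alpha) (hkappa : kappa = 1)
  (v0 : R -> R) (hv0 : periodic1 v0) (hv0_meas : measurable_fun setT v0)
  (hv0_bdd : exists M, forall u, `|v0 u| <= M)
  (mu : forall N, probability (config R N) R)
  (hmu : associated mu v0) (hIM : assumption_IM mu)
  (d : nat -> measure_display) (W : forall N, measurableType (d N))
  (P : forall N, probability (W N) R)
  (eta : forall N, W N -> cadlag (config R N))
  (heta : forall N, (0 < N)%N ->
     is_markov_process (P N) (eta N) (mu N) (@generator R alpha kappa N))
  (m : nat) (hm : 5 / 2 < m%:R :> R) :
  exists v : R -> R -> R,
    [/\ weak_solution T alpha v0 v,
        forall w, weak_solution T alpha v0 w ->
          forall t, 0 <= t <= T ->
          {ae (@lebesgue_measure R), forall u, u \in `[0, 1] -> w t u = v t u} &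
        forall t, 0 <= t <= T ->
        forall (delta : R) (G : R -> R), 0 < delta -> C2_circle G ->
          empirical_law (P N) (eta N) hm
            [set pi : skorohod T m |
               delta < `|dual_pairing (pi t) G -
                         circle_integral (fun u => v t u * G u)|]
            @[N --> \oo] --> 0%E].
Proof.
subst kappa; case: hv0_bdd => M v0M.
have wv := heat_sol_weak_solution alpha hT hv0 hv0_meas v0M.
exists (heat_sol alpha v0); split=> // [w ww t tT|t /andP[t0 _] delta G delta0 G2].
  exact: weak_solution_unique ww wv t tT.
have [pG dG _ _] := G2.
have cG : continuous G.
  by move=> u; apply/differentiable_continuous/derivable1_diffP.
have := vanishing_cvg (empirical_vanishing hv0_meas v0M hmu hIM heta t0 pG cG delta0).
(* For N > 0 the event on Skorohod paths, pulled back along the empirical path at time t, is the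
   event on configurations, because the pairing is the empirical form. *)
apply: cvg_trans; apply: near_eq_cvg; near=> N.
have N0 : (0 < N)%N by near: N; exact: nbhs_infty_gt.
rewrite /empirical_law /pushforward/=; congr (P N _).
by apply/funext => w /=; rewrite dual_pairing_empirical.
Unshelve. all: by end_near.
Qed.
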